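(* Assume that: (i) there exists $y^\ast=\operatorname{argmax}\{g(x)/\psi(x)\}\in\mathcal I$; (ii) $(\mathcal G_rg)(x)\le0$ for all $x\in[y^\ast,b)\setminus\mathcal P$; (iii) $g'(x+)\le g'(x-)$ for all $x\in[y^\ast,b)\cap\mathcal P$. Assume moreover that $\lim_{x\to b}g(x)/\psi(x)=0$ and that $g'$ is lower semicontinuous on $[y^\ast,b)$. Then, for all $x\in\mathcal I$, $$V(x)=V_{y^\ast}(x)=J_{y^\ast}(x)=\mathbb E_x\big[\hat f(M_T)\mathbf 1_{[y^\ast,b)}(M_T)\big].$$
   Context: Diffusion. $X=\{X_t;\,t\in[0,\xi)\}$ is a linear, time-homogeneous, regular diffusion on $\mathcal I=(a,b)\subset\mathbb R$ with possibly infinite lifetime $\xi$, drift coefficient $\mu:\mathcal I\to\mathbb R$ and volatility coefficient $\sigma:\mathcal I\to(0,\infty)$, both continuous. $X$ does not die inside $\mathcal I$; the boundaries $a,b$ are natural, entrance, exit or regular, a regular boundary being killing (the process is sent to a cemetery state $\partial\notin\mathcal I$ on hitting it). Functions on $\mathcal I$ are taken to vanish at $\partial$. $r>0$ is a constant, and $T\sim\mathrm{Exp}(r)$ is independent of $X$. $M_t=\sup\{X_s; s\in[0,t]\}$ is the running supremum. $(\mathcal G_rf)(x)=\frac12\sigma^2(x)f''(x)+\mu(x)f'(x)-rf(x)$. $\psi$ is the (unique up to a positive multiple) positive increasing fundamental solution of $\mathcal G_ru=0$ satisfying the boundary conditions of $X$, so that $\mathbb E_x[e^{-r\tau_z}]=\psi(x)/\psi(z)$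 for $x\le z$, where $\tau_z=\inf\{t\ge0:X_t\ge z\}$. Payoff. $g:\mathcal I\to\mathbb R$ is continuous, $g^{-1}((0,\infty))=(x_g,b)\ne\emptyset$ for some $x_g\in\mathcal I$, $\mathbb E_x[\sup_{t\ge0}e^{-rt}g(X_t)]<\infty$ for all $x\in\mathcal I$, and $g$ is twice continuously differentiable on $\mathcal I\setminus\mathcal P$, where $\mathcal P\subset\mathcal I$ is a finite set with $|g'(x\pm)|<\infty$ and $|g''(x\pm)|<\infty$ for $x\in\mathcal P$. At points $x\in\mathcal P$, $g'(x)$ is understood as the right-hand derivative $g'(x+)$. Functionals. $V(x)=\sup_\tau\mathbb E_x[e^{-r\tau}g(X_\tau)]$ (supremum over stopping times), $\hat f(x)=g(x)-\psi(x)g'(x)/\psi'(x)$, and for $y\in g^{-1}((0,\infty))$, $$V_y(x)=\mathbb E_x[e^{-r\tau_y}g(X_{\tau_y});\tau_y<\infty]=\begin{cases}g(x),&x\ge y,\\ \psi(x)\,g(y)/\psi(y),&x<y,\end{cases}$$ $$J_y(x)=\mathbb E_x\big[\hat f(M_T)\mathbf 1_{[y,b)}(M_T)\big]=\psi(x)\int_{x\vee y}^b\hat f(z)\frac{\psi'(z)}{\psi^2(z)}\,dz$$ (the integral being understood as improper at $b$). *)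

(* Defs.v *)
From HB Require Import structures.
From mathcomp Require Import all_boot all_order all_algebra.
From mathcomp Require Import all_classical all_reals all_analysis.
From mathcomp Require Import measurable_realfun.
Set Implicit Arguments.
Unset Strict Implicit.
Unset Printing Implicit Defensive.
Import Order.TTheory GRing.Theory Num.Theory.
Import numFieldNormedType.Exports.
Local Open Scope classical_set_scope.
Local Open Scope ring_scope.

Section Calculus.
Context {R : realType}.
Implicit Types (a b : \bar R) (I : set R) (f g psi mu sigma : R -> R) (x y : R).

Definition state_space a b : set R := [set x | (a < x%:E < b)%E].

(* For I = (a, b), these are the filters x -> a+ and x -> b-, uniformly in
   whether the endpoint is finite. *)
Definition lower_end I : set_system R :=
  filter_from I (fun c => [set x | I x /\ x < c]).
Definition upper_end I : set_system R :=
  filter_from I (fun c => [set x | I x /\ c < x]).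

Definition right_derive g x : R := lim (h^-1 * (g (x + h) - g x) @[h --> 0^'+]).
Definition left_derive g x : R := lim (h^-1 * (g (x + h) - g x) @[h --> 0^'-]).

Definition generator mu sigma f x : R :=
  2^-1 * sigma x ^+ 2 * derive1 (derive1 f) x + mu x * derive1 f x.

Definition generator_r mu sigma (r : R) f x : R :=
  generator mu sigma f x - r * f x.

Definition C2_at f x : Prop :=
  [/\ \forall z \near x, derivable f z 1,
      \forall z \near x, derivable (derive1 f) z 1 &
      {for x, continuous (derive1 (derive1 f))}].

Definition piecewise_C2 I (Pts : set R) g : Prop :=
  [/\ finite_set Pts, Pts `<=` I,
      forall x, I x -> {for x, continuous g},
      forall x, (I `\` Pts) x -> C2_at g x &
      forall p, Pts p ->
        [/\ cvg (derive1 g @ p^'+), cvg (derive1 g @ p^'-),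
            cvg (derive1 (derive1 g) @ p^'+) & cvg (derive1 (derive1 g) @ p^'-)]].

Definition lower_semicontinuous_on (A : set R) g : Prop :=
  lower_semicontinuous (fun x : subspace A => (g x)%:E).

(* g'(p) is the right-hand derivative at the exceptional points, hence
   everywhere, since the two agree where g is differentiable. *)
Definition fhat g psi x : R := g x - psi x * right_derive g x / derive1 psi x.

Definition J_density g psi x : R := fhat g psi x * derive1 psi x / psi x ^+ 2.

Definition J_partial g psi y x d : R :=
  psi x * \int[lebesgue_measure]_(z in `[Num.max x y, d]) J_density g psi z.

Definition J_integral I g psi y x : R :=
  lim (J_partial g psi y x d @[d --> upper_end I]).

Definition V_threshold_explicit g psi y x : R :=
  if x < y then psi x * (g y / psi y) else g x.

End Calculus.

Section Process.
Context {R : realType} {d : measure_display} {Omega : measurableType d}.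
(* The cemetery state is [None], and [oapp f 0] extends f by 0 to it. *)
Implicit Types (X : R -> Omega -> option R) (F : R -> set_system Omega)
  (P : R -> probability Omega R) (tau : Omega -> \bar R) (I : set R)
  (mu sigma g psi : R -> R) (T : Omega -> R).

Definition state_in X (t : R) (A : set R) : set Omega := X t @^-1` (Some @` A).

Definition transition P X (t : R) (A : set R) (x : R) : \bar R :=
  P x (state_in X t A).

Definition filtration F : Prop :=
  [/\ forall t : R, 0 <= t -> sigma_algebra setT (F t),
      forall t : R, 0 <= t -> F t `<=` measurable &
      forall s t : R, 0 <= s -> s <= t -> F s `<=` F t].

Definition stopping_time F tau : Prop :=
  (forall w, (0 <= tau w)%E) /\
  (forall t : R, 0 <= t -> F t [set w | (tau w <= t%:E)%E]).

Definition stopped_sigma_algebra F tau : set_system Omega :=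
  [set B | measurable B /\
    forall t : R, 0 <= t -> F t (B `&` [set w | (tau w <= t%:E)%E])].

Definition lifetime X (w : Omega) : \bar R :=
  ereal_inf [set t%:E | t in [set t : R | 0 <= t /\ X t w = None]].

Definition exits_at X (e : \bar R) (w : Omega) : Prop :=
  exists t : R, [/\ 0 < t, lifetime X w = t%:E &
    oapp EFin 0%E (X s w) @[s --> t^'-] --> e].

Definition accessible I P X (e : \bar R) : Prop :=
  exists2 x, I x & (0 < P x [set w | exits_at X e w])%E.

Definition visits X (z : R) : set Omega :=
  [set w | exists2 t : R, 0 <= t & X t w = Some z].

(* [dif_continuous] also forces {t | X t w <> None} to be open in [0, oo), so
   that it is [0, lifetime). [dif_death] says that a path of finite lifetime
   reaches a or b at that time: there is no killing inside (a, b), and a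
   boundary point that is reached sends the process to the cemetery. *)
Record diffusion (a b : \bar R) mu sigma F X P : Prop := Diffusion {
  dif_filtration : filtration F ;
  dif_state : forall (t : R) w (x : R), 0 <= t -> X t w = Some x -> state_space a b x ;
  dif_absorbed : forall (s t : R) w, 0 <= s -> s <= t -> X s w = None -> X t w = None ;
  dif_continuous : forall (t : R) w (x : R), 0 <= t -> X t w = Some x ->
    forall e : R, 0 < e -> \forall s \near t, (0 <= s)%R ->
      exists2 z, X s w = Some z & `|z - x| < e ;
  dif_death : forall w (t : R), 0 < t -> lifetime X w = t%:E ->
    exits_at X a w \/ exits_at X b w ;
  dif_adapted : forall (t : R) (A : set R), 0 <= t -> measurable A -> F t (state_in X t A) ;
  dif_start : forall x : R, state_space a b x -> P x (state_in X 0 [set x]) = 1%E ;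
  dif_kernel : forall (t : R) (A : set R), 0 <= t -> measurable A ->
    measurable_fun (state_space a b) (transition P X t A) ;
  (* P_x(B, X_{tau + t} \in A) = E_x[P_{X_tau}(X_t \in A); B] *)
  dif_strong_markov : forall (x : R) tau (t : R) (A : set R) (B : set Omega), state_space a b x ->
    stopping_time F tau -> 0 <= t -> measurable A ->
    stopped_sigma_algebra F tau B -> B `<=` [set w | (tau w < +oo)%E] ->
    P x (B `&` [set w | state_in X (fine (tau w) + t) A w]) =
    (\int[P x]_(w in B)
       oapp (transition P X t A) 0%E (X (fine (tau w)) w))%E ;
  dif_regular : forall x z : R, state_space a b x -> state_space a b z ->
    (0 < P x (visits X z))%E ;
  (* f(X_t) - \int_0^t (generator f)(X_u) du is a martingale under each P_x,
     for f of class C^2 with compact support in (a, b) *)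
  dif_martingale_problem : forall (f : R -> R) (c c' : R),
    state_space a b c -> state_space a b c' ->
    (forall z, C2_at f z) -> (forall z, ~ (c <= z <= c') -> f z = 0) ->
    forall (x s t : R) (B : set Omega), state_space a b x -> 0 <= s -> s <= t -> F s B ->
    (\int[P x]_(w in B) (oapp f 0%R (X t w) - oapp f 0%R (X s w) -
       \int[lebesgue_measure]_(u in `[s, t])
          oapp (generator mu sigma f) 0 (X u w))%:E = 0)%E }.

(* An entrance or natural a imposes nothing beyond positivity and
   monotonicity; the value at a+ has to vanish when a is reached. *)
Definition increasing_solution (a b : \bar R) mu sigma (r : R) P X psi : Prop :=
  let I := state_space a b in
  [/\ forall x, I x -> 0 < psi x,
      forall x z, I x -> I z -> x < z -> psi x < psi z,
      forall x, I x -> C2_at psi x,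
      forall x, I x -> generator_r mu sigma r psi x = 0 &
      accessible I P X a -> psi x @[x --> lower_end I] --> 0].

Definition hitting_time X (y : R) (w : Omega) : \bar R :=
  ereal_inf [set t%:E | t in
    [set t : R | 0 <= t /\ exists2 z, X t w = Some z & y <= z]].

Definition running_sup X (t : R) (w : Omega) : \bar R :=
  ereal_sup [set z%:E | z in
    [set z | exists s : R, [/\ 0 <= s, s <= t & X s w = Some z]]].

(* e^{- r tau} g(X_tau), read as 0 on {tau = +oo} *)
Definition stopped_payoff (r : R) g X tau (w : Omega) : R :=
  if tau w is t%:E then expR (- (r * t)) * oapp g 0 (X t w) else 0.

Definition value_function (r : R) g F X P (x : R) : \bar R :=
  ereal_sup [set \int[P x]_w (stopped_payoff r g X tau w)%:E
            | tau in stopping_time F]%E.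

Definition V_threshold (r : R) g X P (y x : R) : \bar R :=
  (\int[P x]_w (stopped_payoff r g X (hitting_time X y) w)%:E)%E.

Definition J_expectation (b : \bar R) g psi X P T (y x : R) : \bar R :=
  (\int[P x]_w (let m := running_sup X (T w) w in
     fhat g psi (fine m) * \1_([set m' | (y%:E <= m' < b)%E]) m)%:E)%E.

Definition integrable_sup_payoff I (r : R) g X P : Prop :=
  forall x, I x ->
  (\int[P x]_w ereal_sup
     [set (expR (- (r * t)) * oapp g 0%R (X t w))%:E | t in [set t : R | 0 <= t]%R]
   < +oo)%E.

Definition process_sigma_algebra X : set_system Omega :=
  <<s [set C | exists (t : R) (A : set R), [/\ 0 <= t, measurable A & C = state_in X t A]] >>.

Definition independent_exponential_time I (r : R) X P T : Prop :=
  [/\ measurable_fun setT T,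
      forall (x : R) (A : set R), I x -> measurable A ->
        P x (T @^-1` A) = exponential_prob r A &
      forall (x : R) (C : set Omega) (A : set R), I x -> process_sigma_algebra X C -> measurable A ->
        P x (C `&` T @^-1` A) = (P x C * P x (T @^-1` A))%E].

End Process.

(* Main.v *)
(**
Let [h = V_threshold_explicit g psi ystar], i.e. [c psi] left of [ystar] and [g]
to its right, with [c] the maximum of [g / psi]. It majorizes [g], solves
[generator_r h <= 0] off a finite set, and has concave kinks there (at [ystar]
because [c psi - g >= 0] attains its minimum). Smoothing [h] by second
differences of its double primitive gives test functions for the martingale
problem, so optional stopping, localization and Fatou's lemma yield
[E_x(e^(-r tau) h(X_tau)) <= h x] for every stopping time. Hence [V <= h], and
the hitting time of [ystar] attains [h], because the same argument for [psi]
and [- psi] gives [E_x(e^(-r tau_z)) = psi x / psi z].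

The last identity also is [P_x(M_T > z) = psi x / psi z]. Off the exceptional
points, [(- h / psi)' = fhat psi' / psi^2]; comparing increments over small
intervals shows that both [E_x(fhat(M_T); m < M_T <= v)] and
[psi x * \int_m^v fhat psi' / psi^2] equal [psi x (h m / psi m - h v / psi v)],
which tends to [psi x * h m / psi m] as [v] tends to [b]. The passage to the
limit in the expectation uses [fhat >= 0] on [[ystar, b)]: the Wronskian
[h psi' - psi h'], multiplied by the integrating factor
[exp (\int 2 mu / sigma^2)], is nondecreasing there, including across kinks,
and is nonnegative at [ystar].
*)

Require Import Defs.
From HB Require Import structures.
From mathcomp Require Import all_boot all_order all_algebra.
From mathcomp Require Import all_classical all_reals all_analysis.
From mathcomp Require Import measurable_realfun.
From mathcomp Require Import ring lra.
Set Implicit Arguments.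
Unset Strict Implicit.
Unset Printing Implicit Defensive.
Import Order.TTheory GRing.Theory Num.Theory.
Import numFieldNormedType.Exports.
Local Open Scope classical_set_scope.
Local Open Scope ring_scope.


(** * Monotonicity from one-sided behaviour *)

(** The one analytic handle on the paths is the martingale problem: deterministic times, events of
    [F s], and [C^2] functions with compact support in the state space; there is no Ito formula.
    Hence estimates are made on a time grid, a stopping time enters through adapted events saying
    whether it may still lie ahead, and general functions enter through cutoffs. The coefficients
    are merely continuous, so the generator does not commute with averaging. At each point it is
    compared with the operator whose coefficients are frozen there; on a compact interval this costs
    an arbitrarily small error. Death is invisible to a function of compact support, since the path
    leaves the support shortly before dying. Letting the support grow loses mass in general, so
    Fatou gives an inequality. For [psi] stopped at a level [z] the values stay bounded and the
    limit is exact; this is where the boundary condition at [a] is used. [fhat] jumps at kinks and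
    the law of the supremum is known through its tail only, so the two final integrals are handled
    by one Stieltjes-type lemma that needs bounds over subintervals and no density. *)

Section RealCalculus.
Context {R : realType}.
Implicit Types (f g h k q : R -> R) (x y z u v al be : R) (E : set R).

(** Continuous induction: the supremum of the points reachable from [al] is itself reachable,
    because the relation holds just to its left, and if it were below [be] it could be passed,
    because the relation holds just to its right. It turns local statements into global ones for
    monotonicity, uniform continuity and boundedness. *)
Lemma creep (Rl : R -> R -> Prop) al be : al <= be ->
  (forall u v w, al <= u -> u <= v -> v <= w -> w <= be ->
     Rl u v -> Rl v w -> Rl u w) ->
  (forall z, al <= z -> z <= be -> exists2 d, 0 < d &
     (forall v, z <= v -> v < z + d -> v <= be -> Rl z v) /\
     (forall u, z - d < u -> u <= z -> al <= u -> Rl u z)) ->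
  Rl al be.
Proof.
move=> ab tr loc.
pose S := [set v | [/\ al <= v, v <= be & Rl al v]].
have Sal : S al.
  split => //; have [d d0 [h _]] := loc _ (lexx al) ab.
  by apply: h => //; rewrite ltrDl.
have hS : has_sup S by split; [exists al|exists be => v [_ vb _]].
have sup_ge v : S v -> v <= sup S by move=> Sv; apply: sup_upper_bound.
have als : al <= sup S by exact: sup_ge.
have sbe : sup S <= be by apply: ge_sup; [exists al|move=> v [_ vb _]].
have [d d0 [hr hl]] := loc _ als sbe.
have [v [av vb Rv] dv] := sup_adherent d0 hS.
have vs : v <= sup S by exact: sup_ge.
have Rs : Rl al (sup S).
  by apply: (tr _ v) => //; exact: hl.
have [sb|] := ltP (sup S) be; last first.
  by move=> bs; have <- : sup S = be by apply/eqP; rewrite eq_le sbe.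
pose v' := Num.min be (sup S + d / 2).
have sv' : sup S < v' by rewrite lt_min sb ltrDl divr_gt0.
have v'b : v' <= be by rewrite ge_min lexx.
have : S v'.
  split => //; first exact: le_trans als (ltW sv').
  apply: (tr _ (sup S)) => //; first exact: ltW.
  apply: hr => //; first exact: ltW.
  by rewrite gt_min; apply/orP; right; rewrite ltrD2l gtr_pMr // invf_lt1 // ltr1n.
by move=> /sup_ge; rewrite leNgt sv'.
Qed.

Lemma cvg_le_bound T (F : set_system T) {FF : ProperFilter F} (p : T -> R) (l c : R) :
  p @ F --> l -> (\forall x \near F, p x <= c) -> l <= c.
Proof.
move=> pl pc; have <- := cvg_lim (@Rhausdorff R) pl.
by apply: limr_le => //; apply/cvg_ex; exists l.
Qed.

Lemma cvg_ge_bound T (F : set_system T) {FF : ProperFilter F} (p : T -> R) (l c : R) :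
  p @ F --> l -> (\forall x \near F, c <= p x) -> c <= l.
Proof.
move=> pl pc; have <- := cvg_lim (@Rhausdorff R) pl.
by apply: limr_ge => //; apply/cvg_ex; exists l.
Qed.

Lemma finite_set_dnbhs E z : finite_set E -> \forall x \near z^', ~ E x.
Proof.
move=> fE.
have cl : closed (E `\ z).
  have acc : accessible_space R by exact: hausdorff_accessible (@Rhausdorff R).
  by have /accessible_finite_set_closed := acc; apply; exact: finite_setD.
have : nbhs z (~` (E `\ z)).
  by apply: open_nbhs_nbhs; split; [exact: closed_openC|move=> /= -[_]; apply].
apply: filterS => x /= h xz Ex; apply: h; split=> //.
exact/eqP.
Qed.

Lemma nbhs_ballR z (A : set R) : nbhs z A ->
  exists2 d, 0 < d & forall x, `|x - z| < d -> A x.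
Proof.
move=> /nbhs_ballP [d /= d0 h]; exists d => // x xz; apply: h.
by rewrite /ball /= distrC.
Qed.

Lemma dnbhs_ballR z (A : set R) : z^' A ->
  exists2 d, 0 < d & forall x, x != z -> `|x - z| < d -> A x.
Proof.
rewrite /dnbhs /within /= => /nbhs_ballR [d d0 h]; exists d => // x xz xd.
exact: h.
Qed.

Lemma at_rightR z (A : set R) : z^'+ A ->
  exists2 d, 0 < d & forall x, z < x -> x < z + d -> A x.
Proof.
rewrite /at_right /within /= => /nbhs_ballR [d d0 h]; exists d => // x xz xd.
by apply: h => //; rewrite gtr0_norm ?subr_gt0 // ltrBlDl.
Qed.

Lemma at_leftR z (A : set R) : z^'- A ->
  exists2 d, 0 < d & forall x, z - d < x -> x < z -> A x.
Proof.
rewrite /at_left /within /= => /nbhs_ballR [d d0 h]; exists d => // x xz xd.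
by apply: h => //; rewrite ltr0_norm ?subr_lt0 // opprB ltrBlDl -ltrBlDr.
Qed.

(** Upward jumps are allowed: [q] is right-continuous, and its left limits may lie below its values.
    Minus the right derivative of a function with concave kinks is of this kind. A punctured ball
    around [z] avoids [E], so the sign of the derivative gives monotonicity on each side of [z], and
    the one-sided limits attach [z] itself. *)
Lemma nondecreasing_piecewise q E al be : al <= be -> finite_set E ->
  (forall z, al < z < be -> ~ E z -> derivable q z 1 /\ 0 <= derive1 q z) ->
  (forall z, al <= z -> z < be -> q x @[x --> z^'+] --> q z) ->
  (forall z, al < z -> z <= be ->
     exists2 l, q x @[x --> z^'-] --> l & l <= q z) ->
  q al <= q be.
Proof.
move=> ab fE dq rq lq; apply: (creep (Rl := fun u v => q u <= q v)) => //.
  by move=> u v w _ _ _ _; exact: le_trans.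
move=> z az zb.
have [d d0 hd] := dnbhs_ballR (finite_set_dnbhs z fE).
have incr s t : al < s -> s <= t -> t < be -> z - d < s -> t < z + d ->
    (z < s \/ t < z) -> q s <= q t.
  move=> als st tbe zs tz zst.
  have P x : x \in `[s, t] -> derivable q x 1 /\ 0 <= derive1 q x.
    rewrite in_itv /= => /andP[sx xt]; apply: dq.
      by rewrite (lt_le_trans als) //= (le_lt_trans xt).
    apply: hd; first by case: zst => h; apply/eqP; lra.
    by rewrite ltr_norml; apply/andP; split; lra.
  have sub x : x \in `]s, t[ -> x \in `[s, t].
    by rewrite !in_itv /= => /andP[/ltW -> /ltW ->].
  apply: (@ger0_derive1_ndecr _ q s t) => //.
  - by move=> x /sub /P[].
  - by move=> x /sub /P[].
  - by apply: derivable_within_continuous => x /P[].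
have right s : z < s -> s < z + d -> s < be -> q z <= q s.
  move=> zs sd sb.
  apply: (cvg_le_bound (rq z az (lt_trans zs sb))).
  near=> t; apply: incr => //.
  - by apply: le_lt_trans az _; near: t; exact: nbhs_right_gt.
  - by near: t; apply: nbhs_right_le.
  - by apply: lt_trans (_ : z < t); [lra|near: t; exact: nbhs_right_gt].
  - by left; near: t; exact: nbhs_right_gt.
have left s : z - d < s -> s < z -> al < s -> q s <= q z.
  move=> sd sz als; have [l ql lle] := lq z (lt_trans als sz) zb.
  apply: le_trans lle; apply: (cvg_ge_bound ql).
  near=> t.
  have tz : t < z by near: t; exact: nbhs_left_lt.
  apply: incr => //.
  - by near: t; exact: nbhs_left_ge.
  - exact: lt_le_trans tz zb.
  - lra.
  - by right.
exists d => //; split.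
- move=> v zv vd vb.
  have [->//|zv'] : z = v \/ z < v by move: zv; rewrite le_eqVlt => /orP[/eqP|]; tauto.
  have [vb'|bv] := ltP v be; first exact: right.
  have [l ql lle] := lq v (le_lt_trans az zv') vb; apply: le_trans lle.
  apply: (cvg_ge_bound ql).
  near=> s.
  have sv : s < v by near: s; exact: nbhs_left_lt.
  apply: right; [by near: s; exact: nbhs_left_gt|exact: lt_trans sv vd|exact: lt_le_trans sv vb].
- move=> u zu uz au.
  have [->//|uz'] : u = z \/ u < z by move: uz; rewrite le_eqVlt => /orP[/eqP|]; tauto.
  have [au'|ua] := ltP al u; first exact: left.
  apply: (cvg_le_bound (rq u au (lt_le_trans uz' zb))).
  near=> s.
  have us : u < s by near: s; exact: nbhs_right_gt.
  apply: left; [exact: lt_trans zu us|by near: s; exact: nbhs_right_lt|exact: le_lt_trans au us].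
Unshelve. all: by end_near.
Qed.
End RealCalculus.

(** * Compactness on segments and one-sided derivatives *)

Section RealCalculus2.
Context {R : realType}.
Implicit Types (f g h k q : R -> R) (x y z u v al be : R) (E : set R).

(** Moduli glue by taking the smaller radius, so [creep] applies. The second point [z] may leave the
    segment, as happens when smoothing looks slightly ahead of its argument. *)
Lemma uniform_continuity_segment k u v eta : u <= v -> 0 < eta ->
  (forall x, u <= x <= v -> {for x, continuous k}) ->
  exists2 e, 0 < e & forall x z, u <= x <= v -> `|z - x| < e ->
    `|k z - k x| <= eta.
Proof.
move=> uv eta0 ck.
apply: (creep (Rl := fun u v => exists2 e, 0 < e & forall x z, u <= x <= v ->
    `|z - x| < e -> `|k z - k x| <= eta)) => //.
- move=> u1 v1 w1 _ uv1 vw1 _ [e1 e10 h1] [e2 e20 h2].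
  exists (Num.min e1 e2); first by rewrite lt_min e10.
  move=> x z /andP[ux xw]; rewrite lt_min => /andP[l1 l2].
  have [xv|vx] := leP x v1; first by apply: h1 => //; rewrite ux.
  by apply: h2 => //; rewrite (ltW vx).
- move=> z uz zv.
  have : {for z, continuous k} by apply: ck; rewrite uz.
  move=> /cvgrPdist_lt /(_ (eta / 2)) /(_ (divr_gt0 eta0 (ltr0Sn _ 1))).
  move=> /nbhs_ballR [d d0 hd].
  have key x t : `|x - z| < d / 2 -> `|t - x| < d / 2 -> `|k t - k x| <= eta.
    move=> xz tx.
    have h1 : `|k z - k x| < eta / 2 by apply: hd; lra.
    have h2 : `|k z - k t| < eta / 2.
      apply: hd; have := ler_normD (t - x) (x - z); rewrite addrA subrK; lra.
    have := ler_normB (k z - k x) (k z - k t).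
    have -> : k z - k x - (k z - k t) = k t - k x by ring.
    lra.
  exists (d / 2); first exact: divr_gt0.
  split => w h1 h2 h3; exists (d / 2); rewrite ?divr_gt0 // => x t /andP[h4 h5].
  + by apply: key; rewrite ger0_norm ?subr_ge0 //; lra.
  + by apply: key; rewrite ler0_norm ?subr_le0 //; lra.
Qed.

(** The bound is asked on punctured neighbourhoods only, since second derivatives are controlled on
    the two sides of a kink but not at it; the value at the centre is added to the maximum. *)
Lemma locally_bounded_segment k u v : u <= v ->
  (forall z, u <= z <= v -> exists M, \forall x \near z^', `|k x| <= M) ->
  exists M, forall x, u <= x <= v -> `|k x| <= M.
Proof.
move=> uv lb.
apply: (creep (Rl := fun u v => exists M, forall x, u <= x <= v -> `|k x| <= M)) => //.
- move=> u1 v1 w1 _ uv1 vw1 _ [M1 h1] [M2 h2]; exists (Num.max M1 M2).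
  move=> x /andP[ux xw]; rewrite le_max.
  have [xv|vx] := leP x v1; first by rewrite h1 // ux.
  by rewrite h2 ?orbT // (ltW vx).
- move=> z uz zv; have [|M /dnbhs_ballR [d d0 hd]] := lb z; first by rewrite uz.
  have key x : `|x - z| < d -> `|k x| <= Num.max M `|k z|.
    move=> xd; rewrite le_max; have [->|xz] := eqVneq x z; first by rewrite lexx orbT.
    by rewrite hd.
  exists d => //; split => w h1 h2 h3; exists (Num.max M `|k z|) => x /andP[h4 h5].
  + by apply: key; rewrite ger0_norm ?subr_ge0 //; lra.
  + by apply: key; rewrite ler0_norm ?subr_le0 //; lra.
Qed.

Lemma derive1_is_derive f x d : is_derive x 1 f d -> derive1 f x = d.
Proof. by move=> fd; rewrite derive1E derive_val. Qed.

Lemma derivable_is_derive1 f x : derivable f x 1 -> is_derive x 1 f (derive1 f x).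
Proof. by move=> fd; rewrite derive1E; exact: derivableP. Qed.

Lemma is_derive_shift f x c d :
  is_derive (x + c) 1 f d -> is_derive x 1 (fun z => f (z + c)) d.
Proof.
move=> fd; have := @is_derive1_comp _ f (fun z => z + c) x d 1 fd.
rewrite mulr1; apply.
by apply: is_derive_eq; rewrite addr0.
Qed.

Lemma MVT_slope g p t : p != t ->
  (forall x, Num.min p t < x < Num.max p t -> derivable g x 1) ->
  {for p, continuous g} -> {for t, continuous g} ->
  exists2 c, Num.min p t < c < Num.max p t & (g t - g p) / (t - p) = derive1 g c.
Proof.
wlog pt : p t / p < t.
  move=> wl pt dg cp ct; have [lt|lt] := orP (lt_total pt); first exact: wl.
  have [| |c h1 h2] := wl t p lt _ _ ct cp; first by rewrite eq_sym.
    by rewrite minC maxC.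
  rewrite minC maxC in h1; exists c => //.
  by rewrite -h2 -(opprB (g t)) -(opprB t) invrN mulrNN.
move=> _; rewrite (min_idPl (ltW pt)) (max_idPr (ltW pt)) => dg cp ct.
have dg' x : x \in `]p, t[ -> derivable g x 1 by rewrite in_itv /=; exact: dg.
have cg : {within `[p, t], continuous g}.
  apply/(continuous_within_itvP _ pt); split => /=.
  - move=> x /dg' /derivable1_diffP dx; exact: differentiable_continuous.
  - by apply: cvg_at_right_filter; exact: cp.
  - by apply: cvg_at_left_filter; exact: ct.
have [c] := @MVT R g (derive1 g) p t pt (fun x xi => derivable_is_derive1 (dg' x xi)) cg.
rewrite in_itv /= => ci e; exists c => //.
by rewrite e mulfK // subr_eq0 gt_eqF.
Qed.

(** By the mean value theorem the slope is a value of [derive1 g] at an intermediate point. This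
    links [right_derive], a limit of slopes, to the one-sided limits of [derive1] by which
    regularity at exceptional points is expressed. *)
Lemma cvg_right_slope g p (l : R) : {for p, continuous g} ->
  (\forall x \near p^'+, derivable g x 1) -> derive1 g x @[x --> p^'+] --> l ->
  h^-1 * (g (p + h) - g p) @[h --> (0 : R)^'+] --> l.
Proof.
move=> cg /at_rightR [d1 d10 h1] /cvgrPdist_le cl; apply/cvgrPdist_le => e e0.
have [d2 d20 h2] := at_rightR (cl e e0).
near=> h.
have h0 : 0 < h by near: h; exact: nbhs_right_gt.
have hd1 : h < d1 by near: h; exact: nbhs_right_lt.
have hd2 : h < d2 by near: h; exact: nbhs_right_lt.
have pm : Num.min p (p + h) = p by apply/min_idPl; rewrite lerDl ltW.
have px : Num.max p (p + h) = p + h by apply/max_idPr; rewrite lerDl ltW.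
have [| | | |c] := @MVT_slope g p (p + h); rewrite ?pm ?px //.
- by rewrite lt_eqF // ltrDl.
- by move=> x /andP[px' xh]; apply: h1 => //; lra.
- have /derivable1_diffP : derivable g (p + h) 1 by apply: h1; lra.
  exact: differentiable_continuous.
- move=> /andP[pc ch]; rewrite addrAC subrr add0r mulrC => ->.
  by apply: h2; lra.
Unshelve. all: by end_near.
Qed.

Lemma cvg_left_slope g p (l : R) : {for p, continuous g} ->
  (\forall x \near p^'-, derivable g x 1) -> derive1 g x @[x --> p^'-] --> l ->
  h^-1 * (g (p + h) - g p) @[h --> (0 : R)^'-] --> l.
Proof.
move=> cg /at_leftR [d1 d10 h1] /cvgrPdist_le cl; apply/cvgrPdist_le => e e0.
have [d2 d20 h2] := at_leftR (cl e e0).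
near=> h.
have h0 : h < 0 by near: h; exact: nbhs_left_lt.
have hd1 : - d1 < h by near: h; apply: nbhs_left_gt; lra.
have hd2 : - d2 < h by near: h; apply: nbhs_left_gt; lra.
have pm : Num.min p (p + h) = p + h by apply/min_idPr; lra.
have px : Num.max p (p + h) = p by apply/max_idPl; lra.
have [| | | |c] := @MVT_slope g p (p + h); rewrite ?pm ?px //.
- by apply/eqP; lra.
- by move=> x /andP[px' xh]; apply: h1 => //; lra.
- have /derivable1_diffP : derivable g (p + h) 1 by apply: h1; lra.
  exact: differentiable_continuous.
- move=> /andP[pc ch]; rewrite addrAC subrr add0r mulrC => ->.
  by apply: h2; lra.
Unshelve. all: by end_near.
Qed.

Lemma right_derive_cvg g p (l : R) : {for p, continuous g} ->
  (\forall x \near p^'+, derivable g x 1) -> derive1 g x @[x --> p^'+] --> l ->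
  right_derive g p = l.
Proof. by move=> ? ? ?; apply: cvg_lim => //; exact: cvg_right_slope. Qed.

Lemma left_derive_cvg g p (l : R) : {for p, continuous g} ->
  (\forall x \near p^'-, derivable g x 1) -> derive1 g x @[x --> p^'-] --> l ->
  left_derive g p = l.
Proof. by move=> ? ? ?; apply: cvg_lim => //; exact: cvg_left_slope. Qed.

Lemma right_derive_derivable g p : derivable g p 1 -> right_derive g p = derive1 g p.
Proof.
move=> dg; apply: cvg_lim; first exact: Rhausdorff.
have : t^-1 *: (g (t *: 1 + p) - g p) @[t --> (0 : R)^'] --> derive1 g p.
  by rewrite derive1E; exact: dg.
rewrite (_ : (fun t : R => _) = fun t : R => t^-1 * (g (p + t) - g p)); last first.
  by apply/funext => t; rewrite [t *: 1]mulr1 (addrC p).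
exact: cvg_dnbhs_at_right.
Qed.

End RealCalculus2.

(** * Piecewise superharmonic functions *)

Section Smoothing.
Context {R : realType}.
Implicit Types (f g h k q : R -> R) (x y z u v al be : R) (E : set R).

Lemma is_derive_continuous f x d : is_derive x 1 f d -> {for x, continuous f}.
Proof.
by move=> fd; apply: differentiable_continuous; apply/derivable1_diffP.
Qed.

(** The primitive again vanishes left of [c], so the construction can be iterated to obtain a double
    primitive. *)
Lemma primitive_exists k c : continuous k -> (forall z, z <= c -> k z = 0) ->
  exists2 H : R -> R, forall z, z <= c -> H z = 0 & forall z, is_derive z 1 H (k z).
Proof.
move=> ck k0.
(* The base point lies strictly below [c], which leaves room for the fundamental theorem of calculus
   at [c] itself. *)
pose H z := \int[lebesgue_measure]_(t in `[c - 1, z]) k t.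
have H0 z : z <= c -> H z = 0.
  move=> zc; rewrite /H (@eq_Rintegral _ _ _ _ _ (cst 0)).
    by rewrite Rintegral_cst // mul0r.
  by move=> t; rewrite inE /= in_itv /= => /andP[_ tz]; rewrite k0 // (le_trans tz).
exists H => // z.
have [zc|cz] := ltP z c.
  rewrite k0 ?(ltW zc) //.
  apply: (@near_eq_is_derive _ _ _ (cst 0) H).
    by near=> t; rewrite H0 //; apply: ltW; near: t; exact: lt_nbhsl.
have [||||dH HE] := @continuous_FTC1_closed R k (c - 1) z (z + 1).
- by rewrite ltrDl.
- apply: continuous_compact_integrable; first exact: segment_compact.
  exact: continuous_subspaceT.
- by rewrite ltrBlDr (le_lt_trans cz) // ltrDl.
- exact: ck.
by rewrite -HE; exact: derivable_is_derive1.
Unshelve. all: by end_near.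
Qed.

(* Here [q] may be the right-hand derivative, hence jumps on [E]. *)
Lemma second_difference_le0 f q E x e : 0 < e -> finite_set E ->
  (forall z, x <= z <= x + 2 * e -> {for z, continuous f}) ->
  (forall z, x < z < x + 2 * e -> ~ E z -> is_derive z 1 f (q z)) ->
  (forall z z', x < z -> z <= z' -> z' < x + 2 * e -> q z' <= q z) ->
  f (x + 2 * e) - 2 * f (x + e) + f x <= 0.
Proof.
move=> e0 fE cf df dq.
(* The second difference is [s x - s (x + e)], and [s] increases because its derivative
   [q z - q (z + e)] is nonnegative. [E'] collects the points where one of the two terms may fail to
   be differentiable. *)
pose s z := f z - f (z + e).
pose E' := E `|` [set z - e | z in E].
have fE' : finite_set E' by rewrite finite_setU; split => //; exact: finite_image.
have cs z : x <= z <= x + e -> {for z, continuous s}.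
  move=> /andP[xz ze]; apply: continuousB; first by apply: cf; lra.
  apply: (@continuous_comp _ _ _ (fun z => z + e) f); last by apply: cf; lra.
  by apply: cvgD; [exact: cvg_id|exact: cvg_cst].
have : s x <= s (x + e).
  apply: (@nondecreasing_piecewise R s E') => //; first by rewrite lerDl ltW.
  - move=> z /andP[xz ze] E'z.
    have d1 : is_derive z 1 f (q z) by apply: df; [lra|move=> Ez; apply: E'z; left].
    have d2 : is_derive (z + e) 1 f (q (z + e)).
      by apply: df; [lra|move=> Ez; apply: E'z; right; exists (z + e) => //; lra].
    have d3 := is_derive_shift d2.
    have ds : is_derive z 1 s (q z - q (z + e)) by exact: is_deriveB.
    split; first exact: ex_derive.
    by rewrite (derive1_is_derive ds) subr_ge0; apply: dq; lra.
  - by move=> z xz ze; apply: cvg_at_right_filter; apply: cs; lra.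
  - move=> z xz ze; exists (s z) => //; apply: cvg_at_left_filter; apply: cs; lra.
rewrite /s; have -> : x + e + e = x + 2 * e by ring.
lra.
Qed.

End Smoothing.

Section PiecewiseSuperharmonic.
Context {R : realType}.
Variables (a b : \bar R) (mu sigma : R -> R) (r : R).
Local Notation I := (state_space a b).
Implicit Types (f g h k q : R -> R) (x y z u v al be : R) (E : set R).

Lemma state_space_open : open I.
Proof.
rewrite (_ : I = [set x | a < x%:E]%E `&` [set x | x%:E < b]%E); last first.
  by apply/seteqP; split => z /=; [move=> /andP[]|move=> [h1 h2]; rewrite /state_space /= h1].
by apply: openI; [exact: open_ereal_gt|exact: open_ereal_lt].
Qed.

Lemma state_space_near x : I x -> \forall z \near x, I z.
Proof. by move=> Ix; apply: open_nbhs_nbhs; split=> //; exact: state_space_open. Qed.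

Lemma state_space_segment x y z : I x -> I y -> x <= z <= y -> I z.
Proof.
rewrite /state_space /= => /andP[ax _] /andP[_ yb] /andP[xz zy]; apply/andP; split.
  by apply: lt_le_trans ax _; rewrite lee_fin.
by apply: le_lt_trans yb; rewrite lee_fin.
Qed.

(** The generator is constrained off [E]; at a point of [E] the slope may only drop. The one-sided
    limits of the second derivative keep it bounded near a kink. Both signs of [psi] fit with [E]
    empty. *)
Definition piecewise_superharmonic h E : Prop :=
  [/\ finite_set E, forall z, I z -> {for z, continuous h},
      forall z, I z -> ~ E z -> C2_at h z /\ generator_r mu sigma r h z <= 0 &
      forall z, I z -> E z ->
        [/\ exists l1 l2 : R, [/\ derive1 h x @[x --> z^'-] --> l1,
                             derive1 h x @[x --> z^'+] --> l2 & l2 <= l1],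
            cvg (derive1 (derive1 h) @ z^'-) & cvg (derive1 (derive1 h) @ z^'+)]].

Lemma C2_at_derivable f x : C2_at f x -> derivable f x 1.
Proof. by case=> + _ _; exact: nbhs_singleton. Qed.

Lemma C2_at_derivable2 f x : C2_at f x -> derivable (derive1 f) x 1.
Proof. by case=> _ + _; exact: nbhs_singleton. Qed.

Lemma C2_at_continuous f x : C2_at f x -> {for x, continuous f}.
Proof.
by move=> /C2_at_derivable /derivable1_diffP; exact: differentiable_continuous.
Qed.

Lemma C2_at_continuous1 f x : C2_at f x -> {for x, continuous (derive1 f)}.
Proof.
by move=> /C2_at_derivable2 /derivable1_diffP; exact: differentiable_continuous.
Qed.

Lemma right_derive_C2 f x : C2_at f x -> \forall z \near x, right_derive f z = derive1 f z.
Proof. by case=> + _ _; apply: filterS => z; exact: right_derive_derivable. Qed.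

Section Regularity.
Variables (h : R -> R) (E : set R).
Hypothesis hh : piecewise_superharmonic h E.

Lemma psh_dnbhs z : I z -> \forall x \near z^', I x /\ ~ E x.
Proof.
move=> Iz; have [fE _ _ _] := hh; near=> x; split.
  by near: x; apply: nbhs_dnbhs; exact: state_space_near.
by near: x; exact: finite_set_dnbhs.
Unshelve. all: by end_near.
Qed.

Lemma psh_dnbhs_C2 z : I z -> \forall x \near z^', C2_at h x.
Proof.
move=> /psh_dnbhs; apply: filterS => x [Ix Ex].
by have [_ _ /(_ _ Ix Ex) [] ] := hh.
Qed.

Lemma psh_right_derive z : I z ->
  derive1 h x @[x --> z^'+] --> right_derive h z.
Proof.
move=> Iz; have [fE ch hC hE] := hh.
have nr : \forall x \near z^'+, derivable h x 1.
  have := psh_dnbhs_C2 Iz => /dnbhs_ballR [d d0 hd].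
  near=> x.
  have zx : z < x by near: x; exact: nbhs_right_gt.
  apply/C2_at_derivable/hd; first by rewrite gt_eqF.
  by rewrite gtr0_norm ?subr_gt0 // ltrBlDl; near: x; apply: nbhs_right_lt; rewrite ltrDl.
have [Ez|Ez] := pselect (E z).
  have [[l1 [l2 [_ h2 _]]] _ _] := hE z Iz Ez.
  by rewrite (right_derive_cvg (ch z Iz) nr h2).
have [C2 _] := hC z Iz Ez.
rewrite right_derive_derivable; last exact: C2_at_derivable.
by apply: cvg_at_right_filter; exact: C2_at_continuous1.
Unshelve. all: by end_near.
Qed.

Lemma psh_left_derive z : I z ->
  exists2 l : R, derive1 h x @[x --> z^'-] --> l & right_derive h z <= l.
Proof.
move=> Iz; have [fE ch hC hE] := hh.
have [Ez|Ez] := pselect (E z).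
  have [[l1 [l2 [h1 h2 h12]]] _ _] := hE z Iz Ez.
  exists l1 => //; have h2' := psh_right_derive Iz.
  by have -> := cvg_unique (@Rhausdorff R) h2' h2.
have [C2 _] := hC z Iz Ez.
exists (derive1 h z); first by apply: cvg_at_left_filter; exact: C2_at_continuous1.
rewrite right_derive_derivable //; exact: C2_at_derivable.
Qed.

Lemma psh_right_derive_right z : I z ->
  right_derive h x @[x --> z^'+] --> right_derive h z.
Proof.
move=> Iz; apply: cvg_trans (psh_right_derive Iz); apply: near_eq_cvg.
have := psh_dnbhs_C2 Iz => /dnbhs_ballR [d d0 hd].
near=> x.
have zx : z < x by near: x; exact: nbhs_right_gt.
apply/esym/right_derive_derivable/C2_at_derivable/hd; first by rewrite gt_eqF.
by rewrite gtr0_norm ?subr_gt0 // ltrBlDl; near: x; apply: nbhs_right_lt; rewrite ltrDl.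
Unshelve. all: by end_near.
Qed.

Lemma psh_right_derive_left z : I z ->
  exists2 l : R, right_derive h x @[x --> z^'-] --> l & right_derive h z <= l.
Proof.
move=> Iz; have [l hl le] := psh_left_derive Iz; exists l => //.
apply: cvg_trans hl; apply: near_eq_cvg.
have := psh_dnbhs_C2 Iz => /dnbhs_ballR [d d0 hd].
near=> x.
have zx : x < z by near: x; exact: nbhs_left_lt.
apply/esym/right_derive_derivable/C2_at_derivable/hd; first by rewrite lt_eqF.
rewrite ltr0_norm ?subr_lt0 // opprB ltrBlDl -ltrBlDr.
by near: x; apply: nbhs_left_gt; rewrite ltrBlDr ltrDl.
Unshelve. all: by end_near.
Qed.

Lemma dnbhs_bound_of_cvg k z (l1 l2 : R) :
  k x @[x --> z^'-] --> l1 -> k x @[x --> z^'+] --> l2 ->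
  exists M, \forall x \near z^', `|k x| <= M.
Proof.
have cl (F : set_system R) (FF : ProperFilter F) (l : R) : k x @[x --> F] --> l ->
    \forall x \near F, `|k x| <= `|l| + 1.
  move=> /cvgrPdist_le /(_ 1 ltr01); apply: filterS => x h1.
  have := ler_normB l (l - k x); rewrite opprB addrC subrK; lra.
move=> /cl /at_leftR [d1 d10 h1] /cl /at_rightR [d2 d20 h2].
exists (Num.max (`|l1| + 1) (`|l2| + 1)).
have d0 : 0 < Num.min d1 d2 by rewrite lt_min d10.
rewrite /dnbhs /within /=; apply/nbhs_ballP; exists (Num.min d1 d2) => //= x.
rewrite /ball /= lt_min ltr_distlC ltr_distlC => /andP[/andP[h3 h4] /andP[h5 h6]] xz.
rewrite le_max; have [zx|xz'] := ltP z x.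
  by rewrite h2 ?orbT.
by rewrite h1 // lt_neqAle xz.
Qed.

Lemma dnbhs_bound_of_continuous k z : {for z, continuous k} ->
  exists M, \forall x \near z^', `|k x| <= M.
Proof.
by move=> ck; apply: dnbhs_bound_of_cvg;
  [exact: cvg_at_left_filter ck|exact: cvg_at_right_filter ck].
Qed.

Lemma psh_derive2_bound z : I z ->
  exists M, \forall x \near z^', `|derive1 (derive1 h) x| <= M.
Proof.
move=> Iz; have [fE ch hC hE] := hh.
have [Ez|Ez] := pselect (E z).
  by have [_ cl cr] := hE z Iz Ez; exact: dnbhs_bound_of_cvg cl cr.
by have [[_ _ c2] _] := hC z Iz Ez; exact: dnbhs_bound_of_continuous.
Qed.

Lemma psh_derive_bound z : I z ->
  exists M, \forall x \near z^', `|right_derive h x| <= M.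
Proof.
move=> Iz; have [l cl _] := psh_right_derive_left Iz.
exact: dnbhs_bound_of_cvg cl (psh_right_derive_right Iz).
Qed.

End Regularity.
End PiecewiseSuperharmonic.

(** * Smoothing *)

Section SecondDifference.
Context {R : realType}.
Implicit Types (h k q : R -> R) (x y z e hi : R).

(** A forward quotient: applied to a double primitive of [k], it is the average of [k] over
    [[x, x + 2 e]] against a tent-shaped kernel, so it smooths by two orders and depends on values
    ahead of [x] only. *)
Definition second_difference e h x : R := (h (x + 2 * e) - 2 * h (x + e) + h x) / e ^+ 2.

Lemma is_derive_second_difference e h k :
  (forall z, is_derive z 1 h (k z)) ->
  forall x, is_derive x 1 (second_difference e h) (second_difference e k x).
Proof.
move=> hk x.
have d1 := is_derive_shift (hk (x + 2 * e)).
have d2 := is_derive_shift (hk (x + e)).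
have d3 := hk x.
have -> : second_difference e h =
    (e ^+ 2)^-1 *: ((fun z => h (z + 2 * e)) - 2 *: (fun z => h (z + e)) + h).
  by apply/funext => z; rewrite /second_difference mulrC.
have -> : second_difference e k x =
    (e ^+ 2)^-1 *: (k (x + 2 * e) - 2 *: k (x + e) + k x).
  by rewrite /second_difference mulrC.
apply: is_deriveZ.
Qed.

Lemma second_difference_continuous e h : continuous h -> continuous (second_difference e h).
Proof.
move=> ch x; rewrite /second_difference.
have sh c : {for x, continuous (fun z => h (z + c))}.
  apply: (@continuous_comp _ _ _ (fun z => z + c) h); last exact: ch.
  by apply: cvgD; [exact: cvg_id|exact: cvg_cst].
apply: cvgM; last exact: cvg_cst.
apply: cvgD; last exact: ch.
apply: cvgB; first exact: sh.
by apply: cvgM; [exact: cvg_cst|exact: sh].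
Qed.

(** Subtracting [hi / 2 * z ^ 2], whose second difference quotient is exactly [hi], leaves a
    function whose derivative [q] is nonincreasing. *)
Lemma second_difference_le e k (K1 K2 : R -> R) x hi : 0 < e ->
  (forall z, is_derive z 1 K1 (k z)) -> (forall z, is_derive z 1 K2 (K1 z)) ->
  (forall t, x <= t <= x + 2 * e -> k t <= hi) ->
  second_difference e K2 x <= hi.
Proof.
move=> e0 d1 d2 khi.
pose q := (fun z => K1 z - hi * z) : R -> R.
pose f := (fun z => K2 z - hi / 2 * (z * z)) : R -> R.
have dq z : is_derive z 1 q (k z - hi).
  have := d1 z => ?; rewrite /q.
  by apply: is_derive_eq; rewrite /GRing.scale /= mulr1.
have df z : is_derive z 1 f (q z).
  have := d2 z => ?; rewrite /f.
  apply: is_derive_eq; rewrite /q /GRing.scale /=; lra.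
have cf z : {for z, continuous f} by exact: is_derive_continuous (df z).
have cq z : {for z, continuous q} by exact: is_derive_continuous (dq z).
have : f (x + 2 * e) - 2 * f (x + e) + f x <= 0.
  apply: (@second_difference_le0 _ f q set0) => // z z' xz zz' z'x.
  rewrite -lerN2; apply: (@nondecreasing_piecewise _ (fun z => - q z) set0) => //.
  - move=> t /andP[zt tz'] _.
    have dN : is_derive t 1 (fun z => - q z) (- (k t - hi)) by exact: is_deriveN.
    split; first exact: ex_derive.
    by rewrite (derive1_is_derive dN) oppr_ge0 subr_le0; apply: khi; lra.
  - by move=> t _ _; apply: cvgN; apply: cvg_at_right_filter; exact: cq.
  - move=> t _ _; exists (- q t) => //.
    by apply: cvgN; apply: cvg_at_left_filter; exact: cq.
rewrite /f /second_difference => le0.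
rewrite ler_pdivrMr ?exprn_gt0 //.
have -> : e ^+ 2 = e * e by rewrite expr2.
lra.
Qed.

Lemma second_difference_ge e k (K1 K2 : R -> R) x lo : 0 < e ->
  (forall z, is_derive z 1 K1 (k z)) -> (forall z, is_derive z 1 K2 (K1 z)) ->
  (forall t, x <= t <= x + 2 * e -> lo <= k t) ->
  lo <= second_difference e K2 x.
Proof.
move=> e0 d1 d2 klo; rewrite -lerN2.
have -> : - second_difference e K2 x = second_difference e (fun z => - K2 z) x.
  by rewrite /second_difference; ring.
apply: (@second_difference_le e (fun z => - k z) (fun z => - K1 z)) => //.
by move=> t /klo; rewrite lerN2.
Qed.

End SecondDifference.

Section SmoothApproximation.
Context {R : realType}.
Variables (a b : \bar R) (mu sigma : R -> R) (r : R).
Local Notation I := (state_space a b).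
Hypothesis hmu : forall x, I x -> {for x, continuous mu}.
Hypothesis hsigma : forall x, I x -> {for x, continuous sigma}.

Lemma cvg_linear_combination (T : Type) (F : set_system T) {FF : Filter F}
    (k1 k2 k3 k4 : T -> R) (l1 l2 l3 l4 A B C D : R) :
  k1 @ F --> l1 -> k2 @ F --> l2 -> k3 @ F --> l3 -> k4 @ F --> l4 ->
  (fun t => A * k1 t + B * k2 t - C * k3 t - D * k4 t) @ F -->
  A * l1 + B * l2 - C * l3 - D * l4.
Proof.
move=> c1 c2 c3 c4.
by apply: cvgB; [apply: cvgB; [apply: cvgD|]|]; apply: cvgM => //; exact: cvg_cst.
Qed.

(** With constant coefficients [A] and [B] the left side minus [eta] is the second difference of the
    single function [Q], divided by [e ^ 2]. The derivative [q] of [Q] is nonincreasing: off [E] by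
    the assumed inequality, and across a kink because the slope of [h] drops and [A >= 0]. So kinks
    cost nothing. *)
Lemma frozen_generator_second_difference (h ht H1 H2 : R -> R) (E : set R)
    (A B eta x e : R) :
  piecewise_superharmonic a b mu sigma r h E -> 0 <= A -> 0 < e ->
  I x -> I (x + 2 * e) -> continuous ht ->
  (forall z : R, is_derive z 1 H1 (ht z)) -> (forall z : R, is_derive z 1 H2 (H1 z)) ->
  (forall z, x <= z -> z <= x + 2 * e -> ht z = h z) ->
  (forall z, x < z -> z < x + 2 * e -> ~ E z ->
    A * derive1 (derive1 h) z + B * derive1 h z - r * h z <= eta) ->
  A * second_difference e ht x + B * second_difference e H1 x
    - r * second_difference e H2 x <= eta.
Proof.
move=> hh A0 e0 Ix Ixe cht dH1 dH2 hth Gle.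
have [fE ch hC hE] := hh.
have cH1 z : {for z, continuous H1} by exact: is_derive_continuous (dH1 z).
have cH2 z : {for z, continuous H2} by exact: is_derive_continuous (dH2 z).
have Iin z : x < z -> z < x + 2 * e -> I z.
  by move=> *; apply: (state_space_segment Ix Ixe); rewrite !ltW.
pose q := (fun z => A * right_derive h z + B * ht z - r * H1 z - eta * z) : R -> R.
pose Q := (fun z => A * ht z + B * H1 z - r * H2 z - eta / 2 * (z * z)) : R -> R.
have dht (z : R) : x < z -> z < x + 2 * e -> ~ E z -> is_derive z 1 ht (derive1 h z).
  move=> xz zx Ez; apply: (@near_eq_is_derive _ _ _ h).
    near=> t; apply/esym/hth; apply: ltW; near: t.
      exact: lt_nbhsr.
    exact: lt_nbhsl.
  by apply/derivable_is_derive1/C2_at_derivable; case: (hC z (Iin z xz zx) Ez).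
have cQ z : {for z, continuous Q}.
  have cz : (fun t : R => t * t) @ z --> z * z by apply: cvgM; exact: cvg_id.
  exact: (@cvg_linear_combination _ (nbhs z) _ ht H1 H2 (fun t : R => t * t) _ _ _ _
    A B r (eta / 2) (cht z) (cH1 z) (cH2 z) cz).
have q_decr z z' : x < z -> z <= z' -> z' < x + 2 * e -> q z' <= q z.
  move=> xz zz' z'x; rewrite -lerN2.
  apply: (@nondecreasing_piecewise R (fun z => - q z) E z z' zz' fE).
  - move=> t /andP[zt tz'] Et.
    have xt := lt_trans xz zt; have tx := lt_trans tz' z'x.
    have It := Iin t xt tx.
    have [C2t _] := hC t It Et.
    have dz := dht t xt tx Et; have dz1 := dH1 t.
    have dr : is_derive t 1 (right_derive h) (derive1 (derive1 h) t).
      apply: (@near_eq_is_derive _ _ _ (derive1 h)).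
        by have := right_derive_C2 C2t; apply: filterS => u ->.
      by apply: derivable_is_derive1; exact: C2_at_derivable2.
    have dq : is_derive t 1 (fun z => - q z) (- (A * derive1 (derive1 h) t
        + B * derive1 h t - r * ht t - eta)).
      by rewrite /q; apply: is_derive_eq; rewrite /GRing.scale /= mulr1.
    split; first exact: ex_derive.
    rewrite (derive1_is_derive dq) oppr_ge0 subr_le0 hth ?(ltW xt) ?(ltW tx) //.
    exact: Gle.
  - move=> t zt tz'.
    have It := Iin t (lt_le_trans xz zt) (lt_trans tz' z'x).
    apply: cvgN.
    apply: (@cvg_linear_combination _ t^'+ _ (right_derive h) ht H1 id _ _ _ _ A B r eta).
    + exact: (psh_right_derive_right hh It).
    + exact: cvg_at_right_filter (cht t).
    + exact: cvg_at_right_filter (cH1 t).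
    + by apply: cvg_at_right_filter; exact: cvg_id.
  - move=> t zt tz'.
    have It := Iin t (lt_trans xz zt) (le_lt_trans tz' z'x).
    have [l c5 hl] := psh_right_derive_left hh It.
    exists (- (A * l + B * ht t - r * H1 t - eta * t)).
      apply: cvgN.
      apply: (@cvg_linear_combination _ t^'- _ (right_derive h) ht H1 id _ _ _ _ A B r eta).
      + exact: c5.
      + exact: cvg_at_left_filter (cht t).
      + exact: cvg_at_left_filter (cH1 t).
      + by apply: cvg_at_left_filter; exact: cvg_id.
    by rewrite lerN2 /q !lerD2r ler_wpM2l.
have Q_le0 : Q (x + 2 * e) - 2 * Q (x + e) + Q x <= 0.
  apply: (@second_difference_le0 _ Q q E) => //.
  move=> z /andP[xz zx] Ez.
  have dz := dht z xz zx Ez; have dz1 := dH1 z; have dz2 := dH2 z.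
  rewrite /Q; apply: is_derive_eq; rewrite /q right_derive_derivable; last first.
    by apply: C2_at_derivable; case: (hC z (Iin z xz zx) Ez).
  by rewrite /GRing.scale /=; field.
rewrite -subr_le0.
have -> : A * second_difference e ht x + B * second_difference e H1 x
    - r * second_difference e H2 x - eta = (Q (x + 2 * e) - 2 * Q (x + e) + Q x) / e ^+ 2.
  by rewrite /Q /second_difference; field; rewrite gt_eqF.
by rewrite pmulr_lle0 // invr_gt0 exprn_gt0.
Unshelve. all: by end_near.
Qed.

(** [f] is the second difference of a double primitive [H2] of [ht]; then [f'] and [f''] are the
    second differences of [H1] and of [ht], so [f] is [C^2] although [ht] is only continuous. On
    [[c, c']] all three only see [[c, c'']], where [ht] is [h]. *)
Lemma smooth_approximation (h ht : R -> R) (E : set R) (c c' c'' c1 c2 eta : R) :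
  piecewise_superharmonic a b mu sigma r h E ->
  I c1 -> I c2 -> I c -> c <= c' -> c' < c'' -> I c'' -> continuous ht ->
  (forall z, ~ (c1 <= z <= c2) -> ht z = 0) ->
  (forall z, c <= z <= c'' -> ht z = h z) -> 0 < eta ->
  exists (f : R -> R) d1 d2, [/\ I d1, I d2, forall z, C2_at f z,
    forall z, ~ (d1 <= z <= d2) -> f z = 0 &
    (forall z, `|f z - ht z| <= eta) /\
    forall z, c <= z <= c' -> generator_r mu sigma r f z <= eta].
Proof.
move=> hh Ic1 Ic2 Ic cc' c'c'' Ic'' cht ht0 hth eta0.
have [fE ch hC hE] := hh.
have cc'' : c <= c'' by rewrite (le_trans cc') // ltW.
have Iseg z : c <= z <= c'' -> I z by exact: state_space_segment.
have [K1 hK1] := locally_bounded_segment cc'' (fun z zc => psh_derive_bound hh (Iseg z zc)).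
have [K2 hK2] := locally_bounded_segment cc'' (fun z zc => psh_derive2_bound hh (Iseg z zc)).
pose K := `|K1| + `|K2| + 1.
have K0 : 0 < K by rewrite /K; have := normr_ge0 K1; have := normr_ge0 K2; lra.
have hK1' z : c <= z <= c'' -> `|right_derive h z| <= K.
  by move=> /hK1 /le_trans; apply; rewrite /K; have := ler_norm K1; have := normr_ge0 K2; lra.
have hK2' z : c <= z <= c'' -> `|derive1 (derive1 h) z| <= K.
  by move=> /hK2 /le_trans; apply; rewrite /K; have := ler_norm K2; have := normr_ge0 K1; lra.
pose Av z := 2^-1 * sigma z ^+ 2.
have cA x : c <= x <= c'' -> {for x, continuous Av}.
  move=> /Iseg /hsigma cs; apply: cvgM; first exact: cvg_cst.
  by rewrite expr2; apply: cvgM; exact: cs.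
(* [K] bounds both derivatives of [h] off its kinks. Freezing the coefficients changes the generator
   by two products, each then at most [eta / (2 * K) * K], that is [eta / 2]. *)
have w0 : 0 < eta / (2 * K) by rewrite divr_gt0 // mulr_gt0.
have [e1 e10 he1] := uniform_continuity_segment cc'' w0 cA.
have [e2 e20 he2] := uniform_continuity_segment cc'' w0 (fun x xc => hmu (Iseg x xc)).
have [|e3 e30 he3] := @uniform_continuity_segment _ ht (c1 - 1) (Num.max c1 c2 + 1) eta _ eta0
    (fun x _ => cht x).
  have : c1 <= Num.max c1 c2 by rewrite le_max lexx.
  lra.
have [e4 e40 he4] := nbhs_ballR (state_space_near Ic1).
(* The look-ahead is [2 * e]. It stays below the moduli of [Av], [mu] and [ht], below the room [e4]
   that keeps the enlarged support in [I], below [1] so that [ht] still vanishes ahead of a point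
   under [c1 - 1], and below [c'' - c']. *)
have [e e0 [m1 m2 m3 m4 [m5 m6]]] : exists2 e : R, 0 < e &
    [/\ 2 * e < e1, 2 * e < e2, 2 * e < e3, 2 * e < e4 & 2 * e < 1 /\ 2 * e < c'' - c'].
  pose m := Num.min e1 (Num.min e2 (Num.min e3 (Num.min e4 (Num.min 1 (c'' - c'))))).
  have m0 : 0 < m by rewrite /m !lt_min e10 e20 e30 e40 ltr01 subr_gt0.
  exists (m / 4); first by rewrite divr_gt0.
  have lt2 u : m <= u -> 2 * (m / 4) < u by lra.
  by split; last split; apply: lt2; rewrite /m !ge_min lexx ?orbT.
have [H1 H10 dH1] : exists2 H1 : R -> R, forall z : R, z <= c1 - 1 -> H1 z = 0 &
    forall z : R, is_derive z 1 H1 (ht z).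
  by apply: primitive_exists => // z zc; apply: ht0; lra.
have cH1 : continuous H1 by move=> z; exact: is_derive_continuous (dH1 z).
have [H2 H20 dH2] := primitive_exists cH1 H10.
pose f := second_difference e H2.
have df (x : R) : is_derive x 1 f (second_difference e H1 x).
  exact: is_derive_second_difference.
have ddf (x : R) : is_derive x 1 (second_difference e H1) (second_difference e ht x).
  exact: is_derive_second_difference.
have f1E : derive1 f = second_difference e H1.
  by apply/funext => x; exact: derive1_is_derive.
have f2E : derive1 (derive1 f) = second_difference e ht.
  by rewrite f1E; apply/funext => x; exact: derive1_is_derive.
have f_zero z : ~ (c1 - 2 * e <= z <= c2) -> f z = 0.
  move=> zn; have htz t : z <= t <= z + 2 * e -> ht t = 0.
    by move=> zt; apply: ht0; lra.
  apply/eqP; rewrite eq_le; apply/andP; split.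
  - by apply: (second_difference_le e0 dH1 dH2) => t /htz ->.
  - by apply: (second_difference_ge e0 dH1 dH2) => t /htz ->.
exists f, (c1 - 2 * e), c2; split => //.
- apply: he4; have -> : c1 - 2 * e - c1 = - (2 * e) by ring.
  by rewrite normrN gtr0_norm ?mulr_gt0 //; lra.
- move=> z; split.
  + by near=> t; exact: ex_derive.
  + by rewrite f1E; near=> t; exact: ex_derive.
  + by rewrite f2E; exact: second_difference_continuous.
split.
- move=> z.
  have hz t : z <= t <= z + 2 * e -> `|ht t - ht z| <= eta.
    move=> zt; have [zin|zout] := boolP (c1 - 1 <= z <= Num.max c1 c2 + 1).
      by apply: he3 => //; rewrite ger0_norm; lra.
    have c2m : c2 <= Num.max c1 c2 by rewrite le_max lexx orbT.
    have zout' : z < c1 - 1 \/ Num.max c1 c2 + 1 < z.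
      by move: zout; rewrite negb_and -!ltNge => /orP.
    rewrite (ht0 z); last by case: zout' => ?; lra.
    have /andP[zt1 zt2] := zt.
    rewrite (ht0 t); last by case: zout' => ?; lra.
    by rewrite subrr normr0 ltW.
  rewrite ler_norml; apply/andP; split.
  + rewrite lerBrDr; apply: (second_difference_ge e0 dH1 dH2) => t /hz.
    by rewrite ler_norml; lra.
  + rewrite lerBlDr; apply: (second_difference_le e0 dH1 dH2) => t /hz.
    by rewrite ler_norml; lra.
move=> x /andP[cx xc'].
have xc'' : x + 2 * e < c'' by lra.
have hcx : c <= x <= c'' by rewrite cx (le_trans xc') // ltW.
have hcxe : c <= x + 2 * e <= c'' by rewrite (ltW xc'') andbT; lra.
rewrite /generator_r /generator f2E f1E -/(Av x).
apply: (frozen_generator_second_difference hh) => //.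
- by rewrite mulr_ge0 ?invr_ge0 // sqr_ge0.
- exact: Iseg.
- exact: Iseg.
- by move=> z xz zx; apply: hth; rewrite (le_trans cx) //= (le_trans zx) // ltW.
move=> z xz zx Ez.
have hcz : c <= z <= c'' by rewrite (le_trans cx (ltW xz)) (ltW (lt_trans zx xc'')).
have [C2z Gz] := hC z (Iseg z hcz) Ez.
have b1 := hK1' z hcz; have b2 := hK2' z hcz.
rewrite right_derive_derivable in b1; last exact: C2_at_derivable.
have zx' : `|z - x| < 2 * e by rewrite gtr0_norm ?subr_gt0 // ltrBlDl.
have a1 := he1 x z hcx (lt_trans zx' m1).
have a2 := he2 x z hcx (lt_trans zx' m2).
have prodle u v : `|u| <= eta / (2 * K) -> `|v| <= K -> - (u * v) <= eta / 2.
  move=> h1 h2; apply: le_trans (ler_norm _) _; rewrite normrN normrM.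
  apply: le_trans (ler_pM _ _ h1 h2) _ => //.
  by rewrite le_eqVlt; apply/orP; left; apply/eqP; field; rewrite gt_eqF.
have p1 := prodle _ _ a1 b2; have p2 := prodle _ _ a2 b1.
move: Gz; rewrite /generator_r /generator -/(Av z) => Gz.
lra.
Unshelve. all: by end_near.
Qed.

End SmoothApproximation.

(** * Paths, hitting times and measurability *)

Section Paths.
Context {R : realType} {d : measure_display} {Omega : measurableType d}.
Variables (a b : \bar R) (mu sigma : R -> R) (F : R -> set_system Omega)
  (X : R -> Omega -> option R) (P : R -> probability Omega R).
Hypothesis hX : diffusion a b mu sigma F X P.
Local Notation I := (state_space a b).
Implicit Types (k f : R -> R) (w : Omega) (s t u x y z c : R).

Lemma maxr_dist u v : `|Num.max u 0 - Num.max v 0| <= `|u - v|.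
Proof.
have h1 := ler_norm (u - v); have h2 := ler_norm (v - u); rewrite distrC in h2.
by rewrite ler_norml; case: (leP u 0) => ?; case: (leP v 0) => ?; apply/andP; split; lra.
Qed.

Lemma minr_dist t u v : `|Num.min t u - Num.min t v| <= `|u - v|.
Proof.
have h1 := ler_norm (u - v); have h2 := ler_norm (v - u); rewrite distrC in h2.
by rewrite ler_norml; case: (leP t u) => ?; case: (leP t v) => ?; apply/andP; split; lra.
Qed.

Definition path_value k u w : R := oapp k 0 (X u w).

Lemma alive_before s t w x : 0 <= s -> s <= t -> X t w = Some x ->
  exists z, X s w = Some z.
Proof.
move=> s0 st Xt; case E : (X s w) => [z|]; first by exists z.
by have := dif_absorbed hX s0 st E; rewrite Xt.
Qed.

Lemma lifetime_eq t w : 0 <= t -> X t w = None ->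
  (forall s, 0 <= s -> s < t -> X s w <> None) -> lifetime X w = t%:E.
Proof.
move=> t0 Xt al; apply/eqP; rewrite eq_le; apply/andP; split.
  by apply: ereal_inf_lbound; exists t.
apply: le_ereal_inf_tmp => _ [s [s0 Xs] <-]; rewrite lee_fin leNgt.
by apply/negP => st; exact: (al s).
Qed.

(* A path that stays away from [a] and [b] survives; hence test functions
   supported in [(a, b)] do not see the death of the path. *)
Lemma dead_case t w : 0 <= t -> X t w = None ->
  [\/ exists s, [/\ 0 <= s, s < t & X s w = None], t = 0 |
      0 < t /\ (exits_at X a w \/ exits_at X b w) /\ lifetime X w = t%:E].
Proof.
move=> t0 Xt; have [[s [s0 st Xs]]|al] := pselect (exists s, [/\ 0 <= s, s < t & X s w = None]).
  by apply: Or31; exists s.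
have L : lifetime X w = t%:E.
  by apply: lifetime_eq => // s s0 st Xs; apply: al; exists s.
move: t0; rewrite le_eqVlt => /orP[/eqP<-|t0]; first exact: Or32.
by apply: Or33; split => //; split => //; exact: (dif_death hX t0 L).
Qed.

Lemma exits_at_level (e : \bar R) t w (A : set (\bar R)) : lifetime X w = t%:E ->
  exits_at X e w -> nbhs e A ->
  exists2 e' : R, 0 < e' & forall s, t - e' < s -> s < t -> A (oapp EFin 0%E (X s w)).
Proof.
move=> L [t' [t'0 L' cv]] Ae; have tt' : t = t' by move: L'; rewrite L => -[].
by rewrite -tt' in cv; have /at_leftR [e' e'0 h] := cv A Ae; exists e'.
Qed.

Lemma exits_at_leave t w c c' : 0 < t -> lifetime X w = t%:E -> I c -> I c' ->
  exits_at X a w \/ exits_at X b w ->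
  exists2 e' : R, 0 < e' & forall s z, t - e' < s -> s < t -> X s w = Some z -> ~ (c <= z <= c').
Proof.
move=> t0 L Ic Ic' [ea|eb].
  have Ac : nbhs a [set z | z < c%:E]%E.
    by apply: open_nbhs_nbhs; split; [exact: open_ereal_lt_ereal|case/andP: Ic].
  have [e' e'0 h] := exits_at_level L ea Ac; exists e' => // s z s1 s2 Xs.
  have := h s s1 s2; rewrite Xs /= lte_fin; lra.
have Ac : nbhs b [set z | c'%:E < z]%E.
  by apply: open_nbhs_nbhs; split; [exact: open_ereal_gt_ereal|case/andP: Ic'].
have [e' e'0 h] := exits_at_level L eb Ac; exists e' => // s z s1 s2 Xs.
have := h s s1 s2; rewrite Xs /= lte_fin; lra.
Qed.

(** While the path is alive this is its continuity; after death the value is constantly zero. At the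
    lifetime itself the path has already left [[c, c']], where [k] lives, so the value is zero on
    both sides. Freezing negative times at [0] gives a function continuous on the whole line. *)
Lemma path_value_continuous k c c' w : continuous k -> I c -> I c' ->
  (forall z, ~ (c <= z <= c') -> k z = 0) ->
  continuous (fun u => path_value k (Num.max u 0) w).
Proof.
move=> ck Ic Ic' k0.
suff loc t : 0 <= t -> forall e : R, 0 < e -> exists2 e' : R, 0 < e' &
    forall s, 0 <= s -> `|s - t| < e' -> `|path_value k t w - path_value k s w| < e.
  move=> u; apply/cvgrPdist_lt => e e0.
  have [|e' e'0 h] := loc (Num.max u 0) _ e e0; first by rewrite le_max lexx orbT.
  apply/nbhs_ballP; exists e' => //= v; rewrite /ball /= => uv; apply: h.
    by rewrite le_max lexx orbT.
  by apply: le_lt_trans uv; rewrite distrC maxr_dist.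
move=> t0 e e0; rewrite /path_value; case Xt : (X t w) => [x|].
  have /cvgrPdist_lt /(_ e e0) /nbhs_ballR [e1 e10 h1] := ck x.
  have /nbhs_ballR [e2 e20 h2] := dif_continuous hX t0 Xt e10.
  exists e2 => // s s0 st; have [z Xs zx] := h2 s st s0.
  by rewrite Xs /=; exact: h1.
have dead s : t <= s -> X s w = None by move=> ts; exact: (dif_absorbed hX t0 ts).
have [[t' [t'0 t't Xt']]|t00|[t1 [ex L]]] := dead_case t0 Xt.
- exists (t - t'); first by rewrite subr_gt0.
  move=> s s0 st; rewrite (dif_absorbed hX t'0 _ Xt') /= ?subrr ?normr0 //.
  by move: st; rewrite ltr_norml; lra.
- by exists 1 => // s s0 _; rewrite dead ?t00 //= subrr normr0.
have [e' e'0 h] := exits_at_leave t1 L Ic Ic' ex.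
exists e' => // s s0; rewrite ltr_norml => st.
have [ts|st'] := leP t s; first by rewrite dead //= subrr normr0.
case Xs : (X s w) => [z|] /=; last by rewrite subrr normr0.
by rewrite k0 ?subrr ?normr0 //; apply: (h s z) => //; lra.
Qed.

Lemma alive_path_continuous t w x : 0 <= t -> X t w = Some x ->
  continuous (fun u => path_value id (Num.min t (Num.max u 0)) w).
Proof.
move=> t0 Xt u; apply/cvgrPdist_lt => e e0.
have cl v : 0 <= Num.min t (Num.max v 0) <= t.
  by rewrite le_min t0 le_max lexx orbT ge_min lexx.
have /andP[u0 ut] := cl u.
have [z Xz] := alive_before u0 ut Xt.
have /nbhs_ballR [e' e'0 h] := dif_continuous hX u0 Xz e0.
apply/nbhs_ballP; exists e' => //= v; rewrite /ball /= => uv.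
have /andP[v0 vt] := cl v.
have [|z' Xz' zz'] := h (Num.min t (Num.max v 0)) _ v0; last first.
  by rewrite /path_value Xz Xz' /= distrC.
apply: le_lt_trans uv; rewrite distrC.
by apply: le_trans (minr_dist _ _ _) _; exact: maxr_dist.
Qed.

(** The minimum and maximum over the compact interval [[0, t]] are values of the path, hence in [I].
    Thus intervals exhausting [I] eventually contain the whole path up to [t]. *)
Lemma alive_path_range t w x : 0 <= t -> X t w = Some x ->
  exists lo hi, [/\ I lo, I hi & forall s, 0 <= s -> s <= t ->
    exists2 z, X s w = Some z & lo <= z <= hi].
Proof.
move=> t0 Xt; have cp := alive_path_continuous t0 Xt.
pose p u := path_value id (Num.min t (Num.max u 0)) w.
have pE s : 0 <= s -> s <= t -> X s w = Some (p s).
  move=> s0 st; have [z Xz] := alive_before s0 st Xt.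
  by rewrite /p (max_idPl s0) (min_idPr st) /path_value Xz.
have cp' : {within `[0, t], continuous p} by exact: continuous_subspaceT.
have [s1] := EVT_min t0 cp'; rewrite in_itv /= => /andP[s10 s1t] h1.
have [s2] := EVT_max t0 cp'; rewrite in_itv /= => /andP[s20 s2t] h2.
exists (p s1), (p s2); split.
- exact: (dif_state hX s10 (pE _ s10 s1t)).
- exact: (dif_state hX s20 (pE _ s20 s2t)).
- move=> s s0 st; exists (p s); first exact: pE.
  by rewrite h1 ?h2 // in_itv /= s0.
Qed.

Lemma near_rational t u (A : R -> Prop) : 0 <= u -> u < t -> (\forall s \near u, 0 <= s -> A s) ->
  exists q : rat, [/\ 0 <= (ratr q : R), (ratr q : R) <= t & A (ratr q)].
Proof.
move=> u0 ut /nbhs_ballR [e e0 h].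
have [|q] := @rat_in_itvoo R u (Num.min t (u + e)).
  by rewrite lt_min ut ltrDl.
rewrite in_itv /= lt_min => /andP[uq /andP[qt qe]].
exists q; split; [exact: le_trans u0 (ltW uq)|exact: ltW|].
by apply: h; [rewrite gtr0_norm ?subr_gt0 //; lra|exact: le_trans u0 (ltW uq)].
Qed.

Lemma hitting_time_ge0 y w : (0 <= hitting_time X y w)%E.
Proof. by apply: le_ereal_inf_tmp => _ [s [s0 _] <-]; rewrite lee_fin. Qed.

Lemma hitting_time_le y w t : 0 <= t -> (exists2 z, X t w = Some z & y <= z) ->
  (hitting_time X y w <= t%:E)%E.
Proof. by move=> t0 h; apply: ereal_inf_lbound; exists t. Qed.

(** The infimum is attained: a path dead at [t] stays dead, and a path strictly below [y] at [t]
    stays below for a while, whereas hits occur arbitrarily soon after [t]. *)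
Lemma hitting_time_attained y w t : hitting_time X y w = t%:E ->
  [/\ 0 <= t, exists2 z, X t w = Some z & y <= z &
     forall s z, 0 <= s -> s < t -> X s w = Some z -> z < y].
Proof.
move=> ht; have t0 : 0 <= t by rewrite -lee_fin -ht hitting_time_ge0.
have before s z : 0 <= s -> s < t -> X s w = Some z -> z < y.
  move=> s0 st Xs; rewrite ltNge; apply/negP => yz.
  have : (hitting_time X y w <= s%:E)%E by apply: hitting_time_le => //; exists z.
  by rewrite ht lee_fin leNgt st.
have after e : 0 < e -> exists s, [/\ t <= s, s < t + e & exists2 z, X s w = Some z & y <= z].
  move=> e0; have : (hitting_time X y w < (t + e)%:E)%E by rewrite ht lte_fin ltrDl.
  move=> /ereal_inf_lt [_ [s [s0 [z Xs yz]] <-]]; rewrite lte_fin => ste.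
  exists s; split => //; last by exists z.
  by rewrite leNgt; apply/negP => st; have := before s z s0 st Xs; rewrite ltNge yz.
split => //.
case Xt : (X t w) => [x|]; last first.
  have [s [ts _ [z Xs _]]] := after 1 ltr01.
  by have := dif_absorbed hX t0 ts Xt; rewrite Xs.
exists x => //; rewrite leNgt; apply/negP => xy.
have yx0 : 0 < y - x by rewrite subr_gt0.
have /nbhs_ballR [e e0 h] := dif_continuous hX t0 Xt yx0.
have [s [ts ste [z Xs yz]]] := after e e0.
have [||z' Xs' zz'] := h s.
- by rewrite ger0_norm ?subr_ge0 //; lra.
- exact: le_trans ts.
move: zz'; rewrite Xs in Xs'; case: Xs' => <-.
by rewrite ltr_norml => /andP[_]; lra.
Qed.

(** A value strictly above [y] would, by continuity, also be taken a little earlier; positivity of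
    [t] provides the earlier time. *)
Lemma hitting_time_value y w t : hitting_time X y w = t%:E -> 0 < t -> X t w = Some y.
Proof.
move=> /hitting_time_attained [t0 [z Xt yz] before] t1; rewrite Xt; congr Some.
apply/eqP; rewrite eq_le yz andbT leNgt; apply/negP => yz'.
have yz0 : 0 < z - y by rewrite subr_gt0.
have /nbhs_ballR [e e0 h] := dif_continuous hX t0 Xt yz0.
pose s := Num.max 0 (t - e / 2).
have s0 : 0 <= s by rewrite le_max lexx.
have st : s < t by rewrite gt_max t1; lra.
have se : t - e / 2 <= s by rewrite le_max lexx orbT.
have [||z' Xs' zz'] := h s => //.
  by rewrite ltr0_norm ?subr_lt0 //; lra.
by have := before s z' s0 st Xs'; move: zz'; rewrite ltr_norml => /andP[]; lra.
Qed.

Lemma hitting_time_leP y w t : 0 <= t ->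
  (hitting_time X y w <= t%:E)%E <->
  exists s, [/\ 0 <= s, s <= t & exists2 z, X s w = Some z & y <= z].
Proof.
move=> t0; split => [|[s [s0 st h]]]; last first.
  by apply: le_trans (hitting_time_le s0 h) _; rewrite lee_fin.
case E : (hitting_time X y w) => [s| |]; rewrite ?lee_fin ?leye_eq //.
  by move=> st; exists s; have [s0 h _] := hitting_time_attained E; split.
by have := hitting_time_ge0 y w; rewrite E.
Qed.

End Paths.

(** * Measurability and adaptedness of path events *)

Section PathEvents.
Context {R : realType} {d : measure_display} {Omega : measurableType d}.
Variables (a b : \bar R) (mu sigma : R -> R) (F : R -> set_system Omega)
  (X : R -> Omega -> option R) (P : R -> probability Omega R).
Hypothesis hX : diffusion a b mu sigma F X P.
Local Notation I := (state_space a b).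
Implicit Types (k f : R -> R) (w : Omega) (s t u x y z c : R).

Lemma state_in_SomeP t (A : set R) w : state_in X t A w <-> exists2 z, X t w = Some z & A z.
Proof.
split; first by case=> z Az /esym Xz; exists z.
by case=> z Xz Az; exists z.
Qed.

Lemma state_in_measurable t (A : set R) : 0 <= t -> measurable A -> measurable (state_in X t A).
Proof.
move=> t0 mA; have [_ h _] := dif_filtration hX.
exact: h (dif_adapted hX t0 mA).
Qed.

Lemma path_value_measurable k u : measurable_fun setT k -> 0 <= u ->
  measurable_fun setT (path_value X k u).
Proof.
move=> mk u0 _ B mB; rewrite setTI.
have mkB : measurable (k @^-1` B) by rewrite -[X in measurable X]setTI; exact: mk.
rewrite (_ : _ @^-1` B = state_in X u (k @^-1` B) `|`
    (if 0 \in B then ~` state_in X u setT else set0)).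
  apply: measurableU; first exact: state_in_measurable.
  by case: ifP => // _; apply: measurableC; exact: state_in_measurable.
apply/seteqP; split => w /=; rewrite /path_value.
  case Xu : (X u w) => [z|] /=; first by left; exists z.
  by move=> B0; right; rewrite mem_set // => -[z _]; rewrite Xu.
move=> [[z /= Bkz <-] //|].
case: ifP => // /set_mem B0 nst; case Xu : (X u w) => [z|] //=.
by exfalso; apply: nst; exists z.
Qed.

Definition staying (c c' t : R) : set Omega :=
  [set w | forall s, 0 <= s -> s <= t -> exists2 z, X s w = Some z & c <= z <= c'].

(** Leaving the closed interval is an open condition in time, so before [t] it can be tested at
    rational times. Time [t] is tested separately; being alive there also forces the path to be
    alive at all earlier times. *)
Lemma staying_adapted c c' t : 0 <= t -> F t (staying c c' t).
Proof.
move=> t0; have [sF _ Fst] := dif_filtration hX.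
rewrite -[F t](sigma_algebra_id (sF t t0)).
pose A (q : rat) : set Omega :=
  if (0 <= (ratr q : R)) && ((ratr q : R) <= t) then state_in X (ratr q) `[c, c'] else setT.
have -> : staying c c' t = ~` (\bigcup_q ~` A q) `&` state_in X t `[c, c'].
  apply/seteqP; split => w.
    move=> st; split.
      move=> [q _] /=; apply; rewrite /A; case: ifP => // /andP[q0 qt].
      by apply/state_in_SomeP; have [z Xz zc] := st _ q0 qt; exists z => //=; rewrite in_itv.
    by apply/state_in_SomeP; have [z Xz zc] := st _ t0 (lexx t); exists z => //=; rewrite in_itv.
  move=> [hA /state_in_SomeP [x Xt xc]] s s0 st.
  move: xc; rewrite /= in_itv /= => xc.
  move: st; rewrite le_eqVlt => /orP[/eqP ->|st]; first by exists x.
  have [z Xs] := alive_before hX s0 (ltW st) Xt.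
  exists z => //; apply: contrapT => nz.
  have [e e0 he] : exists2 e, 0 < e & forall z', `|z' - z| < e -> ~ (c <= z' <= c').
    have [zc|cz] := ltP z c.
      by exists (c - z); rewrite ?subr_gt0 // => z'; rewrite ltr_norml => /andP[]; lra.
    have [zc|cz'] := ltP c' z; last by exfalso; apply: nz; rewrite cz.
    by exists (z - c'); rewrite ?subr_gt0 // => z'; rewrite ltr_norml => /andP[]; lra.
  have [q [q0 qt [z' Xq zz']]] := near_rational s0 st (dif_continuous hX s0 Xs e0).
  apply: hA; exists q => //; rewrite /A q0 qt /= => /state_in_SomeP [z''].
  by rewrite Xq => -[<-]; rewrite /= in_itv; exact: he.
have mS u A' : 0 <= u -> u <= t -> measurable A' -> <<s F t >> (state_in X u A').
  move=> u0 ut mA'; apply: sub_sigma_algebra; apply: (Fst u t) => //.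
  exact: (dif_adapted hX).
apply: (@measurableI _ (g_sigma_algebraType (F t))); last exact: mS.
apply: (@measurableC _ (g_sigma_algebraType (F t))).
apply: (@bigcupT_measurable_rat _ (g_sigma_algebraType (F t))) => q.
apply: (@measurableC _ (g_sigma_algebraType (F t))).
rewrite /A; case: ifP => [/andP[q0 qt]|_]; first exact: mS.
exact: (@measurableT _ (g_sigma_algebraType (F t))).
Qed.

(** Peak [1] exactly at [y], support in [[y0, y1]]. With the support inside [I], the tent along a
    path is continuous even across death, and hitting [y] means reaching the value [1]. *)
Definition tent (y0 y y1 z : R) : R :=
  Num.max 0 (Num.min ((z - y0) / (y - y0)) ((y1 - z) / (y1 - y))).

Lemma tent_continuous (y0 y y1 : R) : continuous (tent y0 y y1).
Proof.
move=> z.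
have h1 : {for z, continuous (fun z => (z - y0) / (y - y0))}.
  apply: cvgM; last exact: cvg_cst.
  by apply: cvgB; [exact: cvg_id|exact: cvg_cst].
have h2 : {for z, continuous (fun z => (y1 - z) / (y1 - y))}.
  apply: cvgM; last exact: cvg_cst.
  by apply: cvgB; [exact: cvg_cst|exact: cvg_id].
have h3 : {for z, continuous (cst 0 : R -> R)} by exact: cvg_cst.
exact: (continuous_max h3 (continuous_min h1 h2)).
Qed.

Lemma tent_le1 (y0 y y1 z : R) : y0 < y -> y < y1 -> tent y0 y y1 z <= 1.
Proof.
move=> h0 h1; rewrite /tent ge_max ler01 /= ge_min !ler_pdivrMr ?subr_gt0 // !mul1r.
by rewrite !lerD2r; case: (leP z y) => //= h; lra.
Qed.

Lemma tent_eq1 (y0 y y1 z : R) : y0 < y -> y < y1 -> (1 <= tent y0 y y1 z) <-> z = y.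
Proof.
move=> h0 h1; rewrite /tent le_max (leNgt 1 0) ltr01 /= le_min.
rewrite !ler_pdivlMr ?subr_gt0 // !mul1r.
by split => [/andP[]|->]; [lra|rewrite !lexx].
Qed.

Lemma tent_out (y0 y y1 z : R) : y0 < y -> y < y1 -> ~ (y0 <= z <= y1) -> tent y0 y y1 z = 0.
Proof.
move=> h0 h1 zn; apply/max_idPl; rewrite ge_min.
have [zy|yz] := ltP z y0.
  by apply/orP; left; rewrite pmulr_lle0 ?invr_gt0 ?subr_gt0 // subr_le0 ltW.
have [zy|yz'] := ltP y1 z.
  by apply/orP; right; rewrite pmulr_lle0 ?invr_gt0 ?subr_gt0 // subr_le0 ltW.
by exfalso; apply: zn; rewrite yz.
Qed.

Lemma state_space_lower x : I x -> exists2 z, I z & z < x.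
Proof.
move=> Ix; have [e e0 h] := nbhs_ballR (state_space_near Ix).
exists (x - e / 2); last by lra.
apply: h; have -> : x - e / 2 - x = - (e / 2) by ring.
by rewrite normrN gtr0_norm; lra.
Qed.

Lemma state_space_upper x : I x -> exists2 z, I z & x < z.
Proof.
move=> Ix; have [e e0 h] := nbhs_ballR (state_space_near Ix).
exists (x + e / 2); last by lra.
apply: h; have -> : x + e / 2 - x = e / 2 by ring.
by rewrite gtr0_norm; lra.
Qed.

(* A path started below [y] exceeds [y] before time [t] iff a tent function
   peaked at [y] attains its maximum along it; by compactness this can be
   tested at rational times. *)
Lemma hitting_time_le_event (S : set_system Omega) y t : I y -> 0 <= t ->
  sigma_algebra setT S ->
  (forall u A, 0 <= u -> u <= t -> measurable A -> S (state_in X u A)) ->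
  S [set w | (hitting_time X y w <= t%:E)%E].
Proof.
move=> Iy t0 sS mS'.
have [y0 Iy0 y0y] := state_space_lower Iy.
have [y1 Iy1 yy1] := state_space_upper Iy.
pose k := tent y0 y y1.
have ck : continuous k by exact: tent_continuous.
have k1 z : k z <= 1 by exact: tent_le1.
have kE z : (1 <= k z) <-> z = y by exact: tent_eq1.
have k0 z : ~ (y0 <= z <= y1) -> k z = 0 by exact: tent_out.
rewrite -[S](sigma_algebra_id sS).
pose B (n : nat) : set R := k @^-1` `]1 - n.+1%:R^-1, +oo[.
pose A (n : nat) (q : rat) : set Omega :=
  if (0 <= (ratr q : R)) && ((ratr q : R) <= t) then state_in X (ratr q) (B n) else set0.
have n0 (n : nat) : (0 : R) < n.+1%:R^-1 by rewrite invr_gt0.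
have n1 (n : nat) : (n.+1%:R^-1 : R) <= 1 by rewrite invf_le1 // ler1n.
(* The first event covers starts at or above [y]: a path starting strictly higher need not meet the
   peak. The second says that for every [n] some rational time up to [t] has tent value above
   [1 - n.+1%:R^-1]. *)
have -> : [set w | (hitting_time X y w <= t%:E)%E] =
    state_in X 0 `[y, +oo[ `|` (~` \bigcup_n ~` \bigcup_q A n q).
  apply/seteqP; split => w /=.
    case E : (hitting_time X y w) => [s| |]; rewrite ?lee_fin ?leye_eq //; last first.
      by have := hitting_time_ge0 X y w; rewrite E.
    move=> st; have [s0 [z Xz yz] _] := hitting_time_attained hX E.
    move: s0; rewrite le_eqVlt => /orP[/eqP s0|s0].
      by left; apply/state_in_SomeP; exists z; rewrite ?s0 //= in_itv /= yz.
    right; move=> [n _] /=; apply.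
    have Xs := hitting_time_value hX E s0.
    have ky : 1 - n.+1%:R^-1 < k y by apply: (@lt_le_trans _ _ 1); [rewrite gtrBl n0|apply/kE].
    have [e e0 he] : exists2 e, 0 < e & forall z', `|z' - y| < e -> 1 - n.+1%:R^-1 < k z'.
      exact: nbhs_ballR (cvgr_gt _ (ck y) _ ky).
    have [e' e'0 he'] := nbhs_ballR (dif_continuous hX (ltW s0) Xs e0).
    have [|q] := @rat_in_itvoo R (Num.max 0 (s - e')) s.
      by rewrite gt_max s0 /=; lra.
    rewrite in_itv /= gt_max => /andP[/andP[q0 qe] qs].
    exists q => //; rewrite /A (ltW q0) (le_trans (ltW qs) st) /=.
    apply/state_in_SomeP.
    have [| |z' Xq zz'] := he' (ratr q); [|exact: ltW|].
      by rewrite ltr0_norm ?subr_lt0 //; lra.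
    by exists z' => //; rewrite /B /= in_itv /= andbT; exact: he.
  move=> [/state_in_SomeP [z X0]|hA].
    rewrite /= in_itv /= andbT => yz; apply/(hitting_time_leP hX) => //.
    by exists 0; split => //; exists z.
  have cp := @path_value_continuous _ _ _ _ _ _ _ _ _ _ hX k y0 y1 w ck Iy0 Iy1 k0.
  have cp' : {within `[0, t], continuous (fun u => path_value X k (Num.max u 0) w)}.
    exact: continuous_subspaceT.
  have [s] := EVT_max t0 cp'; rewrite in_itv /= => /andP[s0 st] hs.
  rewrite (max_idPl s0) in hs.
  have : 1 <= path_value X k s w.
    rewrite leNgt; apply/negP => lt1.
    have [n nlt] : exists n : nat, (n.+1%:R^-1 : R) < 1 - path_value X k s w.
      have pos : 0 < 1 - path_value X k s w by rewrite subr_gt0.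
      have [N _ hN] := near_infty_natSinv_lt (PosNum pos).
      by exists N; exact: (hN N (leqnn N)).
    apply: hA; exists n => //= -[q _]; rewrite /A.
    case: ifP => // /andP[q0 qt] /state_in_SomeP [z Xq].
    rewrite /B /= in_itv /= andbT => kz.
    have := hs (ratr q); rewrite in_itv /= q0 qt (max_idPl q0) => /(_ isT).
    rewrite {1}/path_value Xq /= leNgt => /negP; apply.
    by apply: lt_trans kz; rewrite ltrBrDr addrC -ltrBrDr.
  rewrite /path_value; case Xs : (X s w) => [z|] /=; last by rewrite leNgt ltr01.
  move=> /kE zy; apply/(hitting_time_leP hX) => //; exists s; split => //.
  by exists z => //; rewrite zy.
pose T := g_sigma_algebraType S.
have mS u A' : 0 <= u -> u <= t -> measurable A' -> <<s S >> (state_in X u A').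
  by move=> u0 ut mA'; apply: sub_sigma_algebra; exact: mS'.
apply: (@measurableU _ T); first by apply: mS => //; exact: measurable_itv.
apply: (@measurableC _ T); apply: (@bigcupT_measurable _ T) => n.
apply: (@measurableC _ T); apply: (@bigcupT_measurable_rat _ T) => q.
rewrite /A; case: ifP => [/andP[q0 qt]|_]; last exact: (@measurable0 _ T).
apply: mS => //; rewrite /B -[X in measurable X]setTI.
apply: continuous_measurable_fun => //; exact: measurable_itv.
Qed.

End PathEvents.

(** * Optional stopping *)

Section IntervalIntegral.
Context {R : realType}.
Implicit Types (y l k : R -> R) (u v s t : R).
Local Notation leb := (@lebesgue_measure R).

Lemma continuous_segment_integrable y u v : continuous y ->
  leb.-integrable `[u, v] (EFin \o y).
Proof.
by move=> cy; apply: continuous_compact_integrable;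
  [exact: segment_compact|exact: continuous_subspaceT].
Qed.

Lemma Rintegral_segment_cst (c u v : R) : u <= v ->
  \int[leb]_(t in `[u, v]) c = c * (v - u).
Proof.
move=> uv; rewrite Rintegral_cst //.
have := @lebesgue_measure_itv R `[u, v]; rewrite /= lte_fin => ->.
case: ltP => [//|vu]; have -> : v = u by apply/eqP; rewrite eq_le vu.
by rewrite subrr.
Qed.

Lemma Rintegral_segment_le y (c u v : R) : continuous y -> u <= v ->
  (forall t, u <= t <= v -> y t <= c) -> \int[leb]_(t in `[u, v]) y t <= c * (v - u).
Proof.
move=> cy uv yc; rewrite -Rintegral_segment_cst //; apply: le_Rintegral => //.
- exact: continuous_segment_integrable.
- by apply: (@continuous_segment_integrable (cst c)) => x; exact: cvg_cst.
Qed.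

Lemma Rintegral_segment_ge y (c u v : R) : continuous y -> u <= v ->
  (forall t, u <= t <= v -> c <= y t) -> c * (v - u) <= \int[leb]_(t in `[u, v]) y t.
Proof.
move=> cy uv yc; rewrite -Rintegral_segment_cst //; apply: le_Rintegral => //.
- by apply: (@continuous_segment_integrable (cst c)) => x; exact: cvg_cst.
- exact: continuous_segment_integrable.
Qed.

Lemma Rintegral_segment_split y s u v : leb.-integrable `[s, v] (EFin \o y) ->
  s <= u -> u <= v ->
  \int[leb]_(t in `[s, v]) y t = \int[leb]_(t in `[s, u]) y t + \int[leb]_(t in `[u, v]) y t.
Proof.
move=> iy su uv; apply/eqP; rewrite addrC -subr_eq; apply/eqP.
rewrite (@Rintegral_itvB R y (BLeft s) (BRight v) u) //.
rewrite -Rintegral_itv_obnd_cbnd //; apply: integrableS iy => //.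
by move=> z /=; rewrite !in_itv /= => /andP[uz ->]; rewrite (le_trans su (ltW uz)).
Qed.

(** Used to see that time integrals along a path are measurable in the path, as limits of finite
    sums of measurable functions. *)
Lemma riemann_sum_cvg y s t : continuous y -> s <= t ->
  (fun m : nat => \sum_(j < m.+1) (t - s) / m.+1%:R * y (s + (t - s) / m.+1%:R * j%:R))
    @ \oo --> \int[leb]_(u in `[s, t]) y u.
Proof.
move=> cy st; apply/cvgrPdist_le => e e0.
(* The added [1] keeps the quotient meaningful when [s = t]. *)
have e10 : 0 < e / (t - s + 1) by rewrite divr_gt0 //; lra.
have [d d0 hd] := uniform_continuity_segment st e10 (fun x _ => cy x).
have dts : 0 < d / (t - s + 1) by rewrite divr_gt0 //; lra.
have [N _ hN] := near_infty_natSinv_lt (PosNum dts).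
exists N => // m Nm /=.
set de := (t - s) / m.+1%:R.
have m0 : (0 : R) < m.+1%:R by [].
have de0 : 0 <= de by rewrite /de divr_ge0 // subr_ge0.
have dem : de * m.+1%:R = t - s by rewrite /de divfK // gt_eqF.
have ded : de < d.
  have /= := hN m Nm; rewrite /de ltr_pdivlMr; last lra.
  move=> h; apply: le_lt_trans h; rewrite mulrC ler_wpM2l ?invr_ge0 //; lra.
have key (i : nat) : (i <= m.+1)%N ->
    `|\int[leb]_(u in `[s, s + de * i%:R]) y u - \sum_(j < i) de * y (s + de * j%:R)|
      <= e / (t - s + 1) * (de * i%:R).
  elim: i => [_|i IH im].
    by rewrite big_ord0 mulr0 addr0 mulr0 set_itv1 Rintegral_set1 subr0 normr0.
  have := IH (ltnW im).
  have dei : 0 <= de * i%:R by rewrite mulr_ge0.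
  have iS : de * i.+1%:R = de * i%:R + de by rewrite -natr1 mulrDr mulr1.
  have ile : de * i.+1%:R <= t - s by rewrite -dem ler_wpM2l // ler_nat.
  have h1 : s <= s + de * i%:R by lra.
  have h2 : s + de * i%:R <= s + de * i.+1%:R by rewrite iS; lra.
  rewrite big_ord_recr /=.
  rewrite (@Rintegral_segment_split y _ _ _ (continuous_segment_integrable _ _ cy) h1 h2).
  have osc v : s + de * i%:R <= v <= s + de * i.+1%:R ->
      `|y v - y (s + de * i%:R)| <= e / (t - s + 1).
    move=> /andP[v1 v2]; apply: hd; first by apply/andP; split; lra.
    by rewrite ger0_norm; lra.
  have deE : s + de * i.+1%:R - (s + de * i%:R) = de by rewrite iS; ring.
  have up := @Rintegral_segment_le y (y (s + de * i%:R) + e / (t - s + 1)) _ _ cy h2.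
  have lo := @Rintegral_segment_ge y (y (s + de * i%:R) - e / (t - s + 1)) _ _ cy h2.
  rewrite deE in up lo.
  have {}up := up (fun v hv => ltac:(by have := osc v hv; rewrite ler_norml => /andP[]; lra)).
  have {}lo := lo (fun v hv => ltac:(by have := osc v hv; rewrite ler_norml => /andP[]; lra)).
  rewrite !ler_norml => /andP[h3 h4]; apply/andP; split.
  - have -> : e / (t - s + 1) * (de * i.+1%:R) = e / (t - s + 1) * (de * i%:R) + e / (t - s + 1) * de.
      by rewrite iS; ring.
    lra.
  - have -> : e / (t - s + 1) * (de * i.+1%:R) = e / (t - s + 1) * (de * i%:R) + e / (t - s + 1) * de.
      by rewrite iS; ring.
    lra.
have := key m.+1 (leqnn _); rewrite dem.
have -> : s + (t - s) = t by ring.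
move=> /le_trans; apply.
by rewrite mulrAC ler_pdivrMr; [rewrite ler_wpM2l ?ltW //; lra|lra].
Qed.

End IntervalIntegral.

(** * Time grids and discrete discounting *)

Section Grid.
Context {R : realType}.
Local Notation leb := (@lebesgue_measure R).

(** Along one path, [p j] tells whether the event attached to the grid time [de * j] holds. It is
    true before [rho], false after, and undecided at [rho]. [J] is the first failing index, capped
    at [M]; in every case its grid time overshoots [rho] by at most one step. *)
Lemma grid_index (p : nat -> bool) (rho de : R) (M : nat) : 0 < de ->
  0 <= rho -> rho <= de * M%:R -> (forall j, de * j%:R < rho -> p j) ->
  (forall j, p j -> de * j%:R <= rho) ->
  exists J : nat, [/\ (J <= M)%N, forall j, (j < M)%N -> p j = (j < J)%N,
    rho <= de * J%:R, forall j, (j < J)%N -> de * j%:R <= rho & de * J%:R <= rho + de].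
Proof.
move=> de0 rho0 rhoM p1 p2.
have exJ : exists j, ~~ p j || (j == M) by exists M; rewrite eqxx orbT.
pose J := ex_minn exJ.
have [PJ minJ] : (~~ p J || (J == M)) /\ forall j, (j < J)%N -> p j && (j != M).
  rewrite /J; case: ex_minnP => n Pn mn; split => // j jn.
  by rewrite -[p j]negbK -negb_or; apply/negP => /mn; rewrite leqNgt jn.
have JM : (J <= M)%N.
  by rewrite leqNgt; apply/negP => /minJ /andP[_]; rewrite eqxx.
have rJ : rho <= de * J%:R.
  move: PJ => /orP[npJ|/eqP -> //]; rewrite leNgt; apply/negP => /p1.
  by move: npJ => /negP.
exists J; split => //.
- move=> j jM; case: (ltnP j J) => [/minJ /andP[] //|Jj].
  apply/negP => pj; have jr := p2 j pj.
  have eJ : j = J.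
    apply/eqP; rewrite eqn_leq Jj andbT -(ler_nat R) -(ler_pM2l de0).
    exact: le_trans jr rJ.
  by move: PJ; rewrite -eJ pj /= => /eqP jM'; move: jM; rewrite jM' ltnn.
- by move=> j /minJ /andP[/p2].
- case E : J => [|j]; first by rewrite mulr0 addr_ge0 // ltW.
  have /minJ /andP[/p2 h _] : (j < J)%N by rewrite E.
  by rewrite -natr1 mulrDr mulr1 lerD2r.
Qed.

Lemma summation_by_parts (e y la : nat -> R) (J : nat) :
  \sum_(j < J) e j.+1 * (y j.+1 - y j - la j) =
  e J * y J - e 0%N * y 0%N + \sum_(j < J) ((e j - e j.+1) * y j - e j.+1 * la j).
Proof.
elim: J => [|J IH]; first by rewrite !big_ord0 subrr addr0.
by rewrite !big_ord_recr /= IH; ring.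
Qed.

(** Both bounds are [1 + x <= expR x], at [x = r * de] and at [x = - (r * de)]; they stand in for
    the derivative of the discount factor. *)
Lemma discount_step (r de u : R) : 0 <= r -> 0 <= de ->
  0 <= expR (- (r * u)) - expR (- (r * (u + de))) - r * de * expR (- (r * (u + de))) /\
  expR (- (r * u)) - expR (- (r * (u + de))) <= r * de * expR (- (r * u)).
Proof.
move=> r0 de0; have x0 : 0 <= r * de by exact: mulr_ge0.
have e1 : expR (- (r * u)) = expR (- (r * (u + de))) * expR (r * de).
  by rewrite -expRD; congr expR; ring.
have e2 : expR (- (r * (u + de))) = expR (- (r * u)) * expR (- (r * de)).
  by rewrite -expRD; congr expR; ring.
split.
  rewrite {1}e1.
  have := expR_ge1Dx (r * de) => h.
  have p := expR_ge0 (- (r * (u + de))).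
  have := ler_wpM2l p h; lra.
rewrite e2.
have := expR_ge1Dx (- (r * de)) => h.
have p := expR_ge0 (- (r * u)).
have := ler_wpM2l p h; lra.
Qed.

End Grid.

Section DiscountedSum.
Context {R : realType}.
Local Notation leb := (@lebesgue_measure R).
Variables (y l : R -> R) (r K de : R).
Hypotheses (cl : continuous l) (r0 : 0 <= r) (K0 : 0 <= K) (de0 : 0 < de).
Hypotheses (yK : forall u, `|y u| <= K) (lK : forall u, `|l u| <= K).

(** One cell of a discrete version of the integral of [e^(-r t)] against the martingale of the
    martingale problem, with [y] and [l] a path of [f(X)] and of its generator. Discounting at the
    right end makes summation by parts leave [y] at the left end of each cell. *)
Definition discounted_increment (j : nat) : R :=
  expR (- (r * (de * j.+1%:R))) * (y (de * j.+1%:R) - y (de * j%:R)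
    - \int[leb]_(u in `[de * j%:R, de * j.+1%:R]) l u).

Let e (j : nat) : R := expR (- (r * (de * j%:R))).
Let la (j : nat) : R := \int[leb]_(u in `[de * j%:R, de * j.+1%:R]) l u.
Let term (j : nat) : R := (e j - e j.+1) * y (de * j%:R) - e j.+1 * la j.

Let e0 : e 0%N = 1. Proof. by rewrite /e !mulr0 oppr0 expR0. Qed.

Let eS0 j : 0 <= e j. Proof. exact: expR_ge0. Qed.

Let eS1 j : e j <= 1.
Proof. by rewrite /e -expR0 ler_expR oppr_le0 mulr_ge0 // mulr_ge0 // ltW. Qed.

Let grid_le j : de * j%:R <= de * j.+1%:R.
Proof. by rewrite ler_pM2l // ler_nat. Qed.

Let grid_step j : de * j.+1%:R - de * j%:R = de.
Proof. by rewrite -natr1; ring. Qed.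

Let step j : 0 <= e j - e j.+1 - r * de * e j.+1 /\ e j - e j.+1 <= r * de * e j.
Proof.
have := discount_step (de * j%:R) r0 (ltW de0).
by have -> : de * j%:R + de = de * j.+1%:R by rewrite -natr1; ring.
Qed.

Let e_decr j : e j.+1 <= e j.
Proof.
have [h _] := step j; have : 0 <= r * de * e j.+1 by rewrite mulr_ge0 // mulr_ge0 // ltW.
by lra.
Qed.

Let laK j : `|la j| <= K * de.
Proof.
have bd u : - K <= l u <= K by rewrite -ler_norml.
rewrite ler_norml /la; apply/andP; split.
  rewrite -mulNr -{1}(grid_step j); apply: Rintegral_segment_ge => // u _.
  by have /andP[] := bd u.
rewrite -[X in K * X](grid_step j); apply: Rintegral_segment_le => // u _.
by have /andP[] := bd u.
Qed.

Lemma discounted_increment_sum (J : nat) :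
  \sum_(j < J) discounted_increment j =
  e J * y (de * J%:R) - y 0 + \sum_(j < J) term j.
Proof.
have := @summation_by_parts R e (fun j => y (de * j%:R)) la J.
by rewrite e0 mul1r mulr0.
Qed.

(** As [e] decreases, the terms [(e j - e j.+1) * y] add up to at most [K]. The bound depends on the
    elapsed time [de * J] and not on the number of cells, so it dominates as the mesh shrinks. *)
Lemma discounted_increment_sum_bound (J : nat) :
  `|\sum_(j < J) discounted_increment j| <= 3 * K + K * (de * J%:R).
Proof.
rewrite discounted_increment_sum.
have h1 : `|e J * y (de * J%:R)| <= K.
  rewrite normrM (ger0_norm (eS0 J)) -[K]mul1r.
  by apply: ler_pM => //; exact: eS1.
have h2 := yK 0.
have h3 : `|\sum_(j < J) term j| <= K * (1 - e J) + K * (de * J%:R).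
  elim: J {h1} => [|J IH]; first by rewrite big_ord0 normr0 e0 subrr !mulr0 addr0.
  rewrite big_ord_recr /=; apply: le_trans (ler_normD _ _) _.
  have -> : K * (1 - e J.+1) + K * (de * J.+1%:R) =
      K * (1 - e J) + K * (de * J%:R) + (K * (e J - e J.+1) + K * de).
    by rewrite -natr1; ring.
  apply: lerD => //; apply: le_trans (ler_normB _ _) _; apply: lerD.
    rewrite normrM ger0_norm ?subr_ge0 // mulrC.
    by apply: ler_wpM2r => //; rewrite subr_ge0.
  rewrite normrM (ger0_norm (eS0 _)) -[K * de]mul1r.
  by apply: ler_pM.
apply: le_trans (ler_normD _ _) _.
have h4 := ler_normB (e J * y (de * J%:R)) (y 0).
have h5 : 0 <= K * e J by rewrite mulr_ge0.
lra.
Qed.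

(** In a cell ending before [rho], the integral of [l] is at most about [r * y + eps] times [de],
    which the decrease of the discount factor cancels up to [osc] and a telescoping error of total
    [K * r * de]. The last cell may overrun [rho], where nothing is known on [l]; it is bounded
    crudely by [K * r * de + K * de]. *)
Lemma discounted_increment_sum_ge (rho eps osc : R) (J : nat) :
  0 <= eps -> 0 <= osc ->
  (forall u, 0 < rho -> 0 <= u -> u <= rho -> l u <= r * y u + eps) ->
  (forall j u, (j < J)%N -> de * j%:R <= u -> u <= de * j.+1%:R ->
    `|y u - y (de * j%:R)| <= osc) ->
  (forall j, (j < J)%N -> de * j%:R <= rho) ->
  expR (- (r * (de * J%:R))) * y (de * J%:R) - y 0
    - de * J%:R * (r * osc + eps) - (2 * K * r + K) * de
  <= \sum_(j < J) discounted_increment j.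
Proof.
move=> eps0 osc0 ly yosc jrho; rewrite discounted_increment_sum.
have ro0 : 0 <= r * osc + eps by rewrite addr_ge0 // mulr_ge0.
have good j : (j < J)%N -> de * j.+1%:R <= rho ->
    - (de * (r * osc + eps)) - K * r * de * (e j - e j.+1) <= term j.
  move=> jJ jr.
  have rho0 : 0 < rho by apply: lt_le_trans jr; rewrite mulr_gt0.
  have la_le : la j <= (r * (y (de * j%:R) + osc) + eps) * de.
    rewrite -[X in _ <= _ * X](grid_step j); apply: Rintegral_segment_le => // u /andP[u1 u2].
    have u0 : 0 <= u by apply: le_trans u1; rewrite mulr_ge0 // ltW.
    apply: le_trans (ly u rho0 u0 (le_trans u2 jr)) _.
    rewrite lerD2r ler_wpM2l //.
    by have := yosc j u jJ u1 u2; rewrite ler_norml => /andP[]; lra.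
  have [s1 s2] := step j.
  have y1 : - K <= y (de * j%:R) by have := yK (de * j%:R); rewrite ler_norml => /andP[].
  rewrite /term.
  have p1 := ler_wpM2l (eS0 j.+1) la_le.
  have p2 : 0 <= (e j - e j.+1 - r * de * e j.+1) * (y (de * j%:R) + K).
    by rewrite mulr_ge0 //; lra.
  have p3 : K * (e j - e j.+1 - r * de * e j.+1) <= K * (r * de * e j - r * de * e j.+1).
    by rewrite ler_wpM2l //; lra.
  have p4 : e j.+1 * ((r * osc + eps) * de) <= (r * osc + eps) * de.
    by rewrite ler_piMl // mulr_ge0 // ltW.
  move: p1 p2 p3 p4; set E1 := e j; set E2 := e j.+1; set Y := y _; set L := la j.
  move=> p1 p2 p3 p4; lra.
have goods (i : nat) : (i < J)%N -> de * i%:R <= rho ->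
    - (de * i%:R * (r * osc + eps)) - K * r * de * (1 - e i) <= \sum_(j < i) term j.
  elim: i => [_ _|i IH iJ ir].
    by rewrite big_ord0 mulr0 mul0r e0 subrr mulr0 oppr0 addr0.
  rewrite big_ord_recr /=.
  have h1 := IH (ltnW iJ) (le_trans (grid_le i) ir).
  have h2 := good i (ltnW iJ) ir.
  have := lerD h1 h2; apply: le_trans.
  by rewrite le_eqVlt; apply/orP; left; apply/eqP; rewrite -natr1; ring.
have Krd : 0 <= K * r * de by rewrite mulr_ge0 ?mulr_ge0 // ltW.
have main : - (de * J%:R * (r * osc + eps)) - (2 * K * r + K) * de <= \sum_(j < J) term j.
  case: (J) goods jrho => [|i] goods' jrho'.
    have K2 : 0 <= 2 * K * r + K by rewrite addr_ge0 // mulr_ge0 // mulr_ge0.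
    by rewrite big_ord0 mulr0 mul0r oppr0 sub0r oppr_le0 mulr_ge0 // ltW.
  have h1 := goods' i (ltnSn i) (jrho' i (ltnSn i)).
  rewrite big_ord_recr /=.
  have [s1 s2] := step i.
  have h2 : - (K * r * de) - K * de <= term i.
    have t1 : `|(e i - e i.+1) * y (de * i%:R)| <= r * de * K.
      rewrite normrM; apply: ler_pM => //.
      rewrite ger0_norm ?subr_ge0 //; apply: le_trans s2 _.
      by rewrite ler_piMr // mulr_ge0 // ltW.
    have t2 : `|e i.+1 * la i| <= 1 * (K * de).
      by rewrite normrM (ger0_norm (eS0 _)); apply: ler_pM.
    rewrite /term; move: t1 t2; rewrite !ler_norml => /andP[t1 _] /andP[_ t2].
    lra.
  have h3 : 0 <= K * r * de * e i by rewrite mulr_ge0.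
  have h4 : de * i%:R * (r * osc + eps) <= de * i.+1%:R * (r * osc + eps).
    by rewrite ler_wpM2r.
  lra.
rewrite -/(e J); lra.
Qed.

End DiscountedSum.

(** * Expectations of bounded real random variables *)

Section BoundedExpectation.
Context {R : realType} {d : measure_display} {Omega : measurableType d}.
Variable P : probability Omega R.
Implicit Types (u v : Omega -> R).

Lemma bounded_integrable u (M : R) : measurable_fun setT u ->
  (forall w, `|u w| <= M) -> P.-integrable setT (EFin \o u).
Proof.
move=> mu uM; apply: measurable_bounded_integrable => //.
  by apply: (le_lt_trans (probability_le1 P measurableT)); exact: ltry.
exists M; split; first exact: num_real.
by move=> x Mx w _ /=; apply: le_trans (uM w) (ltW Mx).
Qed.

Lemma expectation_cst (c : R) : \int[P]_w c = c.
Proof.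
rewrite Rintegral_cst // [X in fine X](_ : _ = 1%E); last exact: probability_setT.
by rewrite mulr1.
Qed.

Lemma expectation_sum (n : nat) (u : nat -> Omega -> R) (M : nat -> R) :
  (forall j, measurable_fun setT (u j)) -> (forall j w, `|u j w| <= M j) ->
  \int[P]_w (\sum_(j < n) u j w) = \sum_(j < n) \int[P]_w u j w.
Proof.
move=> mu uM; elim: n => [|n IH].
  rewrite big_ord0 -[RHS](expectation_cst 0); apply: eq_Rintegral => w _.
  by rewrite big_ord0.
rewrite big_ord_recr /= -IH -RintegralD //.
- by apply: eq_Rintegral => w _; rewrite big_ord_recr.
- apply: (@bounded_integrable _ (\sum_(j < n) M j)).
    by apply: measurable_sum.
  move=> w; apply: le_trans (ler_norm_sum _ _ _) _; exact: ler_sum.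
- exact: bounded_integrable (uM n).
Qed.

Lemma bounded_convergence (u_ : nat -> Omega -> R) u (M : R) :
  (forall n, measurable_fun setT (u_ n)) -> measurable_fun setT u ->
  (forall n w, `|u_ n w| <= M) ->
  {ae P, forall w, u_ n w @[n --> \oo] --> u w} ->
  (fun n => \int[P]_w u_ n w) @ \oo --> \int[P]_w u w.
Proof.
move=> mu_ mu uM cu.
have [| | | | |iu _ cv] := @dominated_convergence _ Omega R P setT measurableT
  (fun n => EFin \o u_ n) (EFin \o u) (cst M%:E).
- by move=> n; exact/measurable_EFinP.
- exact/measurable_EFinP.
- by apply: filterS cu => w cw _; apply: cvg_EFin => //; exact: nearW.
- exact: (@finite_measure_integrable_cst _ _ _ P setT M).
- by apply: nearW => w n _ /=; rewrite lee_fin.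
rewrite /Rintegral; apply: fine_cvg; rewrite fineK //.
exact: integrable_fin_num.
Qed.

End BoundedExpectation.

(** * Discounted optional stopping for compactly supported test functions *)

Section OptionalStopping.
Context {R : realType} {d : measure_display} {Omega : measurableType d}.
Variables (a b : \bar R) (mu sigma : R -> R) (F : R -> set_system Omega)
  (X : R -> Omega -> option R) (P : R -> probability Omega R).
Hypothesis hX : diffusion a b mu sigma F X P.
Hypothesis hmu : forall x, state_space a b x -> {for x, continuous mu}.
Hypothesis hsigma : forall x, state_space a b x -> {for x, continuous sigma}.
Local Notation I := (state_space a b).
Local Notation leb := (@lebesgue_measure R).
Implicit Types (k f : R -> R) (w : Omega) (s t u x y z c : R).

Lemma compact_support_bounded k c c' : continuous k ->
  (forall z, ~ (c <= z <= c') -> k z = 0) -> exists2 K, 0 <= K & forall z, `|k z| <= K.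
Proof.
move=> ck k0; have [cc'|c'c] := leP c c'.
  have [M hM] := locally_bounded_segment cc' (fun z _ => dnbhs_bound_of_continuous (ck z)).
  exists `|M| => // z; have [zc|zc] := boolP (c <= z <= c').
    by apply: le_trans (hM z zc) (ler_norm M).
  by rewrite k0 ?normr0 //; exact/negP.
exists 0 => // z; rewrite k0 ?normr0 //; lra.
Qed.

(** Near a point outside [[c, c']] the function vanishes identically, hence so do its derivatives.
    This yields continuity on the whole line although [mu] and [sigma] are controlled inside [I]
    only. *)
Lemma generator_continuous f c c' : I c -> I c' -> (forall z, C2_at f z) ->
  (forall z, ~ (c <= z <= c') -> f z = 0) ->
  continuous (generator mu sigma f) /\
  forall z, ~ (c <= z <= c') -> generator mu sigma f z = 0.
Proof.
move=> Ic Ic' C2f f0.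
have out z : ~ (c <= z <= c') -> \forall t \near z, ~ (c <= t <= c').
  move=> /negP; rewrite negb_and -!ltNge => /orP[zc|cz].
    near=> t; have : t < c by near: t; exact: lt_nbhsl.
    by move=> tc /andP[ct _]; move: tc; rewrite ltNge ct.
  near=> t; have : c' < t by near: t; exact: lt_nbhsr.
  by move=> tc /andP[_ ct]; move: tc; rewrite ltNge ct.
have f1 z : ~ (c <= z <= c') -> derive1 f z = 0.
  move=> /out zo; rewrite derive1E (@near_eq_derive _ _ _ f (cst 0)) ?derive_cst //.
  by apply: filterS zo => t /f0.
have f2 z : ~ (c <= z <= c') -> derive1 (derive1 f) z = 0.
  move=> /out zo; rewrite derive1E (@near_eq_derive _ _ _ (derive1 f) (cst 0)) ?derive_cst //.
  by apply: filterS zo => t /f1.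
have G0 z : ~ (c <= z <= c') -> generator mu sigma f z = 0.
  by move=> zo; rewrite /generator f1 // f2 // !mulr0 addr0.
split => // z; have [zc|zc] := boolP (c <= z <= c').
  have Iz := state_space_segment Ic Ic' zc.
  have [_ _ c2] := C2f z.
  have cs := hsigma Iz.
  apply: cvgD; apply: cvgM => //.
  - by apply: cvgM; [exact: cvg_cst|rewrite expr2; apply: cvgM].
  - exact: hmu.
  - exact: C2_at_continuous1.
have zo : ~ (c <= z <= c') by exact/negP.
have c0 : (cst (0 : R)) x @[x --> z] --> (0 : R) by exact: cvg_cst.
rewrite /continuous_at G0 //; apply: cvg_trans c0; apply: near_eq_cvg; apply: filterS (out z zo) => t /G0 -> //.
Unshelve. all: by end_near.
Qed.

Lemma path_value_bound k (K : R) u w : 0 <= K -> (forall z, `|k z| <= K) ->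
  `|path_value X k u w| <= K.
Proof. by move=> K0 kK; rewrite /path_value; case: (X u w) => [z|] //=; rewrite normr0. Qed.

Lemma start_ae x : I x -> {ae P x, forall w, X 0 w = Some x}.
Proof.
move=> Ix; have m0 : measurable (state_in X 0 [set x]) by exact: (state_in_measurable hX).
exists (~` state_in X 0 [set x]); split; first exact: measurableC.
  have -> := @probability_setC _ _ _ (P x) _ m0.
  by rewrite (dif_start hX Ix) subee.
by move=> w /= nw; apply: contra_not nw => -[z /= -> <-].
Qed.

Lemma expectation_start k x : I x -> measurable_fun setT k ->
  \int[P x]_w path_value X k 0 w = k x.
Proof.
move=> Ix mk; rewrite -[RHS](expectation_cst (P x)) /Rintegral; congr fine.
apply: ae_eq_integral => //.
- by apply/measurable_EFinP; exact: (path_value_measurable hX).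
- by apply: filterS (start_ae Ix) => w X0 _; rewrite /path_value X0.
Qed.

Section Stopping.
(** [rho] is described by adapted events with [{t < rho}] inside [B t] and [B t] inside
    [{t <= rho}]. Leaving [t = rho] undecided spares a proof that [{t < rho}] is itself in [F t],
    and is the form in which localized times arise as suprema. *)
Variables (L : R) (rho : Omega -> R) (B : R -> set Omega).
Hypothesis L0 : 0 < L.
Hypothesis rho0L : forall w, 0 <= rho w <= L.
Hypothesis FB : forall t, 0 <= t -> F t (B t).
Hypothesis rhoB : forall t w, 0 <= t -> t < rho w -> B t w.
Hypothesis Brho : forall t w, 0 <= t -> B t w -> t <= rho w.

Let mB t : 0 <= t -> measurable (B t).
Proof. by move=> t0; have [_ h _] := dif_filtration hX; exact: h t0 _ (FB t0). Qed.

Let mesh (m : nat) : R := L / m.+1%:R.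

Let mesh_gt0 m : 0 < mesh m. Proof. by rewrite divr_gt0. Qed.

Let meshE m : mesh m * m.+1%:R = L.
Proof. by rewrite /mesh divfK // gt_eqF. Qed.

Let grid_ge0 m (j : nat) : 0 <= mesh m * j%:R.
Proof. by rewrite mulr_ge0 // ltW. Qed.

Let mesh_small e : 0 < e -> exists N, forall m, (N <= m)%N -> mesh m < e.
Proof.
move=> e0; have eL : 0 < e / L by rewrite divr_gt0.
have [N _ hN] := near_infty_natSinv_lt (PosNum eL); exists N => m Nm.
by have := hN m Nm; rewrite /= ltr_pdivlMr // mulrC.
Qed.

(** Along a fixed path the indicators cut every grid sum at one index [J], so a sum with adapted
    weights becomes a plain sum that can telescope. *)
Let index m w : exists J : nat, [/\ (J <= m.+1)%N,
  forall u : nat -> R, \sum_(j < m.+1) \1_(B (mesh m * j%:R)) w * u j = \sum_(j < J) u j,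
  rho w <= mesh m * J%:R, forall j, (j < J)%N -> mesh m * j%:R <= rho w &
  mesh m * J%:R <= rho w + mesh m].
Proof.
have /andP[r0 rL] := rho0L w.
pose p j := w \in B (mesh m * j%:R).
have [| | |J [h1 h2 h3 h4 h5]] := @grid_index R p (rho w) (mesh m) m.+1 (mesh_gt0 m) r0.
- by rewrite meshE.
- by move=> j jr; rewrite /p inE; exact: rhoB.
- by move=> j; rewrite /p inE; exact: Brho.
exists J; split => // u.
rewrite (big_ord_widen m.+1 u h1) [RHS]big_mkcond; apply: eq_bigr => j _.
rewrite indicE -/(p j) h2 //; case: ifP; by rewrite ?mul1r ?mul0r.
Qed.

Let rho_cvg (y : R -> R) w e : continuous y -> 0 < e ->
  exists N, forall m t, (N <= m)%N -> rho w <= t -> t <= rho w + mesh m ->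
    `|y t - y (rho w)| < e.
Proof.
move=> cy e0; have /cvgrPdist_lt /(_ e e0) /nbhs_ballR [d0 d00 h] := cy (rho w).
have [N hN] := mesh_small d00; exists N => m t Nm t1 t2.
by rewrite distrC; apply: h; rewrite ger0_norm ?subr_ge0 //; have := hN m Nm; lra.
Qed.

(** The weighted increments telescope to the value at the grid time following [rho], which converges
    by continuity of the path value. No joint measurability in time and path is required. *)
Lemma stopped_value_measurable k c c' : continuous k -> I c -> I c' ->
  (forall z, ~ (c <= z <= c') -> k z = 0) ->
  measurable_fun setT (fun w => path_value X k (rho w) w).
Proof.
move=> ck Ic Ic' k0.
have mk : measurable_fun setT k by exact: continuous_measurable_fun.
pose S m w := path_value X k 0 w + \sum_(j < m.+1) \1_(B (mesh m * j%:R)) w *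
  (path_value X k (mesh m * j.+1%:R) w - path_value X k (mesh m * j%:R) w).
apply: (@measurable_fun_cvg _ _ _ setT S).
  move=> m; apply: measurable_funD; first exact: (path_value_measurable hX).
  apply: measurable_sum => j; apply: measurable_funM.
    by apply: measurable_indic; exact: mB.
  by apply: measurable_funB; apply: (path_value_measurable hX).
move=> w _; apply/cvgrPdist_lt => e e0.
have cy := path_value_continuous hX (w := w) ck Ic Ic' k0.
have [N hN] := rho_cvg w cy e0; exists N => // m Nm.
have [J [JM hsum rJ Jr Jm]] := index m w.
rewrite /S (hsum (fun j => path_value X k (mesh m * j.+1%:R) w - path_value X k (mesh m * j%:R) w)).
have -> : \sum_(j < J) (path_value X k (mesh m * j.+1%:R) w - path_value X k (mesh m * j%:R) w)
    = path_value X k (mesh m * J%:R) w - path_value X k 0 w.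
  rewrite -(big_mkord xpredT (fun j => path_value X k (mesh m * j.+1%:R) w -
    path_value X k (mesh m * j%:R) w)) (@telescope_sumr _ 0%N J
    (fun j => path_value X k (mesh m * j%:R) w)) //.
  by rewrite mulr0.
rewrite (addrC (path_value X k 0 w)) subrK distrC.
have := hN m (mesh m * J%:R) Nm rJ Jm.
by rewrite !(max_idPl _) //; have /andP[] := rho0L w.
Qed.

Lemma stopping_measurable : measurable_fun setT rho.
Proof.
apply: (@measurable_fun_cvg _ _ _ setT (fun m w => \sum_(j < m.+1) \1_(B (mesh m * j%:R)) w * mesh m)).
  move=> m; apply: measurable_sum => j; apply: measurable_funM; last exact: measurable_cst.
  by apply: measurable_indic; exact: mB.
move=> w _; apply/cvgrPdist_lt => e e0.
have [N hN] := mesh_small e0; exists N => // m Nm.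
have [J [JM hsum rJ Jr Jm]] := index m w.
rewrite /= (hsum (fun=> mesh m)) sumr_const card_ord -mulr_natr.
rewrite distrC ger0_norm ?subr_ge0 // ltrBlDl.
by apply: le_lt_trans Jm _; rewrite ltrD2l; exact: hN.
Qed.

Variables (r : R) (r0 : 0 <= r).

Lemma discounted_value_measurable k c c' : continuous k -> I c -> I c' ->
  (forall z, ~ (c <= z <= c') -> k z = 0) ->
  measurable_fun setT (fun w => expR (- (r * rho w)) * path_value X k (rho w) w).
Proof.
move=> ck Ic Ic' k0; apply: measurable_funM; last exact: stopped_value_measurable k0.
apply: (@measurableT_comp _ _ _ _ _ _ expR) => //.
apply: measurable_funN; apply: measurable_funM; first exact: measurable_cst.
exact: stopping_measurable.
Qed.

Let path_extension k (c c' s t : R) w : 0 <= s ->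
  \int[leb]_(u in `[s, t]) path_value X k (Num.max u 0) w =
  \int[leb]_(u in `[s, t]) path_value X k u w.
Proof.
move=> s0; apply: eq_Rintegral => u; rewrite inE /= in_itv /= => /andP[su _].
by rewrite (max_idPl (le_trans s0 su)).
Qed.

Lemma path_integral_measurable k c c' s t : continuous k -> I c -> I c' ->
  (forall z, ~ (c <= z <= c') -> k z = 0) -> 0 <= s -> s <= t ->
  measurable_fun setT (fun w => \int[leb]_(u in `[s, t]) path_value X k (Num.max u 0) w).
Proof.
move=> ck Ic Ic' k0 s0 st.
have mk : measurable_fun setT k by exact: continuous_measurable_fun.
pose S m w := \sum_(j < m.+1) (t - s) / m.+1%:R *
  path_value X k (Num.max (s + (t - s) / m.+1%:R * j%:R) 0) w.
apply: (@measurable_fun_cvg _ _ _ setT S).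
  move=> m; apply: measurable_sum => j; apply: measurable_funM; first exact: measurable_cst.
  by apply: (path_value_measurable hX) => //; rewrite le_max lexx orbT.
move=> w _; apply: (@riemann_sum_cvg R (fun u => path_value X k (Num.max u 0) w)) => //.
exact: (path_value_continuous hX (w := w) ck Ic Ic' k0).
Qed.

(* The [m]-th sum [D m] has expectation zero by the martingale problem, since
   each event [B t] belongs to [F t]; as the mesh tends to zero it is bounded
   below by the discounted increment of [f] minus [eps * L]. *)
Lemma optional_stopping f c0 c0' x eps :
  I c0 -> I c0' -> (forall z, C2_at f z) -> (forall z, ~ (c0 <= z <= c0') -> f z = 0) ->
  I x -> 0 <= eps ->
  (forall t w z, 0 <= t -> t < rho w -> X t w = Some z -> generator_r mu sigma r f z <= eps) ->
  (forall t w, 0 <= t -> t < rho w -> X t w <> None) ->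
  \int[P x]_w (expR (- (r * rho w)) * path_value X f (rho w) w) <= f x + eps * L.
Proof.
move=> Ic0 Ic0' C2f f0 Ix eps0 geps galive.
have cf : continuous f by move=> z; exact: C2_at_continuous.
have [cg g0] := generator_continuous Ic0 Ic0' C2f f0.
have [K1 K10 fK1] := compact_support_bounded cf f0.
have [K2 K20 gK2] := compact_support_bounded cg g0.
pose K := K1 + K2.
have K0 : 0 <= K by exact: addr_ge0.
have fK z : `|f z| <= K by rewrite (le_trans (fK1 z)) // /K; lra.
have gK z : `|generator mu sigma f z| <= K by rewrite (le_trans (gK2 z)) // /K; lra.
pose y w u := path_value X f (Num.max u 0) w.
pose l w u := path_value X (generator mu sigma f) (Num.max u 0) w.
have cy w : continuous (y w) by exact: (path_value_continuous hX (w := w) cf Ic0 Ic0' f0).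
have cl w : continuous (l w) by exact: (path_value_continuous hX (w := w) cg Ic0 Ic0' g0).
have yK w u : `|y w u| <= K by exact: path_value_bound.
have lK w u : `|l w u| <= K by exact: path_value_bound.
have mf : measurable_fun setT f by exact: continuous_measurable_fun.
have my u : measurable_fun setT (y^~ u).
  by apply: (path_value_measurable hX) => //; rewrite le_max lexx orbT.
pose inc m j w := discounted_increment (y w) (l w) r (mesh m) j.
have minc m j : measurable_fun setT (inc m j).
  apply: measurable_funM; first exact: measurable_cst.
  apply: measurable_funB; first by apply: measurable_funB; exact: my.
  apply: path_integral_measurable cg Ic0 Ic0' g0 _ _ => //.
  by rewrite ler_pM2l // ler_nat.
have incK' m j w : `|y w (mesh m * j.+1%:R) - y w (mesh m * j%:R) -
    \int[leb]_(u in `[mesh m * j%:R, mesh m * j.+1%:R]) l w u| <= 2 * K + K * mesh m.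
  have lb u : - K <= l w u <= K by rewrite -ler_norml.
  have step : mesh m * j.+1%:R - mesh m * j%:R = mesh m by rewrite -natr1; ring.
  have mono : mesh m * j%:R <= mesh m * j.+1%:R by rewrite ler_pM2l // ler_nat.
  have hi := @Rintegral_segment_le R (l w) K _ _ (cl w) mono (fun u _ => proj2 (andP (lb u))).
  have lo := @Rintegral_segment_ge R (l w) (- K) _ _ (cl w) mono (fun u _ => proj1 (andP (lb u))).
  rewrite step in hi lo.
  apply: le_trans (ler_normB _ _) _; apply: lerD.
    apply: le_trans (ler_normB _ _) _.
    by have := yK w (mesh m * j.+1%:R); have := yK w (mesh m * j%:R); lra.
  by rewrite ler_norml hi -mulNr lo.
have incK m j w : `|inc m j w| <= 2 * K + K * mesh m.
  rewrite /inc /discounted_increment normrM -[2 * K + _]mul1r; apply: ler_pM => //.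
  by rewrite ger0_norm ?expR_ge0 // -[leRHS]expR0 ler_expR oppr_le0 mulr_ge0 // grid_ge0.
pose D m w := \sum_(j < m.+1) \1_(B (mesh m * j%:R)) w * inc m j w.
have mterm m j : measurable_fun setT (fun w => \1_(B (mesh m * j%:R)) w * inc m j w).
  by apply: measurable_funM => //; apply: measurable_indic; exact: mB.
have mD m : measurable_fun setT (D m).
  by apply: measurable_sum => j; exact: mterm.
have DK m w : `|D m w| <= 3 * K + K * L.
  have [J [JM hsum rJ Jr Jm]] := index m w.
  rewrite /D (hsum (fun j => inc m j w)).
  apply: le_trans (discounted_increment_sum_bound (cl w) r0 K0 (mesh_gt0 m) (yK w) (lK w) J) _.
  rewrite lerD2l ler_wpM2l // -(meshE m) ler_pM2l // ler_nat //.
have ED m : \int[P x]_w D m w = 0.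
  rewrite (@expectation_sum _ _ _ (P x) m.+1 (fun j w => \1_(B (mesh m * j%:R)) w * inc m j w)
    (fun=> 2 * K + K * mesh m)) //; last first.
    move=> j w; rewrite normrM -[leRHS]mul1r; apply: ler_pM => //.
    by rewrite indicE; case: (_ \in _); rewrite ?normr1 ?normr0.
  apply: big1 => j _.
  rewrite (_ : (fun w => _) = fun w => expR (- (r * (mesh m * j.+1%:R))) *
     ((fun w => y w (mesh m * j.+1%:R) - y w (mesh m * j%:R) -
       \int[leb]_(u in `[mesh m * j%:R, mesh m * j.+1%:R]) l w u) \_ (B (mesh m * j%:R))) w); last first.
    apply/funext => w; rewrite /inc /discounted_increment patchE indicE.
    by case: ifP => _; rewrite ?mul1r ?mul0r ?mulr0.
  set Z := (fun w => _ - _ - _).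
  have mZ : measurable_fun setT Z.
    apply: measurable_funB; first by apply: measurable_funB; exact: my.
    apply: path_integral_measurable cg Ic0 Ic0' g0 _ _ => //.
    by rewrite ler_pM2l // ler_nat.
  have iZ : (P x).-integrable setT (EFin \o (Z \_ (B (mesh m * j%:R)))).
    apply: (@bounded_integrable _ _ _ _ _ (2 * K + K * mesh m)).
      by apply/measurable_restrict => //; [exact: mB|exact: measurable_funS mZ].
    move=> w; rewrite patchE; case: ifP => _; first exact: incK'.
    by rewrite normr0 addr_ge0 // mulr_ge0 // ltW.
  rewrite RintegralZl // -Rintegral_mkcond /Rintegral.
  have mg := dif_martingale_problem hX Ic0 Ic0' C2f f0 Ix (grid_ge0 m j)
    (_ : mesh m * j%:R <= mesh m * j.+1%:R) (FB (grid_ge0 m j)).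
  rewrite (_ : (\int[P x]_(w in B (mesh m * j%:R)) (Z w)%:E)%E = 0%E) ?mulr0 //.
  rewrite -mg; last by rewrite ler_pM2l // ler_nat.
  apply: eq_integral => w _; rewrite /Z /y !(max_idPl (grid_ge0 m _)).
  by rewrite path_extension.
pose tgt w := expR (- (r * rho w)) * path_value X f (rho w) w - y w 0 - eps * L.
have mdisc := discounted_value_measurable cf Ic0 Ic0' f0.
have mtgt : measurable_fun setT tgt.
  apply: measurable_funB; last exact: measurable_cst.
  by apply: measurable_funB => //; exact: my.
have rw0 w : 0 <= rho w by have /andP[] := rho0L w.
have rwL w : rho w <= L by have /andP[] := rho0L w.
have e1 u : 0 <= u -> expR (- (r * u)) <= 1.
  by move=> u0; rewrite -[leRHS]expR0 ler_expR oppr_le0 mulr_ge0.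
have discK w : `|expR (- (r * rho w)) * path_value X f (rho w) w| <= K.
  rewrite normrM -[K]mul1r; apply: ler_pM => //; last exact: path_value_bound.
  by rewrite ger0_norm ?expR_ge0 // e1.
have epsL : 0 <= eps * L by rewrite mulr_ge0 // ltW.
have tgtK w : `|tgt w| <= 2 * K + eps * L.
  have h1 := discK w; have h2 := yK w 0.
  rewrite /tgt; apply: le_trans (ler_normB _ _) _; rewrite (ger0_norm epsL) lerD2r.
  by apply: le_trans (ler_normB _ _) _; lra.
(* [D] is controlled from below only, so its shortfall under the target is measured by a positive
   part. [U] is uniformly bounded and tends to zero pointwise; since [D] has expectation zero, the
   target has expectation at most that of [U]. *)
pose U m w := Num.max 0 (tgt w - D m w).
have mU m : measurable_fun setT (U m).
  apply: (@measurable_maxr _ _ _ setT (cst 0) (fun w => tgt w - D m w)) => //.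
  exact: measurable_funB.
have UK m w : `|U m w| <= 2 * K + eps * L + (3 * K + K * L).
  rewrite ger0_norm /U ?le_max ?lexx // ge_max.
  have h1 := tgtK w; have h2 := DK m w.
  have h3 : `|tgt w - D m w| <= 2 * K + eps * L + (3 * K + K * L).
    by apply: le_trans (ler_normB _ _) _; exact: lerD.
  by rewrite (le_trans (normr_ge0 _) h3) (le_trans (ler_norm _) h3).
have Ucvg w : U m w @[m --> \oo] --> 0.
  apply/cvgrPdist_le => e e0.
  (* One third each for rounding [rho] up to the grid, for the oscillation of [y] within a cell, and
     for the error proportional to the mesh. *)
  have e30 : 0 < e / 3 by rewrite divr_gt0.
  pose v u := expR (- (r * u)) * y w u.
  have cv : continuous v.
    move=> u; apply: cvgM; last exact: cy.
    apply: (@continuous_comp _ _ _ (fun u => - (r * u)) expR); last exact: continuous_expR.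
    by apply: cvgN; apply: cvgM; [exact: cvg_cst|exact: cvg_id].
  have [N1 hN1] := rho_cvg w cv e30.
  have osc0 : 0 < e / 3 / (r * L + 1).
    by rewrite divr_gt0 // ltr_wpDl // mulr_ge0 // ltW.
  have [d0 d00 hd0] := uniform_continuity_segment (ltW L0) osc0 (fun u _ => cy w u).
  have [N2 hN2] := mesh_small d00.
  have K'0 : 0 < 2 * K * r + K + 1 by rewrite ltr_wpDl // addr_ge0 // mulr_ge0 // mulr_ge0.
  have [N3 hN3] := mesh_small (divr_gt0 e30 K'0).
  exists (maxn N1 (maxn N2 N3)) => // m /=; rewrite !geq_max => /and3P[m1 m2 m3].
  have [J [JM hsum rJ Jr Jm]] := index m w.
  have JL : mesh m * J%:R <= L by rewrite -(meshE m) ler_pM2l // ler_nat.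
  have close := hN1 m _ m1 rJ Jm.
  have md := hN2 m m2.
  have mK : (2 * K * r + K) * mesh m <= e / 3.
    have := hN3 m m3; rewrite ltr_pdivlMr // => /ltW; apply: le_trans.
    by rewrite mulrC ler_wpM2l ?(ltW (mesh_gt0 m)) // lerDl.
  have step j : mesh m * j.+1%:R - mesh m * j%:R = mesh m by rewrite -natr1; ring.
  have lower := @discounted_increment_sum_ge R (y w) (l w) r K (mesh m) (cl w) r0 K0
    (mesh_gt0 m) (yK w) (lK w) (rho w) eps (e / 3 / (r * L + 1)) J eps0 (ltW osc0).
  have {}lower := lower _ _ Jr.
  have lowerD : expR (- (r * (mesh m * J%:R))) * y w (mesh m * J%:R) - y w 0
      - mesh m * J%:R * (r * (e / 3 / (r * L + 1)) + eps) - (2 * K * r + K) * mesh m <= D m w.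
    rewrite /D (hsum (fun j => inc m j w)); apply: lower.
      have lt_case u : 0 <= u -> u < rho w -> l w u <= r * y w u + eps.
        move=> u0 ur; rewrite /l /y (max_idPl u0) /path_value.
        case Xu : (X u w) => [z|]; last by case: (galive u w u0 ur Xu).
        by have := geps u w z u0 ur Xu; rewrite /generator_r /=; lra.
      (* The generator bound is assumed strictly before [rho]; at [rho] itself it follows by a left
         limit along the path, available because [rho] is positive. *)
      move=> u rpos u0; rewrite le_eqVlt => /orP[/eqP ->|]; last exact: lt_case.
      have cc : (fun u => l w u - r * y w u) t @[t --> (rho w)^'-] --> l w (rho w) - r * y w (rho w).
        apply: cvg_at_left_filter; apply: cvgB; first exact: cl.
        by apply: cvgM; [exact: cvg_cst|exact: cy].
      suff : l w (rho w) - r * y w (rho w) <= eps by lra.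
      apply: (cvg_le_bound cc); near=> t.
      have t0 : 0 <= t by apply: ltW; near: t; exact: nbhs_left_gt.
      have tr : t < rho w by near: t; exact: nbhs_left_lt.
      by have := lt_case t t0 tr; lra.
    move=> j u jJ u1 u2; apply: hd0.
      rewrite grid_ge0 /=; exact: le_trans (Jr j jJ) (rwL w).
    by rewrite ger0_norm ?subr_ge0 //; have := step j; lra.
  have small : mesh m * J%:R * (r * (e / 3 / (r * L + 1)) + eps) <= e / 3 + eps * L.
    have p1 : 0 <= r * (e / 3 / (r * L + 1)) by rewrite mulr_ge0 // ltW.
    apply: (@le_trans _ _ (L * (r * (e / 3 / (r * L + 1)) + eps))).
      by rewrite ler_wpM2r // addr_ge0.
    rewrite mulrDr (mulrC L eps) lerD2r.
    have -> : L * (r * (e / 3 / (r * L + 1))) = (r * L) * (e / 3) / (r * L + 1) by ring.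
    rewrite ler_pdivrMr; last by rewrite ltr_wpDl // mulr_ge0 // ltW.
    by rewrite mulrC ler_pM2l // lerDl.
  rewrite sub0r normrN ger0_norm /U ?le_max ?lexx // ge_max (ltW e0) /=.
  rewrite /tgt; have -> : path_value X f (rho w) w = y w (rho w).
    by rewrite /y (max_idPl (rw0 w)).
  move: close; rewrite ltr_norml /v => /andP[close _].
  lra.
have tgtU m : \int[P x]_w tgt w <= \int[P x]_w U m w.
  have it : (P x).-integrable setT (EFin \o (fun w => tgt w - D m w)).
    apply: (@bounded_integrable _ _ _ _ _ (2 * K + eps * L + (3 * K + K * L))).
      exact: measurable_funB.
    by move=> w; apply: le_trans (ler_normB _ _) _; exact: lerD.
  have -> : \int[P x]_w tgt w = \int[P x]_w (tgt w - D m w).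
    have itg := bounded_integrable (P x) mtgt tgtK.
    have iD := bounded_integrable (P x) (mD m) (DK m).
    by rewrite (RintegralB measurableT itg iD) ED subr0.
  apply: le_Rintegral => //; first exact: (bounded_integrable (P x) (mU m) (UK m)).
  by move=> w _; rewrite /U le_max lexx orbT.
have lim := @bounded_convergence _ _ _ (P x) U (cst 0) _ mU (measurable_cst _) UK
  (aeW _ Ucvg).
rewrite expectation_cst in lim.
have tgt0 : \int[P x]_w tgt w <= 0.
  apply: (cvg_ge_bound lim).
  by apply: nearW => m; exact: tgtU.
have idisc := bounded_integrable (P x) mdisc discK.
have iy := bounded_integrable (P x) (my 0) (fun w => yK w 0).
have E0 : \int[P x]_w y w 0 = f x.
  rewrite -(@expectation_start f x) //; apply: eq_Rintegral => w _.
  by rewrite /y (max_idPl (lexx 0)).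
move: tgt0; rewrite /tgt RintegralB //; last 2 first.
- apply: (@bounded_integrable _ _ _ _ _ (2 * K)).
    by apply: measurable_funB => //; exact: my.
  move=> w; apply: le_trans (ler_normB _ _) _.
  by have := discK w; have := yK w 0; lra.
- exact: (@finite_measure_integrable_cst _ _ _ (P x) setT (eps * L)).
rewrite RintegralB // E0 expectation_cst; lra.
Unshelve. all: by end_near.
Qed.

End Stopping.
End OptionalStopping.

(** * Localization and the supermartingale inequality *)

Section Localization.
Context {R : realType} {d : measure_display} {Omega : measurableType d}.
Variables (a b : \bar R) (mu sigma : R -> R) (F : R -> set_system Omega)
  (X : R -> Omega -> option R) (P : R -> probability Omega R).
Hypothesis hX : diffusion a b mu sigma F X P.
Hypothesis hmu : forall x, state_space a b x -> {for x, continuous mu}.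
Hypothesis hsigma : forall x, state_space a b x -> {for x, continuous sigma}.
Variables (r : R) (r0 : 0 <= r).
Local Notation I := (state_space a b).
Implicit Types (k f h : R -> R) (w : Omega) (s t u x y z c : R).

(** [ht] is [h] times a trapezoid equal to [1] on [[c, c'']] and vanishing outside [(c1, c2)].
    Nothing is known about [h] outside [I], but there the trapezoid is locally zero. The values
    between [0] and [h] serve the bounds in the later limits. *)
Lemma cutoff_extension h c1 c c'' c2 : (forall z, I z -> {for z, continuous h}) ->
  I c1 -> I c2 -> c1 < c -> c'' < c2 ->
  exists ht : R -> R, [/\ continuous ht, forall z, ~ (c1 <= z <= c2) -> ht z = 0,
    forall z, c <= z <= c'' -> ht z = h z &
    forall z, I z -> 0 <= h z -> 0 <= ht z <= h z].
Proof.
move=> ch Ic1 Ic2 c1c c''c2.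
pose q1 z := (z - c1) / (c - c1).
pose q2 z := (c2 - z) / (c2 - c'').
pose chi z := Num.max 0 (Num.min 1 (Num.min (q1 z) (q2 z))).
have cq1 : continuous q1.
  by move=> z; apply: cvgM; [apply: cvgB; [exact: cvg_id|exact: cvg_cst]|exact: cvg_cst].
have cq2 : continuous q2.
  by move=> z; apply: cvgM; [apply: cvgB; [exact: cvg_cst|exact: cvg_id]|exact: cvg_cst].
have cchi : continuous chi.
  move=> z; have k0 : {for z, continuous (cst 0 : R -> R)} by exact: cvg_cst.
  have k1 : {for z, continuous (cst 1 : R -> R)} by exact: cvg_cst.
  exact: (continuous_max k0 (continuous_min k1 (continuous_min (cq1 z) (cq2 z)))).
have chi0 z : 0 <= chi z by rewrite /chi le_max lexx.
have chi1 z : chi z <= 1 by rewrite /chi ge_max ler01 ge_min lexx.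
have out z : ~ (c1 < z < c2) -> chi z = 0.
  move=> zn; apply/max_idPl; rewrite !ge_min.
  have [zc|cz] := leP z c1.
    have -> : q1 z <= 0 by rewrite /q1 pmulr_lle0 ?invr_gt0 ?subr_gt0 // subr_le0.
    by rewrite orbT.
  have [zc|cz'] := leP c2 z; last by exfalso; apply: zn; rewrite cz.
  have -> : q2 z <= 0 by rewrite /q2 pmulr_lle0 ?invr_gt0 ?subr_gt0 // subr_le0.
  by rewrite !orbT.
exists (fun z => h z * chi z); split.
- move=> z; have [Iz|nIz] := pselect (I z).
    by apply: cvgM; [exact: ch|exact: cchi].
  have zo : ~ (c1 <= z <= c2) by move=> zc; apply: nIz; exact: state_space_segment zc.
  have near0 : \forall t \near z, ~ (c1 < t < c2).
    move: zo => /negP; rewrite negb_and -!ltNge => /orP[zc|cz].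
      near=> t; have tc : t < c1 by near: t; exact: lt_nbhsl.
      by move=> /andP[ct _]; move: tc; rewrite ltNge (ltW ct).
    near=> t; have tc : c2 < t by near: t; exact: lt_nbhsr.
    by move=> /andP[_ ct]; move: tc; rewrite ltNge (ltW ct).
  have c0 : (cst (0 : R)) x @[x --> z] --> (0 : R) by exact: cvg_cst.
  rewrite /continuous_at (nbhs_singleton (filterS (fun t => out t) near0)) mulr0.
  apply: cvg_trans c0; apply: near_eq_cvg.
  by apply: filterS near0 => t /out ->; rewrite mulr0.
- move=> z zo; rewrite out ?mulr0 //.
  by move=> /andP[z1 z2]; apply: zo; rewrite !ltW.
- move=> z /andP[cz zc]; suff -> : chi z = 1 by rewrite mulr1.
  have h1 : 1 <= q1 z by rewrite /q1 ler_pdivlMr ?subr_gt0 // mul1r lerD2r.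
  have h2 : 1 <= q2 z by rewrite /q2 ler_pdivlMr ?subr_gt0 // mul1r; lra.
  apply/eqP; rewrite eq_le chi1 /= /chi le_max; apply/orP; right.
  by rewrite !le_min lexx h1.
- move=> z _ hz; rewrite mulr_ge0 //=.
  by rewrite -[leRHS]mulr1 ler_wpM2l.
Unshelve. all: by end_near.
Qed.

Section Localized.
Variables (L : R) (rho : Omega -> R) (B : R -> set Omega).
Hypothesis L0 : 0 < L.
Hypothesis rho0L : forall w, 0 <= rho w <= L.
Hypothesis FB : forall t, 0 <= t -> F t (B t).
Hypothesis rhoB : forall t w, 0 <= t -> t < rho w -> B t w.
Hypothesis Brho : forall t w, 0 <= t -> B t w -> t <= rho w.

(** Optional stopping is applied to smooth approximations [f] of [ht], and the error then tends to
    zero. The generator of [f] is controlled on [[c, c']] only, which suffices because the path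
    stays there before [rho]. *)
Lemma superharmonic_localized h (E : set R) ht c1 c c' c'' c2 x :
  piecewise_superharmonic a b mu sigma r h E ->
  I c1 -> I c2 -> I c -> c <= c' -> c' < c'' -> I c'' -> continuous ht ->
  (forall z, ~ (c1 <= z <= c2) -> ht z = 0) ->
  (forall z, c <= z <= c'' -> ht z = h z) -> c <= x <= c' ->
  (forall t w, 0 <= t -> t < rho w -> exists2 z, X t w = Some z & c <= z <= c') ->
  \int[P x]_w (expR (- (r * rho w)) * path_value X ht (rho w) w) <= h x.
Proof.
move=> hh Ic1 Ic2 Ic cc' c'c'' Ic'' cht ht0 hth xc stay.
have Ix : I x.
  apply: (state_space_segment Ic Ic''); move: xc => /andP[-> xc] /=.
  by rewrite (le_trans xc) // ltW.
apply/ler_addgt0Pr => e e0.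
(* The errors are [eta] for replacing [ht] by [f] in the expectation, [eta * L] for the generator
   over the time span, and [eta] at the starting point: [L + 2] times [eta] in all. *)
pose eta := e / (L + 2).
have L2 : 0 < L + 2 by rewrite addr_gt0.
have eta0 : 0 < eta by rewrite divr_gt0.
have [f [d1 [d2 [Id1 Id2 C2f f0 [fht fG]]]]] :=
  smooth_approximation hmu hsigma hh Ic1 Ic2 Ic cc' c'c'' Ic'' cht ht0 hth eta0.
have cf : continuous f by move=> z; exact: C2_at_continuous.
have mdf := discounted_value_measurable hX L0 rho0L FB rhoB Brho r cf Id1 Id2 f0.
have mdh := discounted_value_measurable hX L0 rho0L FB rhoB Brho r cht Ic1 Ic2 ht0.
have os := optional_stopping hX hmu hsigma L0 rho0L FB rhoB Brho r0 Id1 Id2 C2f f0 Ix (ltW eta0).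
have e1 w : expR (- (r * rho w)) <= 1.
  by rewrite -[leRHS]expR0 ler_expR oppr_le0 mulr_ge0 //; have /andP[] := rho0L w.
have dbound k (K : R) w : 0 <= K -> (forall z, `|k z| <= K) ->
    `|expR (- (r * rho w)) * path_value X k (rho w) w| <= K.
  move=> K0 kK; rewrite normrM -[K]mul1r; apply: ler_pM => //; last exact: path_value_bound.
  by rewrite ger0_norm ?expR_ge0.
have [K1 K10 fK] := compact_support_bounded cf f0.
have [K2 K20 hK] := compact_support_bounded cht ht0.
have idf := bounded_integrable (P x) mdf (fun w => dbound f K1 w K10 fK).
have idh := bounded_integrable (P x) mdh (fun w => dbound ht K2 w K20 hK).
have ieta := @finite_measure_integrable_cst _ _ _ (P x) setT eta measurableT.
apply: (@le_trans _ _ (\int[P x]_w (expR (- (r * rho w)) * path_value X f (rho w) w + eta))).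
  apply: le_Rintegral => //.
    exact: (@integrableD _ _ _ (P x) setT measurableT _ _ idf ieta).
  move=> w _; rewrite -lerBlDl -mulrBr.
  have : path_value X ht (rho w) w - path_value X f (rho w) w <= eta.
    rewrite /path_value; case: (X (rho w) w) => [z|] /=; last by rewrite subrr ltW.
    by have := fht z; rewrite ler_norml => /andP[]; lra.
  move=> le_eta; apply: (@le_trans _ _ (expR (- (r * rho w)) * eta)).
    by rewrite ler_wpM2l // expR_ge0.
  by rewrite ler_piMl // ltW.
rewrite RintegralD // expectation_cst.
have {}os : \int[P x]_w (expR (- (r * rho w)) * path_value X f (rho w) w) <= f x + eta * L.
  apply: os => t w; last by move=> t0 tr Xt; have [z] := stay t w t0 tr; rewrite Xt.
  move=> z t0 tr Xt; apply: fG; have [z'] := stay t w t0 tr.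
  by rewrite Xt => -[->].
have fx : f x <= h x + eta.
  have := fht x; rewrite hth; first by rewrite ler_norml => /andP[]; lra.
  by move: xc => /andP[-> xc] /=; rewrite (le_trans xc) // ltW.
have eE : e = eta * L + eta + eta by rewrite /eta; field; rewrite gt_eqF.
rewrite eE; lra.
Qed.

End Localized.

Section LocalizedTime.
Variables (tau : Omega -> \bar R) (c c' L : R).
Hypothesis L0 : 0 < L.
Hypothesis tau0 : forall w, (0 <= tau w)%E.
Hypothesis Ftau : forall t, 0 <= t -> F t [set w | (tau w <= t%:E)%E].

(** Strict inequality for [tau] makes the event adapted as a complement; the closed interval
    [[c, c']] makes [staying] testable at rational times. *)
Definition localized_event (t : R) : set Omega :=
  [set w | [/\ (t%:E < tau w)%E, staying X c c' t w & t < L]].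

(** The point [0] is added so that the supremum is over a nonempty set even if the event already
    fails at time [0]. As the events decrease in time, this supremum is sandwiched by them. *)
Definition localized_time w : R := sup ([set 0] `|` [set t | 0 <= t /\ localized_event t w]).

Let has_sup_localized w : has_sup ([set 0] `|` [set t | 0 <= t /\ localized_event t w]).
Proof.
split; first by exists 0; left.
by exists L => t [->|[_ [_ _ /ltW]]] //; exact: ltW.
Qed.

Lemma localized_time_ge0 w : 0 <= localized_time w.
Proof. by apply: ub_le_sup; [have [] := has_sup_localized w|left]. Qed.

Lemma localized_time_bounds w : 0 <= localized_time w <= L.
Proof.
rewrite localized_time_ge0 /=; apply: ge_sup; first by exists 0; left.
by move=> t [->|[_ [_ _ /ltW]]] //; exact: ltW.
Qed.

Lemma localized_event_adapted t : 0 <= t -> F t (localized_event t).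
Proof.
move=> t0; have [sF _ _] := dif_filtration hX.
rewrite -[F t](sigma_algebra_id (sF t t0)).
have [tL|Lt] := ltP t L; last first.
  rewrite (_ : localized_event t = set0); first exact: (@measurable0 _ (g_sigma_algebraType (F t))).
  by apply/seteqP; split => w // -[_ _]; rewrite ltNge Lt.
rewrite (_ : localized_event t = ~` [set w | (tau w <= t%:E)%E] `&` staying X c c' t); last first.
  apply/seteqP; split => w /=; rewrite /localized_event /= ltNge.
    by move=> [/negP].
  by move=> [/negP h1 h2].
apply: (@measurableI _ (g_sigma_algebraType (F t))).
  apply: (@measurableC _ (g_sigma_algebraType (F t))); apply: sub_sigma_algebra.
  exact: Ftau.
by apply: sub_sigma_algebra; exact: (staying_adapted hX).
Qed.

Lemma localized_event_anti s t w : 0 <= s -> s <= t -> localized_event t w -> localized_event s w.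
Proof.
move=> s0 st [h1 h2 h3]; split; last exact: le_lt_trans st h3.
  by apply: le_lt_trans h1; rewrite lee_fin.
by move=> u u0 us; apply: h2 => //; exact: le_trans us st.
Qed.

Lemma localized_time_event t w : 0 <= t -> t < localized_time w -> localized_event t w.
Proof.
move=> t0 tl; have tl0 : 0 < localized_time w - t by rewrite subr_gt0.
have [u + ut] := sup_adherent tl0 (has_sup_localized w).
have {}ut : t < u by move: ut; rewrite -/(localized_time w); lra.
by case=> [u0|[u0 Bu]]; [move: ut; rewrite u0 ltNge t0|exact: localized_event_anti (ltW ut) Bu].
Qed.

Lemma localized_event_time t w : 0 <= t -> localized_event t w -> t <= localized_time w.
Proof.
by move=> t0 Bt; apply: ub_le_sup; [have [] := has_sup_localized w|right].
Qed.

Lemma localized_time_ge t w : 0 <= t ->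
  (forall s, 0 <= s -> s < t -> localized_event s w) -> t <= localized_time w.
Proof.
move=> t0 Bs; rewrite leNgt; apply/negP => lt.
have l0 := localized_time_ge0 w.
have : (localized_time w + t) / 2 <= localized_time w.
  by apply: localized_event_time; [lra|apply: Bs; lra].
lra.
Qed.

Lemma localized_time_le t w : tau w = t%:E -> localized_time w <= t.
Proof.
move=> tt; have t0 : 0 <= t by rewrite -lee_fin -tt tau0.
rewrite leNgt; apply/negP => /(localized_time_event t0) [].
by rewrite tt ltxx.
Qed.

End LocalizedTime.

(** A countable exhaustion near [a], uniform in the type of endpoint: [a0 + (x - a0) / (n + 1)] for
    a finite one, [x - n] for an infinite one. *)
Lemma lower_sequence x : I x -> exists cs : nat -> R,
  (forall n, I (cs n) /\ cs n <= x) /\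
  (forall z, I z -> exists N, forall n, (N <= n)%N -> cs n < z).
Proof.
move=> Ix; have /andP[ax xb] := Ix.
have Ilow z : (a < z%:E)%E -> z <= x -> I z.
  by move=> az zx; rewrite /state_space /= az /=; apply: le_lt_trans xb; rewrite lee_fin.
case: {2}a (erefl a) => [a0| |] E; [|by move: ax; rewrite E|].
- have xa : 0 < x - a0 by move: ax; rewrite E lte_fin subr_gt0.
  exists (fun n => a0 + (x - a0) / n.+1%:R); split.
    move=> n; have d0 : 0 < (x - a0) / n.+1%:R by rewrite divr_gt0.
    have le1 : (x - a0) / n.+1%:R <= x - a0 by rewrite ler_pdivrMr // ler_peMr ?(ltW xa) ?ler1n.
    set dd := (x - a0) / n.+1%:R in d0 le1 *.
    have dx : a0 + dd <= x by move: le1; rewrite lerBrDl.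
    by split => //; apply: Ilow => //; rewrite E lte_fin ltrDl.
  move=> z /andP[]; rewrite E lte_fin => az _.
  have zp : 0 < (z - a0) / (x - a0) by rewrite divr_gt0 // subr_gt0.
  have [N _ hN] := near_infty_natSinv_lt (PosNum zp); exists N => n Nn.
  have := hN n Nn; rewrite /= ltr_pdivlMr // mulrC => h.
  by rewrite -ltrBrDl.
- exists (fun n => x - n%:R); split.
    by move=> n; split; [apply: Ilow; rewrite ?E ?ltNyr //; rewrite gerBl|rewrite gerBl].
  move=> z _; exists (Num.bound `|x - z|) => n nn.
  rewrite ltrBlDr -ltrBlDl.
  apply: le_lt_trans (ler_norm _) _.
  by apply: lt_le_trans (archi_boundP (normr_ge0 _)) _; rewrite ler_nat.
Qed.

Lemma upper_sequence x : I x -> exists cs : nat -> R,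
  (forall n, I (cs n) /\ x <= cs n) /\
  (forall z, I z -> exists N, forall n, (N <= n)%N -> z < cs n).
Proof.
move=> Ix; have /andP[ax xb] := Ix.
have Iup z : (z%:E < b)%E -> x <= z -> I z.
  by move=> zb xz; rewrite /state_space /= zb andbT; apply: lt_le_trans ax _; rewrite lee_fin.
case: {2}b (erefl b) => [b0| |] E; [| |by move: xb; rewrite E ltNge leNye].
- have bx : 0 < b0 - x by move: xb; rewrite E lte_fin subr_gt0.
  exists (fun n => b0 - (b0 - x) / n.+1%:R); split.
    move=> n; have d0 : 0 < (b0 - x) / n.+1%:R by rewrite divr_gt0.
    have le1 : (b0 - x) / n.+1%:R <= b0 - x by rewrite ler_pdivrMr // ler_peMr ?(ltW bx) ?ler1n.
    set dd := (b0 - x) / n.+1%:R in d0 le1 *.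
    have dx : x <= b0 - dd by rewrite lerBrDr -lerBrDl.
    by split => //; apply: Iup => //; rewrite E lte_fin gtrBl.
  move=> z /andP[_]; rewrite E lte_fin => zb.
  have zp : 0 < (b0 - z) / (b0 - x) by rewrite divr_gt0 // subr_gt0.
  have [N _ hN] := near_infty_natSinv_lt (PosNum zp); exists N => n Nn.
  have := hN n Nn; rewrite /= ltr_pdivlMr // mulrC => h.
  by rewrite ltrBrDr -ltrBrDl.
- exists (fun n => x + n%:R); split.
    by move=> n; split; [apply: Iup; rewrite ?E ?ltry //; rewrite lerDl|rewrite lerDl].
  move=> z _; exists (Num.bound `|z - x|) => n nn.
  rewrite -ltrBlDl.
  apply: le_lt_trans (ler_norm _) _.
  by apply: lt_le_trans (archi_boundP (normr_ge0 _)) _; rewrite ler_nat.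
Qed.

End Localization.

(** * Monotonicity of integrals without measurability, and lower limits *)

Section IntegralMonotone.
Context {d : measure_display} {T : measurableType d} {R : realType}.
Variable m : {measure set T -> \bar R}.
Local Open Scope ereal_scope.

(** The integral of a nonnegative function is a supremum over the simple functions below it, hence
    monotone for arbitrary functions. Stopped payoffs at general stopping times can therefore be
    compared without first proving them measurable. *)
Lemma ge0_integral_mono (f g : T -> \bar R) :
  (forall x, 0 <= f x) -> (forall x, f x <= g x) -> \int[m]_x f x <= \int[m]_x g x.
Proof.
move=> f0 fg; have g0 x : 0 <= g x by exact: le_trans (f0 x) (fg x).
rewrite !ge0_integralTE //; apply: ereal_sup_le => _ [h /= hf <-].
by exists h => //= x; exact: le_trans (hf x) (fg x).
Qed.

(** Dropping the negative part of [f] can only increase the integral; the case is needed because [g]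
    may be negative. *)
Lemma integral_le_ge0 (f g : T -> \bar R) :
  (forall x, 0 <= g x) -> (forall x, f x <= g x) -> \int[m]_x f x <= \int[m]_x g x.
Proof.
move=> g0 fg; rewrite integralE.
apply: (@le_trans _ _ (\int[m]_x f^\+ x)).
  rewrite -[leRHS]adde0; apply: leeD2l; rewrite oppe_le0.
  by apply: integral_ge0 => x _; exact: funeneg_ge0.
apply: ge0_integral_mono => x; first exact: funepos_ge0.
by rewrite funeposE ge_max fg g0.
Qed.

Lemma limn_einf_ge (u : (\bar R)^nat) (v : \bar R) (N : nat) :
  (forall n, (N <= n)%N -> v <= u n) -> v <= limn_einf u.
Proof.
move=> vu; rewrite limn_einf_lim; apply: lime_ge; first exact: is_cvg_einfs.
exists N => // n Nn; apply: le_ereal_inf_tmp => _ [k /= nk <-].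
by apply: vu; exact: leq_trans Nn nk.
Qed.

Lemma limn_einf_le (u : (\bar R)^nat) (v : \bar R) :
  (forall n, u n <= v) -> limn_einf u <= v.
Proof.
move=> uv; rewrite limn_einf_lim; apply: lime_le; first exact: is_cvg_einfs.
by exists 0%N => // n _; apply: le_trans (uv n); apply: ereal_inf_lbound; exists n => /=.
Qed.

End IntegralMonotone.

(** * The supermartingale inequality for arbitrary stopping times *)

Section Superharmonic.
Context {R : realType} {d : measure_display} {Omega : measurableType d}.
Variables (a b : \bar R) (mu sigma : R -> R) (F : R -> set_system Omega)
  (X : R -> Omega -> option R) (P : R -> probability Omega R).
Hypothesis hX : diffusion a b mu sigma F X P.
Hypothesis hmu : forall x, state_space a b x -> {for x, continuous mu}.
Hypothesis hsigma : forall x, state_space a b x -> {for x, continuous sigma}.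
Variables (r : R) (r0 : 0 <= r).
Local Notation I := (state_space a b).
Implicit Types (k f h : R -> R) (w : Omega) (s t u x y z c : R).

(** [tau] is localized to the intervals [[cl n, cu n]] and to times below [n + 1], and [Y n] is the
    discounted cutoff value there, of expectation at most [h x]. If the path is alive at a finite
    [tau], then eventually [rho n = tau] and [Y n] is the payoff; otherwise the payoff is zero and
    [Y n >= 0]. Fatou concludes. *)
Lemma superharmonic_stopping h (E : set R) x tau :
  piecewise_superharmonic a b mu sigma r h E -> (forall z, I z -> 0 <= h z) ->
  I x -> stopping_time F tau ->
  (\int[P x]_w (stopped_payoff r h X tau w)%:E <= (h x)%:E)%E.
Proof.
move=> hh h0 Ix [tau0 Ftau].
have [_ ch _ _] := hh.
have [cl [Icl lcl]] := lower_sequence Ix.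
have [cu [Icu lcu]] := upper_sequence Ix.
have up z : I z -> {z' | I z' & z < z'} by move=> Iz; apply/cid2; exact: state_space_upper.
have dn z : I z -> {z' | I z' & z' < z} by move=> Iz; apply/cid2; exact: state_space_lower.
(* The points are ordered as [c1 < cl <= x <= cu < c'' < c2]: the path is kept in [[cl, cu]], the
   cutoff equals [h] on [[cl, c'']], leaving room for the look-ahead, and its support is
   [[c1, c2]]. *)
pose c1 n := s2val (dn _ (Icl n).1).
pose c'' n := s2val (up _ (Icu n).1).
have Ic1 n : I (c1 n) by exact: (s2valP (dn _ (Icl n).1)).
have c1c n : c1 n < cl n by exact: (s2valP' (dn _ (Icl n).1)).
have Ic'' n : I (c'' n) by exact: (s2valP (up _ (Icu n).1)).
have cc'' n : cu n < c'' n by exact: (s2valP' (up _ (Icu n).1)).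
pose c2 n := s2val (up _ (Ic'' n)).
have Ic2 n : I (c2 n) by exact: (s2valP (up _ (Ic'' n))).
have c2c n : c'' n < c2 n by exact: (s2valP' (up _ (Ic'' n))).
have ext n := cid (cutoff_extension ch (Ic1 n) (Ic2 n) (c1c n) (c2c n)).
pose ht n := sval (ext n).
have hext n : [/\ continuous (ht n), forall z, ~ (c1 n <= z <= c2 n) -> ht n z = 0,
    forall z, cl n <= z <= c'' n -> ht n z = h z &
    forall z, I z -> 0 <= h z -> 0 <= ht n z <= h z] by exact: svalP (ext n).
pose L (n : nat) : R := n.+1%:R.
have L0 n : 0 < L n by [].
pose rho n := localized_time X tau (cl n) (cu n) (L n).
pose B n := localized_event X tau (cl n) (cu n) (L n).
have rho0L n w : 0 <= rho n w <= L n by exact: localized_time_bounds.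
have FB n t : 0 <= t -> F t (B n t) by exact: (localized_event_adapted hX).
have rhoB n t w : 0 <= t -> t < rho n w -> B n t w by exact: localized_time_event.
have Brho n t w : 0 <= t -> B n t w -> t <= rho n w by exact: localized_event_time.
have ht0 n z : 0 <= ht n z.
  have [_ hout _ hpos] := hext n.
  have [zc|zc] := pselect (c1 n <= z <= c2 n); last by rewrite hout.
  have Iz := state_space_segment (Ic1 n) (Ic2 n) zc.
  by have /andP[] := hpos z Iz (h0 z Iz).
pose Y n w := expR (- (r * rho n w)) * path_value X (ht n) (rho n w) w.
have mY n : measurable_fun setT (Y n).
  have [cht hout _ _] := hext n.
  exact: (discounted_value_measurable hX (L0 n) (rho0L n) (FB n) (rhoB n) (Brho n) r cht (Ic1 n) (Ic2 n) hout).
have Y0 n w : 0 <= Y n w.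
  by rewrite mulr_ge0 ?expR_ge0 // /path_value; case: (X _ _) => [z|] /=.
have EY n : (\int[P x]_w (Y n w)%:E <= (h x)%:E)%E.
  have [cht hout heq _] := hext n.
  have [K K0 hK] := compact_support_bounded cht hout.
  have iY : (P x).-integrable setT (EFin \o Y n).
    apply: (@bounded_integrable _ _ _ _ _ K) => // w.
    rewrite normrM -[K]mul1r; apply: ler_pM => //; last exact: path_value_bound.
    rewrite ger0_norm ?expR_ge0 // -[leRHS]expR0 ler_expR oppr_le0 mulr_ge0 //.
    by have /andP[] := rho0L n w.
  rewrite -(fineK (integrable_fin_num measurableT iY)) lee_fin.
  apply: (superharmonic_localized hX hmu hsigma r0 (L0 n) (rho0L n) (FB n) (rhoB n) (Brho n)
    hh (Ic1 n) (Ic2 n) (Icl n).1 _ (cc'' n) (Ic'' n) cht hout heq).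
  - exact: le_trans (Icl n).2 (Icu n).2.
  - by rewrite (Icl n).2 (Icu n).2.
  - by move=> t w t0 tr; have [_ st _] := rhoB n t w t0 tr; exact: st.
apply: (@le_trans _ _ (\int[P x]_w limn_einf (fun n => (Y n w)%:E))%E); last first.
  apply: le_trans; first apply: fatou => //.
  - by move=> n; exact/measurable_EFinP.
  - by move=> n w _; rewrite lee_fin.
  - exact: limn_einf_le.
have sp0 w : 0 <= stopped_payoff r h X tau w.
  rewrite /stopped_payoff; case E1 : (tau w) => [t| |] //.
  have t0 : 0 <= t by rewrite -lee_fin -E1.
  rewrite mulr_ge0 ?expR_ge0 //; case Xt : (X t w) => [z|] //=.
  by apply: h0; exact: (dif_state hX t0 Xt).
apply: ge0_integral_mono => w; first by rewrite lee_fin.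
rewrite /stopped_payoff; case E1 : (tau w) => [t| |]; last 2 first.
- by apply: (@limn_einf_ge _ _ _ 0%N) => n _; rewrite lee_fin.
- by apply: (@limn_einf_ge _ _ _ 0%N) => n _; rewrite lee_fin.
have t0 : 0 <= t by rewrite -lee_fin -E1.
case Xt : (X t w) => [z|] /=; last first.
  by rewrite mulr0; apply: (@limn_einf_ge _ _ _ 0%N) => n _; rewrite lee_fin.
have [lo [hi [Ilo Ihi rng]]] := alive_path_range hX t0 Xt.
have [N1 hN1] := lcl lo Ilo; have [N2 hN2] := lcu hi Ihi.
apply: (@limn_einf_ge _ _ _ (maxn N1 (maxn N2 (Num.bound t)))) => n.
rewrite !geq_max => /and3P[n1 n2 n3].
have lon := hN1 n n1; have hin := hN2 n n2.
have tL : t < L n.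
  apply: lt_trans (archi_boundP t0) _; rewrite /L ltr_nat ltnS //.
have stay s : 0 <= s -> s <= t -> staying X (cl n) (cu n) s w.
  move=> s0 st u u0 us; have [z' Xu /andP[zl zh]] := rng u u0 (le_trans us st).
  by exists z' => //; apply/andP; split; apply: ltW; [exact: lt_le_trans zl|exact: le_lt_trans hin].
have rt : rho n w = t.
  apply/eqP; rewrite eq_le (localized_time_le X _ _ (L0 n) tau0 E1) /=.
  apply: (localized_time_ge (L0 n)) => // s s0 st; split.
  - by rewrite E1 lte_fin.
  - by apply: stay => //; exact: ltW.
  - exact: lt_trans st tL.
rewrite lee_fin /Y rt /path_value Xt /=.
have [_ _ heq _] := hext n; rewrite heq //.
have [z' ] := stay t t0 (lexx t) t t0 (lexx t); rewrite Xt => -[<-] /andP[-> zc].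
by rewrite (le_trans zc) // ltW.
Qed.

End Superharmonic.

(** * Hitting times and the law of the running supremum at an exponential time *)

Section Hitting.
Context {R : realType} {d : measure_display} {Omega : measurableType d}.
Variables (a b : \bar R) (mu sigma : R -> R) (F : R -> set_system Omega)
  (X : R -> Omega -> option R) (P : R -> probability Omega R).
Hypothesis hX : diffusion a b mu sigma F X P.
Hypothesis hmu : forall x, state_space a b x -> {for x, continuous mu}.
Hypothesis hsigma : forall x, state_space a b x -> {for x, continuous sigma}.
Variables (r : R) (hr : 0 < r).
Local Notation I := (state_space a b).
Implicit Types (k f h : R -> R) (w : Omega) (s t u x y z c : R).

(** A decreasing reparametrization of the times in [[0, +oo]] by [[0, 1]]: events [tau <= t] become
    upper level sets of a bounded real variable. *)
Definition discount (t : \bar R) : R := if t is s%:E then expR (- (r * s)) else 0.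

Lemma discount_ge0 (t : \bar R) : 0 <= discount t.
Proof. by case: t => [s| |] //=; exact: expR_ge0. Qed.

Lemma discount_le1 (t : \bar R) : (0 <= t)%E -> discount t <= 1.
Proof.
case: t => [s| |] //=; rewrite lee_fin => s0.
by rewrite -[leRHS]expR0 ler_expR oppr_le0 mulr_ge0 // ltW.
Qed.

Lemma le_discount (t : \bar R) s : (0 <= t)%E -> (t <= s%:E)%E = (expR (- (r * s)) <= discount t).
Proof.
case: t => [u| |] //= u0; last by rewrite leye_eq [RHS]leNgt expR_gt0.
by rewrite lee_fin ler_expR lerN2 ler_pM2l.
Qed.

Lemma discount_event (S : set_system Omega) (tau : Omega -> \bar R) y :
  sigma_algebra setT S -> (forall w, (0 <= tau w)%E) ->
  (forall t, 0 <= t -> S [set w | (tau w <= t%:E)%E]) ->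
  S [set w | y <= discount (tau w)].
Proof.
move=> sS tau0 Stau; rewrite -[S](sigma_algebra_id sS).
have [y0|y0] := leP y 0.
  rewrite (_ : [set _ | _] = setT); first exact: (@measurableT _ (g_sigma_algebraType S)).
  by apply/seteqP; split => w //= _; exact: le_trans y0 (discount_ge0 _).
pose t := - ln y / r.
have yE : y = expR (- (r * t)).
  by rewrite /t mulrC divfK ?gt_eqF // opprK lnK.
rewrite (_ : [set _ | _] = [set w | (tau w <= t%:E)%E]); last first.
  by apply/seteqP; split => w /=; rewrite (le_discount t (tau0 w)) -yE.
(* A level [y > 1] corresponds to a negative [t], for which the event is empty. *)
have [t0|t0] := leP 0 t; first by apply: sub_sigma_algebra; exact: Stau.
rewrite (_ : [set _ | _] = set0); first exact: (@measurable0 _ (g_sigma_algebraType S)).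
apply/seteqP; split => w //= tt.
by have := le_trans (tau0 w) tt; rewrite lee_fin leNgt t0.
Qed.

Lemma discount_measurable (tau : Omega -> \bar R) :
  (forall w, (0 <= tau w)%E) ->
  (forall t, 0 <= t -> measurable [set w | (tau w <= t%:E)%E]) ->
  measurable_fun setT (fun w => discount (tau w)).
Proof.
move=> tau0 mtau; apply: (measurability (@RGenCInfty.G R)) => [|/= _ [_] [y] -> <-].
  exact: RGenCInfty.measurableE.
rewrite setTI.
rewrite (_ : _ @^-1` _ = [set w | y <= discount (tau w)]).
  by apply: discount_event => //; exact: sigma_algebra_measurable.
by apply/seteqP; split => w /=; rewrite in_itv /= andbT.
Qed.

Lemma hitting_time_measurable y t : I y -> 0 <= t ->
  measurable [set w | (hitting_time X y w <= t%:E)%E].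
Proof.
move=> Iy t0; apply: (hitting_time_le_event hX) => //.
  exact: sigma_algebra_measurable.
by move=> u A u0 _; exact: (state_in_measurable hX).
Qed.

Lemma hitting_time_stopping y : I y -> stopping_time F (hitting_time X y).
Proof.
move=> Iy; split => [w|t t0]; first exact: hitting_time_ge0.
have [sF _ Fst] := dif_filtration hX.
apply: (hitting_time_le_event hX) => //; first exact: sF.
by move=> u A u0 ut mA; apply: (Fst u t) => //; exact: (dif_adapted hX).
Qed.

(* The death time is always a first time: the set of times alive is open. *)
Lemma lifetime_first w x0 t0 : X 0 w = Some x0 -> 0 <= t0 -> X t0 w = None ->
  exists z, [/\ 0 < z, lifetime X w = z%:E, X z w = None &
    forall s, 0 <= s -> s < z -> X s w <> None].
Proof.
move=> X0 t00 Xt0.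
pose S := [set s | 0 <= s /\ X s w = None].
have hS : has_inf S by split; [exists t0|exists 0 => s []].
have S0 : 0 <= inf S by apply: lb_le_inf; [exists t0|move=> s []].
have before s : 0 <= s -> s < inf S -> X s w <> None.
  move=> s0 si Xs; have : inf S <= s by apply: ge_inf; [have [] := hS|].
  by rewrite leNgt si.
have XS : X (inf S) w = None.
  case E : (X (inf S) w) => [x|] //.
  have /nbhs_ballR [e e0 h] := dif_continuous hX S0 E ltr01.
  have [s [s0 Xs] si] := inf_adherent e0 hS.
  have is' : inf S <= s by apply: ge_inf; [have [] := hS|].
  have [||z Xz _] := h s => //; first by rewrite ger0_norm ?subr_ge0 // ltrBlDl.
  by rewrite Xs in Xz.
have Spos : 0 < inf S.
  by rewrite lt_neqAle S0 andbT; apply/eqP => S00; move: XS; rewrite -S00 X0.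
by exists (inf S); split => //; exact: lifetime_eq.
Qed.

(** With any reference level [y] in [I], exit at [a] means: start alive, die, and from some rational
    time on, at which the path is alive, never be seen above [y] at rational times. Conversely such
    a path cannot exit at [b], since it would exceed [y] just before death, and [dif_death] leaves
    only [a]. Measurability is what makes an exit of probability zero usable almost surely. *)
Lemma exits_lower_measurable : (exists z, I z) -> measurable [set w | exits_at X a w].
Proof.
move=> [y Iy].
pose A0 (n : nat) := ~` state_in X n%:R setT.
pose A1 (q : rat) : set Omega := if 0 <= (ratr q : R) then state_in X (ratr q) setT `&`
  ~` (\bigcup_(s : rat) (if (ratr q : R) <= ratr s then state_in X (ratr s) `[y, +oo[ else set0)) else set0.
rewrite (_ : [set w | exits_at X a w] =
    state_in X 0 setT `&` (\bigcup_n A0 n) `&` \bigcup_q A1 q).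
  apply: measurableI; first apply: measurableI.
  - exact: (state_in_measurable hX).
  - by apply: bigcupT_measurable => n; apply: measurableC; exact: (state_in_measurable hX).
  - apply: bigcupT_measurable_rat => q; rewrite /A1; case: ifP => // q0.
    apply: measurableI; first exact: (state_in_measurable hX).
    apply: measurableC; apply: bigcupT_measurable_rat => s; case: ifP => // qs.
    apply: (state_in_measurable hX); first exact: le_trans qs.
    exact: measurable_itv.
apply/seteqP; split => w /=.
  move=> ex; have [t [t0 L _]] := ex.
  have al s : 0 <= s -> s < t -> exists z, X s w = Some z.
    move=> s0 st; case E : (X s w) => [z|]; first by exists z.
    have : (lifetime X w <= s%:E)%E by apply: ereal_inf_lbound; exists s.
    by rewrite L lee_fin leNgt st.
  have Ac : nbhs a [set z | z < y%:E]%E.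
    by apply: open_nbhs_nbhs; split; [exact: open_ereal_lt_ereal|case/andP: Iy].
  have [e' e'0 h] := exits_at_level L ex Ac.
  split; [split|].
  - by have [z X0] := al 0 (lexx 0) t0; apply/state_in_SomeP; exists z.
  - have : (lifetime X w < (t + 1)%:E)%E by rewrite L lte_fin ltrDl.
    move=> /ereal_inf_lt [_ [s [s0 Xs] <-] _]; exists (Num.bound s) => //.
    move=> /state_in_SomeP [z Xz _].
    by have := dif_absorbed hX s0 (ltW (archi_boundP s0)) Xs; rewrite Xz.
  - have [|q] := @rat_in_itvoo R (Num.max 0 (t - e')) t; first by rewrite gt_max t0 /=; lra.
    rewrite in_itv /= gt_max => /andP[/andP[q0 qe] qt].
    exists q => //; rewrite /A1 (ltW q0); split.
      by have [z Xq] := al _ (ltW q0) qt; apply/state_in_SomeP; exists z.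
    move=> [s _]; case: ifP => // qs /state_in_SomeP [z Xs].
    rewrite /= in_itv /= andbT => yz.
    have [st|ts] := ltP (ratr s) t.
      by have := h _ (lt_le_trans qe qs) st; rewrite Xs /= lte_fin ltNge yz.
    have s0 : 0 <= (ratr s : R) by exact: le_trans (ltW q0) qs.
    have : ~ (lifetime X w < (ratr s)%:E)%E.
      move=> /ereal_inf_lt [_ [u [u0 Xu] <-]]; rewrite lte_fin => us.
      by have := dif_absorbed hX u0 (ltW us) Xu; rewrite Xs.
    rewrite L lte_fin => nts.
    have tE : t = ratr s by apply/eqP; rewrite eq_le ts leNgt; apply/negP.
    have /nbhs_ballR [e e0 he] := dif_continuous hX s0 Xs ltr01.
    have : (lifetime X w < (t + e)%:E)%E by rewrite L lte_fin ltrDl.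
    move=> /ereal_inf_lt [_ [u [u0 Xu] <-]]; rewrite lte_fin => ute.
    have tu : t <= u.
      by rewrite -lee_fin -L; apply: ereal_inf_lbound; exists u.
    have [||z' Xu' _] := he u => //; first by rewrite ger0_norm -?tE ?subr_ge0 //; lra.
    by rewrite Xu in Xu'.
move=> [[/state_in_SomeP [x0 X0 _] [n _ An]] [q _]].
have Xn : X n%:R w = None.
  by case E : (X n%:R w) => [z|] //; exfalso; apply: An; apply/state_in_SomeP; exists z.
have [t [t0 L Xt al]] := lifetime_first X0 (ler0n _ _) Xn.
rewrite /A1; case: ifP => // q0 [/state_in_SomeP [zq Xq _] nA].
have [//|eb] := dif_death hX t0 L.
have Ac : nbhs b [set z | y%:E < z]%E.
  by apply: open_nbhs_nbhs; split; [exact: open_ereal_gt_ereal|case/andP: Iy].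
have [e' e'0 h] := exits_at_level L eb Ac.
have qt : (ratr q : R) < t.
  by rewrite ltNge; apply/negP => tq; have := dif_absorbed hX (ltW t0) tq Xt; rewrite Xq.
have [|s] := @rat_in_itvoo R (Num.max (ratr q) (t - e')) t; first by rewrite gt_max qt /=; lra.
rewrite in_itv /= gt_max => /andP[/andP[qs es] st].
exfalso; apply: nA; exists s => //; rewrite (ltW qs).
have s0 : 0 <= (ratr s : R) by exact: le_trans q0 (ltW qs).
case Es : (X (ratr s) w) => [z|]; last by case: (al _ s0 st Es).
apply/state_in_SomeP; exists z => //=; rewrite in_itv /= andbT.
by have := h _ es st; rewrite Es /= lte_fin => /ltW.
Qed.

End Hitting.

(** * Locality and scaling of twice differentiable functions *)

Section C2Algebra.
Context {R : realType}.
Implicit Types (f g : R -> R) (x c : R).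

Lemma derive1_near f g x : {near x, f =1 g} -> \forall z \near x, derive1 g z = derive1 f z.
Proof.
move=> /near_join fg; near=> z.
rewrite !derive1E; apply/esym/near_eq_derive.
by near: z.
Unshelve. all: by end_near.
Qed.

Lemma C2_at_near f g x : {near x, f =1 g} -> C2_at f x ->
  [/\ C2_at g x, derive1 g x = derive1 f x & derive1 (derive1 g) x = derive1 (derive1 f) x].
Proof.
move=> fg [d1 d2 c2].
have fg1 := derive1_near fg.
have fg1' : {near x, derive1 f =1 derive1 g} by apply: filterS fg1 => z ->.
have fg2 := derive1_near fg1'.
split; [|exact: nbhs_singleton fg1|exact: nbhs_singleton fg2].
split.
- move: (near_join fg) => fg'; near=> z.
  apply: near_eq_derivable; last by near: z; exact: d1.
  by near: z.
- move: (near_join fg1') => fg'; near=> z.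
  apply: near_eq_derivable; last by near: z; exact: d2.
  by near: z.
- suff : derive1 (derive1 g) z @[z --> x] --> derive1 (derive1 g) x by [].
  rewrite (nbhs_singleton fg2).
  by apply: cvg_trans c2; apply: near_eq_cvg; apply: filterS fg2 => z ->.
Unshelve. all: by end_near.
Qed.

Lemma derive1_scale c f x : derivable f x 1 ->
  derivable (fun z => c * f z) x 1 /\ derive1 (fun z => c * f z) x = c * derive1 f x.
Proof.
move=> fx; have fd := derivable_is_derive1 fx.
have gd : is_derive x 1 (fun z => c * f z) (c * derive1 f x) by exact: is_deriveZ.
by split; [exact: ex_derive|exact: derive1_is_derive].
Qed.

Lemma C2_at_scale c f x : C2_at f x ->
  [/\ C2_at (fun z => c * f z) x, derive1 (fun z => c * f z) x = c * derive1 f x &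
      derive1 (derive1 (fun z => c * f z)) x = c * derive1 (derive1 f) x].
Proof.
move=> [d1 d2 c2].
have e1 : \forall z \near x, derive1 (fun z => c * f z) z = c * derive1 f z.
  by apply: filterS d1 => z /(derive1_scale c) [].
have e2 : \forall z \near x, derive1 (derive1 (fun z => c * f z)) z = c * derive1 (derive1 f) z.
  have e1' : {near x, (fun z => c * derive1 f z) =1 derive1 (fun z => c * f z)}.
    by apply: filterS e1 => z ->.
  apply: filterS2 (derive1_near e1') d2 => z -> dz.
  by have [] := derive1_scale c dz.
split; [|exact: nbhs_singleton e1|exact: nbhs_singleton e2].
split.
- by apply: filterS d1 => z /(derive1_scale c) [].
- have e1' : {near x, (fun z => c * derive1 f z) =1 derive1 (fun z => c * f z)}.
    by apply: filterS e1 => z ->.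
  apply: filterS2 (near_join e1') d2 => z ez dz.
  apply: near_eq_derivable ez _.
  by have [] := derive1_scale c dz.
- suff : derive1 (derive1 (fun z => c * f z)) z @[z --> x] -->
      derive1 (derive1 (fun z => c * f z)) x by [].
  rewrite (nbhs_singleton e2).
  have cc : (fun z => c * derive1 (derive1 f) z) z @[z --> x] --> c * derive1 (derive1 f) x.
    by apply: cvgM; [exact: cvg_cst|exact: c2].
  by apply: cvg_trans cc; apply: near_eq_cvg; apply: filterS e2 => z ->.
Unshelve. all: by end_near.
Qed.

Lemma generator_r_scale (mu sigma : R -> R) (r : R) c f x : C2_at f x ->
  generator_r mu sigma r (fun z => c * f z) x = c * generator_r mu sigma r f x.
Proof.
by move=> /(C2_at_scale c) [_ e1 e2]; rewrite /generator_r /generator e1 e2; ring.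
Qed.

Lemma C2_piecewise_superharmonic (a b : \bar R) (mu sigma : R -> R) (r : R) f :
  (forall z, state_space a b z -> C2_at f z) ->
  (forall z, state_space a b z -> generator_r mu sigma r f z <= 0) ->
  piecewise_superharmonic a b mu sigma r f set0.
Proof.
move=> fC fG; split => //; first by move=> z /fC /C2_at_continuous.
by move=> z Iz _; split; [exact: fC|exact: fG].
Qed.

End C2Algebra.

(** * The Laplace transform of hitting times *)

Section HittingExpectation.
Context {R : realType} {d : measure_display} {Omega : measurableType d}.
Variables (a b : \bar R) (mu sigma : R -> R) (F : R -> set_system Omega)
  (X : R -> Omega -> option R) (P : R -> probability Omega R).
Hypothesis hX : diffusion a b mu sigma F X P.
Hypothesis hmu : forall x, state_space a b x -> {for x, continuous mu}.
Hypothesis hsigma : forall x, state_space a b x -> {for x, continuous sigma}.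
Variables (r : R) (hr : 0 < r) (psi : R -> R).
Hypothesis hpsi : increasing_solution a b mu sigma r P X psi.
Local Notation I := (state_space a b).
Implicit Types (k f h : R -> R) (w : Omega) (s t u x y z c : R).

Lemma psi_mono y z : I y -> I z -> y <= z -> psi y <= psi z.
Proof.
move=> Iy Iz; rewrite le_eqVlt => /orP[/eqP -> //|yz]; have [_ h _ _ _] := hpsi.
by apply/ltW/h.
Qed.

Lemma not_accessible_ae x : I x -> ~ accessible I P X a ->
  {ae P x, forall w, ~ exits_at X a w}.
Proof.
move=> Ix na; exists [set w | exits_at X a w]; split.
- by apply: (exits_lower_measurable hX); exists x.
- apply/eqP; rewrite eq_le measure_ge0 andbT leNgt; apply/negP => pos.
  by apply: na; exists x.
- by move=> w /= /contrapT.
Qed.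

(** Localizing below [z] gives the exact value [psi x] for each [n], and all [Y n] are bounded by
    [psi z2], so only pointwise convergence to [psi z * discount r (tau w)] remains. If [z] is hit,
    [rho n] is eventually the hitting time. If not, either the path lives forever and discounting
    kills the limit, or it dies, necessarily at [a]. *)
Lemma hitting_expectation x z : I x -> I z -> x <= z ->
  \int[P x]_w discount r (hitting_time X z w) = psi x / psi z.
Proof.
move=> Ix Iz xz; have [psi0 psi_incr psiC psiG psia] := hpsi.
have [r0 psz] : 0 <= r /\ 0 < psi z by split; [exact: ltW|exact: psi0].
have hh : piecewise_superharmonic a b mu sigma r psi set0.
  by apply: C2_piecewise_superharmonic => // u Iu; rewrite psiG.
have hhN : piecewise_superharmonic a b mu sigma r (fun z => -1 * psi z) set0.
  apply: C2_piecewise_superharmonic => u Iu.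
    by have [] := C2_at_scale (-1) (psiC u Iu).
  by rewrite (generator_r_scale _ _ _ _ (psiC u Iu)) psiG // mulr0.
have cpsi u : I u -> {for u, continuous psi} by move=> /psiC /C2_at_continuous.
have [cl [Icl lcl]] := lower_sequence Ix.
(* The path is stopped at [z]; the cutoff equals [psi] up to [z1] and its support ends at [z2],
   which also supplies the uniform bound [psi z2]. *)
have [z1 Iz1 zz1] := state_space_upper Iz.
have [z2 Iz2 z1z2] := state_space_upper Iz1.
have dn u : I u -> {u' | I u' & u' < u} by move=> Iu; apply/cid2; exact: state_space_lower.
pose c1 n := s2val (dn _ (Icl n).1).
have Ic1 n : I (c1 n) by exact: (s2valP (dn _ (Icl n).1)).
have c1c n : c1 n < cl n by exact: (s2valP' (dn _ (Icl n).1)).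
have ext n := cid (cutoff_extension cpsi (Ic1 n) Iz2 (c1c n) z1z2).
pose ht n := sval (ext n).
have hext n : [/\ continuous (ht n), forall u, ~ (c1 n <= u <= z2) -> ht n u = 0,
    forall u, cl n <= u <= z1 -> ht n u = psi u &
    forall u, I u -> 0 <= psi u -> 0 <= ht n u <= psi u] by exact: svalP (ext n).
pose L (n : nat) : R := n.+1%:R.
have L0 n : 0 < L n by [].
pose tau := hitting_time X z.
have [tau0 Ftau] := hitting_time_stopping hX Iz.
pose rho n := localized_time X tau (cl n) z (L n).
pose B n := localized_event X tau (cl n) z (L n).
have rho0L n w : 0 <= rho n w <= L n by exact: localized_time_bounds.
have rho0 n w : 0 <= rho n w by have /andP[] := rho0L n w.
have FB n t : 0 <= t -> F t (B n t) by exact: (localized_event_adapted hX).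
have rhoB n t w : 0 <= t -> t < rho n w -> B n t w by exact: localized_time_event.
have Brho n t w : 0 <= t -> B n t w -> t <= rho n w by exact: localized_event_time.
have htb n u : 0 <= ht n u <= psi z2.
  have [_ hout _ hpos] := hext n.
  have [uc|uc] := pselect (c1 n <= u <= z2); last by rewrite hout // lexx /= ltW // psi0.
  have Iu := state_space_segment (Ic1 n) Iz2 uc.
  have /andP[-> h] := hpos u Iu (ltW (psi0 u Iu)).
  by rewrite (le_trans h) // psi_mono //; case/andP: uc.
pose Y n w := expR (- (r * rho n w)) * path_value X (ht n) (rho n w) w.
have mY n : measurable_fun setT (Y n).
  have [cht hout _ _] := hext n.
  exact: (discounted_value_measurable hX (L0 n) (rho0L n) (FB n) (rhoB n) (Brho n) r cht (Ic1 n) Iz2 hout).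
have pvb n t w : 0 <= path_value X (ht n) t w <= psi z2.
  by rewrite /path_value; case: (X t w) => [u|] /=; [exact: htb|rewrite lexx ltW // psi0].
have Yle n w : 0 <= Y n w <= expR (- (r * rho n w)) * psi z2.
  have /andP[p1 p2] := pvb n (rho n w) w.
  by rewrite mulr_ge0 ?expR_ge0 //= ler_wpM2l // expR_ge0.
have Yb n w : `|Y n w| <= psi z2.
  have /andP[h1 h2] := Yle n w; rewrite ger0_norm //; apply: le_trans h2 _.
  rewrite ler_piMl ?(ltW (psi0 _ Iz2)) // -[leRHS]expR0 ler_expR oppr_le0 mulr_ge0 //.
have EY n : \int[P x]_w Y n w = psi x.
  have [cht hout heq _] := hext n.
  have stay t w : 0 <= t -> t < rho n w -> exists2 u, X t w = Some u & cl n <= u <= z.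
    by move=> t0 tr; have [_ st _] := rhoB n t w t0 tr; exact: st.
  have clz := le_trans (Icl n).2 xz.
  have xin : cl n <= x <= z by rewrite (Icl n).2.
  apply/eqP; rewrite eq_le; apply/andP; split.
    exact: (superharmonic_localized hX hmu hsigma r0 (L0 n) (rho0L n) (FB n) (rhoB n) (Brho n)
      hh (Ic1 n) Iz2 (Icl n).1 clz zz1 Iz1 cht hout heq xin).
  have chtN : continuous (fun u => -1 * ht n u).
    by move=> u; apply: cvgM; [exact: cvg_cst|exact: cht].
  have houtN u : ~ (c1 n <= u <= z2) -> -1 * ht n u = 0 by move=> /hout ->; rewrite mulr0.
  have heqN u : cl n <= u <= z1 -> -1 * ht n u = -1 * psi u by move=> /heq ->.
  have := superharmonic_localized hX hmu hsigma r0 (L0 n) (rho0L n) (FB n) (rhoB n) (Brho n)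
      hhN (Ic1 n) Iz2 (Icl n).1 clz zz1 Iz1 chtN houtN heqN xin stay.
  rewrite (_ : (fun w => _) = fun w => -1 * Y n w); last first.
    apply/funext => w; rewrite /Y /path_value.
    by case: (X _ w) => [u|] /=; ring.
  rewrite RintegralZl //; last exact: (bounded_integrable (P x) (mY n) (Yb n)).
  by rewrite !mulN1r lerN2.
have mD : measurable_fun setT (fun w => psi z * discount r (tau w)).
  apply: measurable_funM; first exact: measurable_cst.
  apply: (discount_measurable hr) => // t t0; exact: (hitting_time_measurable hX).
have iD : (P x).-integrable setT (EFin \o (fun w => discount r (tau w))).
  apply: (@bounded_integrable _ _ _ _ _ 1).
    apply: (discount_measurable hr) => // t t0; exact: (hitting_time_measurable hX).
  by move=> w; rewrite ger0_norm ?discount_ge0 // discount_le1.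
have stay_of w t xt : 0 <= t -> X t w = Some xt -> (forall s u, 0 <= s -> s < t -> X s w = Some u -> u < z) ->
    exists N, forall n, (N <= n)%N -> cl n < xt /\ (t < L n /\ forall s, 0 <= s -> s < t -> staying X (cl n) z s w).
  move=> t0 Xt below; have [lo [hi [Ilo Ihi rng]]] := alive_path_range hX t0 Xt.
  have [N1 hN1] := lcl lo Ilo; exists (maxn N1 (Num.bound t)) => n.
  rewrite geq_max => /andP[n1 n2]; have lon := hN1 n n1.
  split; last split.
  - have [u] := rng t t0 (lexx t); rewrite Xt => -[->] /andP[lu _]; exact: lt_le_trans lon lu.
  - by apply: lt_trans (archi_boundP t0) _; rewrite /L ltr_nat ltnS.
  - move=> s s0 st u u0 us; have [u' Xu /andP[lu _]] := rng u u0 (ltW (le_lt_trans us st)).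
    exists u' => //; rewrite (ltW (lt_le_trans lon lu)) /=.
    by apply: ltW; exact: below (le_lt_trans us st) Xu.
have Ycvg : {ae P x, forall w, Y n w @[n --> \oo] --> psi z * discount r (tau w)}.
  have nae : {ae P x, forall w, ~ exits_at X a w \/ accessible I P X a}.
    have [ac|nac] := pselect (accessible I P X a); first by apply: aeW => w; right.
    by apply: filterS (not_accessible_ae Ix nac) => w ?; left.
  near=> w.
  have X0 : X 0 w = Some x by near: w; exact: (start_ae hX).
  have exw : ~ exits_at X a w \/ accessible I P X a by near: w; exact: nae.
  have rho_ge t xt : 0 <= t -> X t w = Some xt -> (t%:E <= tau w)%E ->
      exists N, forall n, (N <= n)%N -> cl n < xt /\ t <= rho n w.
    move=> t0 Xt tt; have below s u : 0 <= s -> s < t -> X s w = Some u -> u < z.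
      move=> s0 st Xs; rewrite ltNge; apply/negP => zu.
      have : (tau w <= s%:E)%E by apply: hitting_time_le => //; exists u.
      by move=> /(le_trans tt); rewrite lee_fin leNgt st.
    have [N hN] := stay_of w t xt t0 Xt below; exists N => n /hN [clt [tL st]].
    split => //; apply: (localized_time_ge (L0 n)) => // s s0 s_t; split.
    - by apply: lt_le_trans tt; rewrite lte_fin.
    - exact: st.
    - exact: lt_trans s_t tL.
  case Et : (tau w) => [t| |]; last by have := tau0 w; rewrite -/(tau w) Et.
    have [t0 [z' Xt' zz'] _] := hitting_time_attained hX Et.
    have Xt : X t w = Some z.
      (* If the hit happens at time [0], the start [x <= z] is also at least [z], so it equals [z];
         this covers [x = z]. *)
      move: t0; rewrite le_eqVlt => /orP[/eqP t0|t0]; last exact: (hitting_time_value hX Et).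
      move: Xt'; rewrite -t0 X0 => -[xz']; rewrite -xz' in zz'.
      by congr Some; apply/eqP; rewrite eq_le xz.
    have [|N hN] := rho_ge t z t0 Xt; first by rewrite Et.
    apply/cvgrPdist_le => e e0; exists N => // n /= /hN [clz tr].
    have rt : rho n w = t.
      by apply/eqP; rewrite eq_le (localized_time_le X _ _ (L0 n) tau0 Et).
    have [_ _ heq _] := hext n.
    rewrite /Y rt /path_value Xt /= heq; last by rewrite !ltW.
    by rewrite mulrC subrr normr0 ltW.
  have below s u : 0 <= s -> X s w = Some u -> u < z.
    move=> s0 Xs; rewrite ltNge; apply/negP => zu.
    have : (tau w <= s%:E)%E by apply: hitting_time_le => //; exists u.
    by rewrite Et.
  have small e : 0 < e -> (exists N, forall n, (N <= n)%N -> Y n w <= e) ->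
      exists N, forall n, (N <= n)%N -> `|0 - Y n w| <= e.
    move=> e0 [N hN]; exists N => n /hN h.
    by rewrite sub0r normrN ger0_norm //; have /andP[] := Yle n w.
  rewrite /= mulr0; apply/cvgrPdist_le => e e0.
  suff /(small e e0) [N hN] : exists N, forall n, (N <= n)%N -> Y n w <= e.
    by exists N => // n /= /hN.
  have Ydecay n t : t <= rho n w -> Y n w <= expR (- (r * t)) * psi z2.
    move=> tr; have /andP[_] := Yle n w; move=> /le_trans; apply.
    by rewrite ler_wpM2r ?(ltW (psi0 _ Iz2)) // ler_expR lerN2 ler_wpM2l.
  have [[t1 [t10 Xt1]]|alive] := pselect (exists t1, 0 <= t1 /\ X t1 w = None); last first.
    (* Chosen so that [1 + r * t1 <= expR (r * t1)] already makes the discounted bound [psi z2] at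
       most [e]. *)
    pose t1 := psi z2 / (e * r).
    have t10 : 0 <= t1 by rewrite divr_ge0 ?mulr_ge0 // ltW // psi0.
    case Xt : (X t1 w) => [xt|]; last by exfalso; apply: alive; exists t1.
    have [|N hN] := rho_ge t1 xt t10 Xt; first by rewrite Et leey.
    exists N => n /hN [_ tr]; apply: le_trans (Ydecay n t1 tr) _.
    rewrite expRN mulrC ler_pdivrMr ?expR_gt0 //.
    have h1 := expR_ge1Dx (r * t1).
    have h2 : r * t1 = psi z2 / e by rewrite /t1; field; rewrite !gt_eqF.
    have h3 : e * (psi z2 / e) = psi z2 by field; rewrite gt_eqF.
    rewrite -h3 ler_pM2l // -h2; apply: le_trans h1; lra.
  have [ze [ze0 Lz Xz al]] := lifetime_first hX X0 t10 Xt1.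
  have alS s : 0 <= s -> s < ze -> exists u, X s w = Some u.
    by move=> s0 sz; case Es : (X s w) => [u|]; [exists u|case: (al s s0 sz)].
  (* A path exiting at [b] would exceed [z] just before death, contrary to never reaching [z]. *)
  have ex : exits_at X a w.
    have [//|eb] := dif_death hX ze0 Lz; exfalso.
    have Ac : nbhs b [set v | z%:E < v]%E.
      by apply: open_nbhs_nbhs; split; [exact: open_ereal_gt_ereal|case/andP: Iz].
    have [e' e'0 h] := exits_at_level Lz eb Ac.
    pose s := Num.max 0 (ze - e' / 2).
    have s0 : 0 <= s by rewrite le_max lexx.
    have sz : s < ze by rewrite gt_max ze0; lra.
    have se : ze - e' < s by rewrite lt_max; apply/orP; right; lra.
    have [u Xs] := alS s s0 sz.
    have := h s se sz; rewrite Xs /= lte_fin => zu.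
    by have := below s u s0 Xs; rewrite ltNge (ltW zu).
  have [//|ac] := exw.
  (* Exit at [a] now has a path only when [a] is accessible, and then [psi] is below [e] under some
     [c0]. Before death the path stays under [c0]; after it the value is zero. Either way [Y n] is
     at most [e]. *)
  have [c0 Ic0 hc0] := psia ac _ (nbhsx_ballx (0 : R) e e0).
  have Ac : nbhs a [set v | v < c0%:E]%E.
    by apply: open_nbhs_nbhs; split; [exact: open_ereal_lt_ereal|case/andP: Ic0].
  have [e' e'0 h] := exits_at_level Lz ex Ac.
  pose s := Num.max 0 (ze - e' / 2).
  have s0 : 0 <= s by rewrite le_max lexx.
  have sz : s < ze by rewrite gt_max ze0; lra.
  have se : ze - e' < s by rewrite lt_max; apply/orP; right; lra.
  have [u Xs] := alS s s0 sz.
  have [|N hN] := rho_ge s u s0 Xs; first by rewrite Et leey.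
  exists N => n /hN [_ sr].
  rewrite /Y /path_value; case Xr : (X (rho n w) w) => [v|] /=; last by rewrite mulr0 ltW.
  have rz : rho n w < ze.
    by rewrite ltNge; apply/negP => zr; have := dif_absorbed hX (ltW ze0) zr Xz; rewrite Xr.
  have := h _ (lt_le_trans se sr) rz; rewrite Xr /= lte_fin => vc0.
  have Iv : I v by exact: (dif_state hX (rho0 n w) Xr).
  have := hc0 v (conj Iv vc0); rewrite /ball /= sub0r normrN gtr0_norm ?psi0 // => pve.
  have [_ _ _ hpos] := hext n.
  have /andP[_ hv] := hpos v Iv (ltW (psi0 v Iv)).
  apply: (@le_trans _ _ (1 * ht n v)); last by rewrite mul1r (le_trans hv) // ltW.
  apply: ler_wpM2r; first by have /andP[] := htb n v.
  by rewrite -[leRHS]expR0 ler_expR oppr_le0 mulr_ge0.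
have lim := bounded_convergence mY mD Yb Ycvg.
have E1 : psi z * \int[P x]_w discount r (tau w) = psi x.
  rewrite -RintegralZl //.
  apply: (cvg_unique (@Rhausdorff R) lim).
  rewrite (_ : (fun n => _) = fun=> psi x); first exact: cvg_cst.
  by apply/funext => n; exact: EY.
by rewrite -E1 (mulrC (psi z)) mulfK // gt_eqF.
Unshelve. all: by end_near.
Qed.

End HittingExpectation.

(** * Independent exponential times and the law of the running supremum *)

Section ExponentialTime.
Context {R : realType} {d : measure_display} {Omega : measurableType d}.
Variables (a b : \bar R) (mu sigma : R -> R) (F : R -> set_system Omega)
  (X : R -> Omega -> option R) (P : R -> probability Omega R).
Hypothesis hX : diffusion a b mu sigma F X P.
Hypothesis hmu : forall x, state_space a b x -> {for x, continuous mu}.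
Hypothesis hsigma : forall x, state_space a b x -> {for x, continuous sigma}.
Variables (r : R) (hr : 0 < r) (psi : R -> R) (T : Omega -> R).
Hypothesis hpsi : increasing_solution a b mu sigma r P X psi.
Hypothesis hT : independent_exponential_time (state_space a b) r X P T.
Local Notation I := (state_space a b).
Implicit Types (k f h : R -> R) (w : Omega) (s t u x y z c : R).

Lemma expectation_indic x (A : set Omega) : measurable A ->
  \int[P x]_w \1_A w = fine (P x A).
Proof. by move=> mA; rewrite /Rintegral integral_indic // setIT. Qed.

Let mT : measurable_fun setT T. Proof. by have [] := hT. Qed.

Let mTpre (A : set R) : measurable A -> measurable (T @^-1` A).
Proof. by move=> mA; rewrite -[X in measurable X]setTI; exact: mT. Qed.

Lemma exponential_time_gt x s : I x -> 0 <= s ->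
  P x (T @^-1` `]s, +oo[) = (expR (- (r * s)))%:E.
Proof.
move=> Ix s0; have [_ dist _] := hT.
have neg : P x (T @^-1` `]-oo, 0[) = 0%E.
  rewrite dist // /exponential_prob; apply: integral0_eq => u /=.
  by rewrite in_itv /= => u0; rewrite lt0_exponential_pdf.
have pos : P x (T @^-1` `[0, s]) = (1 - (expR (- (r * s)))%:E)%E.
  rewrite dist //; move: s0; rewrite le_eqVlt => /orP[/eqP <-|s0].
    rewrite mulr0 oppr0 expR0 subee // set_itv1 /exponential_prob.
    exact: integral_set1.
  by rewrite exponential_prob_itv0c // mulNr.
have le_s : P x (T @^-1` `]-oo, s]) = (1 - (expR (- (r * s)))%:E)%E.
  rewrite (_ : T @^-1` `]-oo, s] = T @^-1` `]-oo, 0[ `|` T @^-1` `[0, s]); last first.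
    apply/seteqP; split => w /=; rewrite !in_itv /=.
      by move=> Ts; have [T0|T0] := ltP (T w) 0; [left|right; rewrite Ts].
    by move=> [T0|/andP[]//]; exact: le_trans (ltW T0) s0.
  rewrite measureU; first by rewrite -[RHS]add0e; congr (_ + _)%E.
  - exact: mTpre.
  - exact: mTpre.
  - by apply/seteqP; split => w //= []; rewrite !in_itv /= => T0 /andP[]; rewrite leNgt T0.
rewrite (_ : T @^-1` `]s, +oo[ = ~` (T @^-1` `]-oo, s])); last first.
  by apply/seteqP; split => w /=; rewrite !in_itv /= andbT ltNge => /negP.
rewrite probability_setC; last exact: mTpre.
by rewrite le_s -!EFinB; congr EFin; ring.
Qed.

Let S := process_sigma_algebra X.

Let S_sigma : sigma_algebra setT S. Proof. exact: smallest_sigma_algebra. Qed.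

Let S_measurable : S `<=` measurable.
Proof.
apply: smallest_sub; first exact: sigma_algebra_measurable.
by move=> _ [t [A [t0 mA ->]]]; exact: (state_in_measurable hX).
Qed.

(** With [V = e^(-r T)], uniform on [(0, 1)], the event reads [V <= D], and [D] depends on the path
    alone. Independence is given for product events only, so [D] is cut into the layers [A j], where
    it lies between [j / N] and [(j + 1) / N]. There the event is squeezed between two product
    events, and the total error is at most [1 / N]. *)
Lemma probability_le_exponential_time x (tau : Omega -> \bar R) : I x ->
  (forall w, (0 <= tau w)%E) ->
  (forall t, 0 <= t -> S [set w | (tau w <= t%:E)%E]) ->
  measurable [set w | (tau w <= (T w)%:E)%E] /\
  P x [set w | (tau w <= (T w)%:E)%E] = (\int[P x]_w discount r (tau w))%:E.
Proof.
move=> Ix tau0 Stau; have [_ _ indep] := hT.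
pose D w := discount r (tau w).
have D0 w : 0 <= D w by exact: discount_ge0.
have D1 w : D w <= 1 by exact: (discount_le1 hr).
have mD : measurable_fun setT D.
  by apply: (discount_measurable hr) => // t t0; apply: S_measurable; exact: Stau.
pose V w := expR (- (r * T w)).
have mV : measurable_fun setT V.
  apply: (@measurableT_comp _ _ _ _ _ _ expR) => //.
  by apply: measurable_funN; apply: measurable_funM => //; exact: measurable_cst.
have eqE : [set w | (tau w <= (T w)%:E)%E] = [set w | V w <= D w].
  by apply/seteqP; split => w /=; rewrite (le_discount hr (T w) (tau0 w)).
have mE : measurable [set w | V w <= D w].
  have := measurable_fun_ler mV mD; move=> /(_ measurableT [set true]).
  rewrite setTI; apply => //.
rewrite eqE; split => //.
pose W (q : R) := [set w | V w < q].
have mW q : measurable (W q).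
  have := measurable_fun_ltr mV (measurable_cst q : measurable_fun setT (cst q)).
  by move=> /(_ measurableT [set true]); rewrite setTI; apply.
have PW (A : set Omega) q : S A -> 0 <= q -> q <= 1 -> fine (P x (A `&` W q)) = fine (P x A) * q.
  move=> SA q0 q1; move: q0; rewrite le_eqVlt => /orP[/eqP <-|q0].
    rewrite (_ : W 0 = set0) ?setI0 ?measure0 ?mulr0 //.
    by apply/seteqP; split => w //=; rewrite /W /= ltNge expR_ge0.
  pose s := - ln q / r.
  have qE : q = expR (- (r * s)) by rewrite /s mulrC divfK ?gt_eqF // opprK lnK.
  have s0 : 0 <= s by rewrite divr_ge0 ?(ltW hr) // oppr_ge0 ln_le0.
  rewrite (_ : W q = T @^-1` `]s, +oo[); last first.
    by apply/seteqP; split => w /=; rewrite in_itv /= andbT /W /= {1}qE ltr_expR ltrN2 ltr_pM2l.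
  rewrite indep // exponential_time_gt // -qE fineM // ?fin_num_measure //.
  exact: S_measurable.
(* The top layer [j = N], where [D = 1], leads to the level [(N + 1) / N] above [1]; an inequality
   is enough there. *)
have PWle (A : set Omega) q : S A -> 0 <= q -> fine (P x (A `&` W q)) <= fine (P x A) * q.
  move=> SA q0; have [q1|q1] := leP q 1; first by rewrite PW.
  have mA := S_measurable SA.
  apply: (@le_trans _ _ (fine (P x A))).
    rewrite fine_le ?fin_num_measure //; first exact: measurableI.
    by apply: le_measure; rewrite ?inE //; exact: measurableI.
  by rewrite ler_peMr ?(ltW q1) // fine_ge0.
suff approx (N : nat) : (0 < N)%N -> `|fine (P x [set w | V w <= D w]) - \int[P x]_w D w| <= N%:R^-1.
  have : fine (P x [set w | V w <= D w]) - \int[P x]_w D w = 0.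
    apply/eqP; rewrite -normr_le0; apply/ler_addgt0Pr => e e0.
    have [N _ hN] := near_infty_natSinv_lt (PosNum e0).
    by rewrite add0r; apply: le_trans (approx N.+1 _) (ltW (hN N (leqnn N))).
  move=> /eqP; rewrite subr_eq0 => /eqP <-.
  by rewrite fineK // fin_num_measure.
move=> N0.
have Nr : (0 : R) < N%:R by rewrite ltr0n.
pose A (j : nat) := [set w | j%:R / N%:R <= D w] `\` [set w | j.+1%:R / N%:R <= D w].
have SA j : S (A j).
  have SD y : <<s S >> [set w | y <= D w].
    by apply: sub_sigma_algebra; exact: (discount_event hr).
  rewrite -[S](sigma_algebra_id S_sigma).
  by rewrite /A; apply: (@measurableD _ (g_sigma_algebraType S)); exact: SD.
have mA j : measurable (A j) by exact: S_measurable.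
have indexN w : exists J : nat, [/\ (J <= N)%N, J%:R / N%:R <= D w, D w < J.+1%:R / N%:R &
    forall c : nat -> R, \sum_(j < N.+1) \1_(A j) w * c j = c J].
  have ex : exists j : nat, D w < j.+1%:R / N%:R.
    by exists N; apply: le_lt_trans (D1 w) _; rewrite ltr_pdivlMr // mul1r ltr_nat.
  case: (ex_minnP ex) => J DJ minJ.
  have JN : (J <= N)%N.
    by apply: minJ; apply: le_lt_trans (D1 w) _; rewrite ltr_pdivlMr // mul1r ltr_nat.
  have JD : J%:R / N%:R <= D w.
    case: J DJ minJ JN => [|J] DJ minJ JN; first by rewrite mul0r.
    by rewrite leNgt; apply/negP => /minJ; rewrite ltnn.
  exists J; split => // c.
  have JN' : (J < N.+1)%N by rewrite ltnS.
  rewrite (bigD1 (Ordinal JN')) //= big1 ?addr0.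
    by rewrite indicE mem_set ?mul1r // /A; split => //=; apply/negP; rewrite -ltNge.
  move=> j /eqP jJ; rewrite indicE memNset ?mul0r // => -[/= j1 /negP]; rewrite -ltNge => j2.
  apply: jJ; apply/val_inj => /=; apply/eqP; rewrite eqn_leq; apply/andP; split.
    rewrite -ltnS -(ltr_nat R) -(ltr_pM2r (x := N%:R^-1)) ?invr_gt0 //.
    exact: le_lt_trans j1 DJ.
  rewrite -ltnS -(ltr_nat R) -(ltr_pM2r (x := N%:R^-1)) ?invr_gt0 //.
  exact: le_lt_trans JD j2.
have ind01 (B : set Omega) w : `|\1_B w : R| <= 1.
  by rewrite indicE; case: (_ \in _); rewrite ?normr1 ?normr0.
have Esum (c : nat -> R) : \int[P x]_w (\sum_(j < N.+1) \1_(A j) w * c j) =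
    \sum_(j < N.+1) fine (P x (A j)) * c j.
  rewrite (@expectation_sum _ _ _ (P x) N.+1 (fun j w => \1_(A j) w * c j) (fun j => `|c j|)).
  - apply: eq_bigr => j _; rewrite RintegralZr //; last first.
      by apply: (@bounded_integrable _ _ _ _ _ 1) => //; exact: measurable_indic.
    by rewrite expectation_indic.
  - by move=> j; apply: measurable_funM; [exact: measurable_indic|exact: measurable_cst].
  - by move=> j w; rewrite normrM -[leRHS]mul1r ler_wpM2r.
have Esum2 (q : nat -> R) : \int[P x]_w (\sum_(j < N.+1) \1_(A j `&` W (q j)) w) =
    \sum_(j < N.+1) fine (P x (A j `&` W (q j))).
  rewrite (@expectation_sum _ _ _ (P x) N.+1 (fun j w => \1_(A j `&` W (q j)) w) (fun=> 1)) //.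
  - by apply: eq_bigr => j _; rewrite expectation_indic //; exact: measurableI.
  - by move=> j; apply: measurable_indic; exact: measurableI.
have sumN (c : nat -> R) M w : (forall j, `|c j| <= M) -> `|\sum_(j < N.+1) \1_(A j) w * c j| <= M.
  by move=> cM; have [J [_ _ _ ->]] := indexN w.
have msum (B : nat -> set Omega) : (forall j, measurable (B j)) ->
    measurable_fun setT (fun w => \sum_(j < N.+1) \1_(B j) w : R).
  by move=> mB; apply: measurable_sum => j; exact: measurable_indic.
have isum (B : nat -> set Omega) : (forall j, measurable (B j)) ->
    (P x).-integrable setT (EFin \o (fun w => \sum_(j < N.+1) \1_(B j) w : R)).
  move=> mB; apply: (@bounded_integrable _ _ _ _ _ (\sum_(j < N.+1) 1)); first exact: msum.
  by move=> w; apply: le_trans (ler_norm_sum _ _ _) _; apply: ler_sum.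
have iE : (P x).-integrable setT (EFin \o (\1_[set w | V w <= D w] : Omega -> R)).
  by apply: (@bounded_integrable _ _ _ _ _ 1) => //; exact: measurable_indic.
have iD : (P x).-integrable setT (EFin \o D).
  by apply: (@bounded_integrable _ _ _ _ _ 1) => // w; rewrite ger0_norm.
have split_ind (q : nat -> R) w j : (\1_(A j `&` W (q j)) w : R) = \1_(A j) w * \1_(W (q j)) w.
  by rewrite indicI.
have step (J : nat) : J.+1%:R / N%:R = J%:R / N%:R + N%:R^-1 :> R.
  by rewrite -natr1 mulrDl mul1r.
have low : \sum_(j < N.+1) fine (P x (A j `&` W (j%:R / N%:R))) <= fine (P x [set w | V w <= D w]).
  rewrite -expectation_indic // -(Esum2 (fun j => j%:R / N%:R)).
  apply: le_Rintegral => //.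
    by apply: (isum (fun j => A j `&` W (j%:R / N%:R))) => j; exact: measurableI.
  move=> w _; have [J [_ JD _ hJ]] := indexN w.
  under eq_bigr do rewrite (split_ind (fun j => j%:R / N%:R)).
  rewrite (hJ (fun j => \1_(W (j%:R / N%:R)) w)).
  rewrite !indicE; case: (boolP (w \in W _)) => [/set_mem wW|_]; last exact: ler0n.
  by rewrite mem_set //= (le_trans (ltW wW)).
have upp : fine (P x [set w | V w <= D w]) <= \sum_(j < N.+1) fine (P x (A j `&` W (j.+1%:R / N%:R))).
  rewrite -expectation_indic // -(Esum2 (fun j => j.+1%:R / N%:R)).
  apply: le_Rintegral => //.
    by apply: (isum (fun j => A j `&` W (j.+1%:R / N%:R))) => j; exact: measurableI.
  move=> w _; have [J [_ _ JD hJ]] := indexN w.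
  under eq_bigr do rewrite (split_ind (fun j => j.+1%:R / N%:R)).
  rewrite (hJ (fun j => \1_(W (j.+1%:R / N%:R)) w)).
  rewrite !indicE; case: (boolP (w \in [set w | _])) => [/set_mem /= wE|_]; last exact: ler0n.
  by rewrite mem_set // /W /=; exact: le_lt_trans wE JD.
have lowE : \sum_(j < N.+1) fine (P x (A j `&` W (j%:R / N%:R))) =
    \int[P x]_w (\sum_(j < N.+1) \1_(A j) w * (j%:R / N%:R)).
  rewrite (Esum (fun j => j%:R / N%:R)); apply: eq_bigr => j _; rewrite PW //.
  by rewrite ler_pdivrMr // mul1r ler_nat -ltnS.
have uppE : \sum_(j < N.+1) fine (P x (A j `&` W (j.+1%:R / N%:R))) <=
    \int[P x]_w (\sum_(j < N.+1) \1_(A j) w * (j.+1%:R / N%:R)).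
  by rewrite (Esum (fun j => j.+1%:R / N%:R)); apply: ler_sum => j _; apply: PWle.
have iA (c : nat -> R) : (P x).-integrable setT (EFin \o (fun w => \sum_(j < N.+1) \1_(A j) w * c j)).
  apply: (@bounded_integrable _ _ _ _ _ (\sum_(j < N.+1) `|c j|)).
    by apply: measurable_sum => j; apply: measurable_funM; [exact: measurable_indic|exact: measurable_cst].
  move=> w; apply: le_trans (ler_norm_sum _ _ _) _; apply: ler_sum => j _.
  by rewrite normrM -[leRHS]mul1r ler_wpM2r.
have icst (c : R) := @finite_measure_integrable_cst _ _ _ (P x) setT c measurableT.
have E1 : \int[P x]_w D w - N%:R^-1 <= \int[P x]_w (\sum_(j < N.+1) \1_(A j) w * (j%:R / N%:R)).
  rewrite -[X in _ - X](expectation_cst (P x)) -RintegralB //; last exact: icst.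
  apply: le_Rintegral => //; [exact: (@integrableB _ _ _ (P x) setT measurableT _ _ iD (icst _))|exact: (iA (fun j => j%:R / N%:R))|].
  move=> w _; have [J [_ _ JD hJ]] := indexN w; rewrite (hJ (fun j => j%:R / N%:R)).
  by rewrite lerBlDr -step ltW.
have E2 : \int[P x]_w (\sum_(j < N.+1) \1_(A j) w * (j.+1%:R / N%:R)) <= \int[P x]_w D w + N%:R^-1.
  rewrite -[X in _ + X](expectation_cst (P x)) -RintegralD //; last exact: icst.
  apply: le_Rintegral => //; [exact: (iA (fun j => j.+1%:R / N%:R))|exact: (@integrableD _ _ _ (P x) setT measurableT _ _ iD (icst _))|].
  move=> w _; have [J [_ JD _ hJ]] := indexN w; rewrite (hJ (fun j => j.+1%:R / N%:R)).
  by rewrite step lerD2r.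
rewrite ler_norml; apply/andP; split; lra.
Qed.

Lemma running_sup_gtP z t w : (z%:E < running_sup X t w)%E <->
  exists s v, [/\ 0 <= s, s <= t, X s w = Some v & z < v].
Proof.
split.
  by move=> /ereal_sup_gt [_ [v [s [s0 st Xs]] <-]]; rewrite lte_fin => zv; exists s, v.
move=> [s [v [s0 st Xs zv]]]; apply: (@lt_le_trans _ _ v%:E); first by rewrite lte_fin.
by apply: ereal_sup_ubound; exists v => //; exists s.
Qed.

(** A value above [z] taken at a positive time is also exceeded at a rational time slightly before
    it, hence still before [T]; time [0] is rational already. *)
Lemma running_sup_gt_measurable z : measurable [set w | (z%:E < running_sup X (T w) w)%E].
Proof.
pose A (q : rat) : set Omega := if 0 <= (ratr q : R) then
  T @^-1` `[ratr q, +oo[ `&` state_in X (ratr q) `]z, +oo[ else set0.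
rewrite (_ : [set w | _] = \bigcup_q A q).
  apply: bigcupT_measurable_rat => q; rewrite /A; case: ifP => // q0.
  apply: measurableI; first exact: mTpre.
  by apply: (state_in_measurable hX) => //; exact: measurable_itv.
apply/seteqP; split => w /=.
  move=> /running_sup_gtP [s [v [s0 sT Xs zv]]].
  move: (s0); rewrite le_eqVlt => /orP[/eqP s00|spos].
    exists 0 => //; rewrite /A rmorph0 lexx; split.
      by rewrite /= in_itv /= andbT s00.
    by apply/state_in_SomeP; exists v; rewrite ?s00 //= in_itv /= zv.
  have vz0 : 0 < v - z by rewrite subr_gt0.
  have /nbhs_ballR [e e0 h] := dif_continuous hX s0 Xs vz0.
  have [|q] := @rat_in_itvoo R (Num.max 0 (s - e)) s; first by rewrite gt_max spos /=; lra.
  rewrite in_itv /= gt_max => /andP[/andP[q0 qe] qs].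
  exists q => //; rewrite /A (ltW q0); split.
    by rewrite /= in_itv /= andbT (le_trans (ltW qs)).
  have [||v' Xq vv'] := h (ratr q) => //; [|exact: ltW|].
    by rewrite ltr0_norm ?subr_lt0 //; lra.
  apply/state_in_SomeP; exists v' => //=; rewrite in_itv /= andbT.
  by move: vv'; rewrite ltr_norml => /andP[]; lra.
move=> [q _]; rewrite /A; case: ifP => // q0 [].
rewrite /= in_itv /= andbT => qT /state_in_SomeP [v Xq].
rewrite /= in_itv /= andbT => zv; apply/running_sup_gtP.
by exists (ratr q), v.
Qed.

(** The event lies inside [{tau_z <= T}] and contains [{tau_y <= T}] for every [y > z]; letting [y]
    decrease to [z], continuity of [psi] closes the gap. *)
Lemma running_sup_law x z : I x -> I z -> x <= z ->
  P x [set w | (z%:E < running_sup X (T w) w)%E] = (psi x / psi z)%:E.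
Proof.
move=> Ix Iz xz; have [psi0 psi_incr psiC _ _] := hpsi.
have hit y : I y -> x <= y ->
    measurable [set w | (hitting_time X y w <= (T w)%:E)%E] /\
    P x [set w | (hitting_time X y w <= (T w)%:E)%E] = (psi x / psi y)%:E.
  move=> Iy xy; rewrite -(hitting_expectation hX hmu hsigma hr hpsi Ix Iy xy).
  apply: probability_le_exponential_time => //; first by move=> w; exact: hitting_time_ge0.
  move=> t t0; apply: (hitting_time_le_event hX) => // u A u0 _ mA.
  by apply: sub_sigma_algebra; exists u, A.
have mM := running_sup_gt_measurable z.
set p := P x _; have pfin : p \is a fin_num by exact: fin_num_measure.
rewrite -(fineK pfin); congr EFin; apply/eqP; rewrite eq_le; apply/andP; split.
  have [mz Pz] := hit z Iz xz.
  rewrite -lee_fin fineK // -Pz; apply: le_measure; rewrite ?inE //.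
  move=> w /= /running_sup_gtP [s [v [s0 sT Xs zv]]].
  apply: (@le_trans _ _ s%:E); last by rewrite lee_fin.
  by apply: hitting_time_le => //; exists v => //; exact: ltW.
have cz : psi x / psi y @[y --> z^'+] --> psi x / psi z.
  apply: cvgM; first exact: cvg_cst.
  apply: cvgV; first by rewrite gt_eqF // psi0.
  by apply: cvg_at_right_filter; exact: C2_at_continuous (psiC z Iz).
apply: (cvg_le_bound cz); near=> y.
have zy : z < y by near: y; exact: nbhs_right_gt.
have Iy : I y by near: y; apply: cvg_within; exact: state_space_near.
have [my Py] := hit y Iy (le_trans xz (ltW zy)).
rewrite -lee_fin -Py fineK //; apply: le_measure; rewrite ?inE //.
move=> w /=; case E : (hitting_time X y w) => [s| |]; rewrite ?lee_fin ?leye_eq //; last first.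
  by have := hitting_time_ge0 X y w; rewrite E.
move=> sT; have [s0 [v Xs yv] _] := hitting_time_attained hX E.
by apply/running_sup_gtP; exists s, v; split => //; exact: lt_le_trans yv.
Unshelve. all: by end_near.
Qed.

End ExponentialTime.

(** * A Stieltjes increment lemma *)

Section StieltjesIncrement.
Context {R : realType}.
Implicit Types (f g k : R -> R) (E : set R).

Lemma eq_increment_piecewise (f g df : R -> R) E (al be : R) : al <= be -> finite_set E ->
  (forall z, al <= z <= be -> {for z, continuous g}) ->
  (forall z, al <= z -> z < be -> f x @[x --> z^'+] --> f z) ->
  (forall z, al < z -> z <= be -> f x @[x --> z^'-] --> f z) ->
  (forall z, al < z < be -> ~ E z -> is_derive z 1 f (df z) /\ is_derive z 1 g (df z)) ->
  f be - f al = g be - g al.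
Proof.
move=> ab fE cg rf lf dfg.
have key (e : R) : e * (f al - g al) <= e * (f be - g be).
  apply: (@nondecreasing_piecewise R (fun z => e * (f z - g z)) E) => //.
  - move=> z zab Ez; have [d1 d2] := dfg z zab Ez.
    have dd : is_derive z 1 (fun z => e * (f z - g z)) (e * (df z - df z)).
      by apply: is_deriveZ.
    split; first exact: ex_derive.
    by rewrite (derive1_is_derive dd) subrr mulr0.
  - move=> z az zb; apply: cvgM; first exact: cvg_cst.
    by apply: cvgB; [exact: rf|apply: cvg_at_right_filter; apply: cg; rewrite az ltW].
  - move=> z az zb; exists (e * (f z - g z)) => //; apply: cvgM; first exact: cvg_cst.
    by apply: cvgB; [exact: lf|apply: cvg_at_left_filter; apply: cg; rewrite zb ltW].
by have := key 1; have := key (- 1); lra.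
Qed.

Variables (F phi K dK G : R -> R) (E : set R) (m d C : R).
Hypothesis md : m <= d.
Hypothesis fE : finite_set E.
Hypothesis Fbounds : forall u v lo hi, m <= u -> u <= v -> v <= d ->
  (forall z, u <= z <= v -> lo <= phi z <= hi) ->
  lo * (K v - K u) <= F v - F u <= hi * (K v - K u).
Hypothesis Kmono : forall u v, m <= u -> u <= v -> v <= d -> K u <= K v.
Hypothesis dKP : forall z, m <= z <= d -> is_derive z 1 K (dK z).
Hypothesis phiC : forall z, m <= z <= d -> `|phi z| <= C.
Hypothesis cphi : forall z, m < z < d -> ~ E z -> {for z, continuous phi}.

Let Fdist u v : m <= u <= d -> m <= v <= d -> `|F v - F u| <= C * `|K v - K u|.
Proof.
wlog uv : u v / u <= v.
  move=> wl hu hv; have [uv|vu] := orP (le_total u v); first exact: wl.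
  by rewrite distrC (distrC (K v)); exact: wl.
move=> /andP[mu ud] /andP[mv vd].
have KuV := Kmono mu uv vd.
rewrite (ger0_norm (_ : 0 <= K v - K u)) ?subr_ge0 // ler_norml -mulNr.
apply: Fbounds => // z /andP[uz zv]; rewrite -ler_norml; apply: phiC.
by rewrite (le_trans mu uz) (le_trans zv vd).
Qed.

Let Kcont z : m <= z <= d -> {for z, continuous K}.
Proof. by move=> zd; exact: is_derive_continuous (dKP zd). Qed.

Let C0 : 0 <= C.
Proof. by apply: le_trans (phiC (_ : m <= m <= d)); rewrite ?normr_ge0 // lexx. Qed.

Let Fcont (T : set_system R) (FT : Filter T) z : m <= z <= d -> (K x @[x --> T] --> K z) ->
  (\forall x \near T, m <= x <= d) -> F x @[x --> T] --> F z.
Proof.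
move=> zd cK nT; apply/cvgrPdist_le => e e0.
have C1 : 0 < C + 1 by rewrite ltr_wpDl.
have := cK; move=> /cvgrPdist_le /(_ (e / (C + 1)) (divr_gt0 e0 C1)) => cK'.
near=> x.
have xd : m <= x <= d by near: x.
apply: le_trans (Fdist xd zd) _.
have : `|K z - K x| <= e / (C + 1) by near: x.
move=> h; apply: (@le_trans _ _ ((C + 1) * (e / (C + 1)))).
  by apply: ler_pM => //; rewrite lerDl.
by rewrite mulrC divfK // gt_eqF.
Unshelve. all: by end_near.
Qed.

(** The ratio of the increments of [F] and [K] is squeezed between bounds of [phi] near [z], hence
    tends to [phi z]; multiplying by the difference quotient of [K] gives the derivative. *)
Let Fderive z : m < z < d -> ~ E z -> is_derive z 1 F (phi z * dK z).
Proof.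
move=> /andP[mz zd] Ez.
have zd' : m <= z <= d by rewrite !ltW.
(* Where [K v = K z] the ratio makes no sense, but the bounds force [F v = F z] too, so any value
   works and [0] keeps [eps] small. *)
pose eps v := if K v == K z then 0 else (F v - F z) / (K v - K z) - phi z.
have epsE v : m <= v <= d -> F v - F z = (phi z + eps v) * (K v - K z).
  move=> vd; rewrite /eps; case: eqP => [e|/eqP ne].
    rewrite e subrr mulr0; apply/eqP; rewrite -normr_le0.
    by apply: le_trans (Fdist zd' vd) _; rewrite e subrr normr0 mulr0.
  by rewrite (addrC (phi z)) subrK divfK // subr_eq0.
have nearz : \forall v \near z, m <= v <= d.
  by near=> v; apply/andP; split; apply: ltW; near: v; [exact: lt_nbhsr|exact: lt_nbhsl].
have ceps : eps v @[v --> z] --> 0.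
  apply/cvgrPdist_le => e e0.
  have zin : m < z < d by rewrite mz.
  have := cphi zin Ez; move=> /cvgrPdist_le /(_ e e0) /nbhs_ballR [d0 d00 h].
  near=> v.
  have vd : m <= v <= d by near: v.
  have vz : `|v - z| < d0.
    by near: v; apply/nbhs_ballP; exists d0 => //= v; rewrite /ball /= distrC.
  rewrite sub0r normrN /eps; case: eqP => [_|/eqP ne]; first by rewrite normr0 ltW.
  have bd t : `|t - z| < d0 -> phi z - e <= phi t <= phi z + e.
    by move=> /h; rewrite ler_norml => /andP[? ?]; apply/andP; split; lra.
  have /andP[mv vd'] := vd.
  have [zv|vz'] := leP z v.
    have /andP[h1 h2] : (phi z - e) * (K v - K z) <= F v - F z <= (phi z + e) * (K v - K z).
      apply: Fbounds => //; first exact: ltW.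
      move=> t /andP[zt tv]; apply: bd; apply: le_lt_trans vz.
      by rewrite !ger0_norm ?subr_ge0 // lerD2r.
    have Kp : 0 < K v - K z by rewrite lt_def subr_eq0 ne subr_ge0 Kmono // ltW.
    rewrite ler_norml lerBrDl ler_pdivlMr // lerBlDl ler_pdivrMr //.
    by rewrite h1.
  have /andP[h1 h2] : (phi z - e) * (K z - K v) <= F z - F v <= (phi z + e) * (K z - K v).
    apply: Fbounds => //; [exact: ltW|exact: ltW|].
    move=> t /andP[vt tz]; apply: bd; apply: le_lt_trans vz.
    by rewrite !ler0_norm ?subr_le0 ?(ltW vz') // !opprB lerD2l lerN2.
  have Kp : 0 < K z - K v by rewrite lt_def subr_eq0 eq_sym ne subr_ge0 Kmono // ltW.
  rewrite -(opprB (F z)) -(opprB (K z)) invrN mulrNN.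
  rewrite ler_norml lerBrDl ler_pdivlMr // lerBlDl ler_pdivrMr //.
  by rewrite h1.
have dK' : h^-1 *: (K (h *: 1 + z) - K z) @[h --> (0 : R)^'] --> dK z.
  by have [dk <-] := dKP zd'; exact: dk.
have shift0 : (h *: 1 + z : R) @[h --> (0 : R)^'] --> z.
  have : (h * 1 + z : R) @[h --> (0 : R)] --> (0 * 1 + z : R).
    by apply: cvgD; [apply: cvgM; [exact: cvg_id|exact: cvg_cst]|exact: cvg_cst].
  by rewrite mul0r add0r => c; apply: cvg_within_filter; exact: c.
have ceps0 : eps (h *: 1 + z) @[h --> (0 : R)^'] --> 0 by exact: cvg_comp shift0 ceps.
have lim : h^-1 *: (F (h *: 1 + z) - F z) @[h --> (0 : R)^'] --> phi z * dK z.
  have c1 : (phi z + eps (h *: 1 + z)) * (h^-1 *: (K (h *: 1 + z) - K z)) @[h --> (0 : R)^'] --> (phi z + 0) * dK z.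
    by apply: cvgM => //; apply: cvgD => //; exact: cvg_cst.
  rewrite addr0 in c1; apply: cvg_trans c1; apply: near_eq_cvg.
  have nh : \forall h \near (0 : R)^', m <= h *: 1 + z <= d by exact: shift0 nearz.
  near=> h.
  have vd : m <= h *: 1 + z <= d by near: h.
  by rewrite (epsE _ vd) /GRing.scale /=; ring.
split; first by apply/cvg_ex; exists (phi z * dK z).
exact: cvg_lim lim.
Unshelve. all: by end_near.
Qed.

(** [F] plays the integral of [phi] against [dK], known only through its bounds on subintervals.
    Instances: [K] the identity for the Lebesgue integral, and [K = - psi x / psi] for the law of
    the running supremum. *)
Lemma stieltjes_increment : 
  (forall z, m <= z <= d -> {for z, continuous G}) ->
  (forall z, m < z < d -> ~ E z -> is_derive z 1 G (phi z * dK z)) ->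
  F d - F m = G d - G m.
Proof.
move=> cG dG.
apply: (@eq_increment_piecewise F G (fun z => phi z * dK z) E) => //.
- move=> z mz zd; have zd' : m <= z <= d by rewrite mz ltW.
  apply: Fcont => //; first by apply: cvg_at_right_filter; exact: Kcont.
  near=> x; apply/andP; split; [|by near: x; exact: nbhs_right_le].
  by apply: le_trans mz _; near: x; exact: nbhs_right_ge.
- move=> z mz zd; have zd' : m <= z <= d by rewrite zd ltW.
  apply: Fcont => //; first by apply: cvg_at_left_filter; exact: Kcont.
  near=> x; apply/andP; split; [by near: x; exact: nbhs_left_ge|].
  by apply: le_trans zd; near: x; exact: nbhs_left_le.
- by move=> z zd Ez; split; [exact: Fderive|exact: dG].
Unshelve. all: by end_near.
Qed.

End StieltjesIncrement.

(** * The threshold function *)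

Section Threshold.
Context {R : realType}.
Variables (a b : \bar R) (mu sigma : R -> R) (r : R) (psi : R -> R).
Local Notation I := (state_space a b).
Hypothesis hr : 0 < r.
Hypothesis psi_gt0 : forall x, I x -> 0 < psi x.
Hypothesis psi_incr : forall x z, I x -> I z -> x < z -> psi x < psi z.
Hypothesis psiC : forall x, I x -> C2_at psi x.
Hypothesis psiG : forall x, I x -> generator_r mu sigma r psi x = 0.
Implicit Types (x z : R).

(** Monotonicity gives a nonnegative derivative. A zero would be a minimum of the derivative, so the
    second derivative would vanish there as well, and the equation would leave [r * psi z = 0]. *)
Lemma psi_derive_gt0 z : I z -> 0 < derive1 psi z.
Proof.
move=> Iz; have [c1 Ic1 c1z] := state_space_lower Iz.
have [c2 Ic2 zc2] := state_space_upper Iz.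
have Ic t : t \in `]c1, c2[ -> I t.
  rewrite in_itv /= => /andP[h1 h2].
  by apply: state_space_segment Ic1 Ic2 _; rewrite !ltW.
have zin : z \in `]c1, c2[ by rewrite in_itv /= c1z.
have psi1 y : y \in `]c1, c2[ -> 0 <= derive1 psi y.
  apply: (@incr_derive1_ge0_itv R psi false true).
    by move=> t; rewrite inE /= => tin; exact: C2_at_derivable (psiC (Ic _ tin)).
  by move=> t1 t2 h1 h2 t12; apply: psi_incr => //; apply: Ic.
rewrite lt_def psi1 // andbT; apply/eqP => e0.
have d0 : is_derive z 1 (derive1 psi) 0.
  apply: (@derive1_at_min R (derive1 psi) c1 c2) => //.
  - by rewrite ltW // (lt_trans c1z).
  - by move=> t tin; exact: C2_at_derivable2 (psiC (Ic _ tin)).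
  - by move=> t tin; rewrite e0; exact: psi1.
have := psiG Iz; rewrite /generator_r /generator (derive1_is_derive d0) e0.
have := mulr_gt0 hr (psi_gt0 Iz); lra.
Qed.

Variables (g : R -> R) (Pts : set R) (ystar : R).
Hypothesis hg : piecewise_C2 I Pts g.
Hypothesis Iy : I ystar.
Hypothesis hargmax : forall x, I x -> g x / psi x <= g ystar / psi ystar.
Hypothesis hii : forall x, I x -> ystar <= x -> ~ Pts x -> generator_r mu sigma r g x <= 0.
Hypothesis hiii : forall x, I x -> ystar <= x -> Pts x -> right_derive g x <= left_derive g x.

Let c := g ystar / psi ystar.
Local Notation h := (V_threshold_explicit g psi ystar).

Lemma threshold_near_left x : x < ystar -> {near x, (fun z => c * psi z) =1 h}.
Proof.
move=> xy; near=> z; have zy : z < ystar by near: z; exact: lt_nbhsl.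
by rewrite /V_threshold_explicit zy mulrC.
Unshelve. all: by end_near.
Qed.

Lemma threshold_near_right x : ystar < x -> {near x, g =1 h}.
Proof.
move=> yx; near=> z; have yz : ystar < z by near: z; exact: lt_nbhsr.
by rewrite /V_threshold_explicit ltNge (ltW yz).
Unshelve. all: by end_near.
Qed.

Lemma threshold_right x : ystar <= x -> h x = g x.
Proof. by move=> yx; rewrite /V_threshold_explicit ltNge yx. Qed.

Lemma threshold_left x : x <= ystar -> h x = c * psi x.
Proof.
move=> xy; rewrite /V_threshold_explicit; case: ltP => [_|yx]; first by rewrite mulrC.
have -> : x = ystar by apply/eqP; rewrite eq_le xy.
by rewrite /c divfK // gt_eqF // psi_gt0.
Qed.

Lemma le_threshold x : I x -> g x <= h x.
Proof.
move=> Ix; have [xy|yx] := leP x ystar; last by rewrite threshold_right // ltW.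
by rewrite threshold_left // -ler_pdivrMr ?psi_gt0 //; exact: hargmax.
Qed.

Lemma threshold_continuous z : I z -> {for z, continuous h}.
Proof.
move=> Iz; have [_ _ cg _ _] := hg.
(* Pasting with minimum and maximum makes continuity at [ystar] a matter of composition. *)
pose q t := c * psi (Num.min t ystar) + g (Num.max t ystar) - g ystar.
have hq : h = q.
  apply/funext => t; rewrite /q; have [ty|yt] := leP t ystar.
    by rewrite threshold_left //; lra.
  rewrite threshold_right ?ltW // /c divfK; last by rewrite gt_eqF // psi_gt0.
  lra.
rewrite hq.
have k0 : {for z, continuous (cst ystar : R -> R)} by exact: cvg_cst.
have k1 : {for z, continuous (id : R -> R)} by exact: cvg_id.
have Imin : I (Num.min z ystar) by rewrite minEle; case: ifP.
have Imax : I (Num.max z ystar) by rewrite maxEle; case: ifP.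
apply: cvgB; last exact: cvg_cst.
apply: cvgD.
  apply: cvgM; first exact: cvg_cst.
  exact: (continuous_comp (continuous_min k1 k0) (C2_at_continuous (psiC Imin))).
exact: (continuous_comp (continuous_max k1 k0) (cg _ Imax)).
Qed.

Lemma C2_at_sides f z : C2_at f z -> [/\ derive1 f x @[x --> z^'-] --> derive1 f z,
  derive1 f x @[x --> z^'+] --> derive1 f z, cvg (derive1 (derive1 f) @ z^'-) &
  cvg (derive1 (derive1 f) @ z^'+)].
Proof.
move=> fC; have c1 := C2_at_continuous1 fC; have [_ _ c2] := fC.
split; [exact: cvg_at_left_filter c1|exact: cvg_at_right_filter c1| |];
  apply/cvg_ex; exists (derive1 (derive1 f) z);
  [exact: cvg_at_left_filter c2|exact: cvg_at_right_filter c2].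
Qed.

Lemma piecewise_C2_sides z : I z -> [/\ cvg (derive1 g @ z^'-), cvg (derive1 g @ z^'+),
  cvg (derive1 (derive1 g) @ z^'-) & cvg (derive1 (derive1 g) @ z^'+)].
Proof.
move=> Iz; have [_ _ _ gC gP] := hg; have [Pz|Pz] := pselect (Pts z).
  by have [] := gP z Pz.
have [h1 h2 h3 h4] := C2_at_sides (gC z (conj Iz Pz)).
split; [apply/cvg_ex|apply/cvg_ex|exact: h3|exact: h4]; exists (derive1 g z);
  [exact: h1|exact: h2].
Qed.

Lemma piecewise_C2_dnbhs z : I z -> \forall x \near z^', derivable g x 1.
Proof.
move=> Iz; have [fP _ _ gC _] := hg; near=> x.
apply/C2_at_derivable/gC; split.
  by near: x; apply: nbhs_dnbhs; exact: state_space_near.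
by near: x; exact: finite_set_dnbhs.
Unshelve. all: by end_near.
Qed.

Lemma dnbhs_at_right z (A : set R) : z^' A -> z^'+ A.
Proof. by rewrite /at_right /at_left /dnbhs /within /=; apply: filterS => x /= hx zx; apply: hx; rewrite gt_eqF. Qed.

Lemma dnbhs_at_left z (A : set R) : z^' A -> z^'- A.
Proof. by rewrite /at_right /at_left /dnbhs /within /=; apply: filterS => x /= hx zx; apply: hx; rewrite lt_eqF. Qed.

Lemma near_eq_cvg_to (T : set_system R) (FT : Filter T) (f k : R -> R) (l : R) :
  (\forall x \near T, f x = k x) -> f x @[x --> T] --> l -> k x @[x --> T] --> l.
Proof. by move=> fk; apply: cvg_trans; exact: near_eq_cvg. Qed.

Lemma near_eq_is_cvg (T : set_system R) (FT : Filter T) (f k : R -> R) :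
  (\forall x \near T, f x = k x) -> cvg (f @ T) -> cvg (k @ T).
Proof. by move=> fk /cvg_ex [l fl]; apply/cvg_ex; exists l; exact: near_eq_cvg_to fl. Qed.

Lemma threshold_derive_left x : x < ystar ->
  derive1 h x = derive1 (fun z => c * psi z) x /\
  derive1 (derive1 h) x = derive1 (derive1 (fun z => c * psi z)) x.
Proof.
move=> /threshold_near_left nh; have n1 := derive1_near nh.
split; first exact: nbhs_singleton n1.
apply/esym; rewrite !derive1E; apply: near_eq_derive.
by apply: filterS n1 => z ->.
Qed.

Lemma threshold_derive_right x : ystar < x ->
  derive1 h x = derive1 g x /\ derive1 (derive1 h) x = derive1 (derive1 g) x.
Proof.
move=> /threshold_near_right nh; have n1 := derive1_near nh.
split; first exact: nbhs_singleton n1.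
apply/esym; rewrite !derive1E; apply: near_eq_derive.
by apply: filterS n1 => z ->.
Qed.

Lemma right_derive_ystar (l : R) : derive1 g x @[x --> ystar^'+] --> l -> l <= c * derive1 psi ystar.
Proof.
move=> gl; have [_ _ cg _ _] := hg.
have s1 := cvg_right_slope (cg _ Iy) (dnbhs_at_right (piecewise_C2_dnbhs Iy)) gl.
have [psi1 _] := psiC Iy.
have [_ psir _ _] := C2_at_sides (psiC Iy).
have s2 := cvg_right_slope (C2_at_continuous (psiC Iy))
  (dnbhs_at_right (nbhs_dnbhs psi1)) psir.
have s3 : c * (t^-1 * (psi (ystar + t) - psi ystar)) - t^-1 * (g (ystar + t) - g ystar)
    @[t --> (0 : R)^'+] --> c * derive1 psi ystar - l.
  by apply: cvgB s1; apply: cvgM s2; exact: cvg_cst.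
suff : 0 <= c * derive1 psi ystar - l by rewrite subr_ge0.
apply: (cvg_ge_bound s3).
have nI := at_rightR (dnbhs_at_right (nbhs_dnbhs (state_space_near Iy))).
have [e e0 he] := nI.
near=> t; have t0 : 0 < t by near: t; exact: nbhs_right_gt.
have te : t < e by near: t; exact: nbhs_right_lt.
have Iyt : I (ystar + t) by apply: he; lra.
have := hargmax Iyt.
rewrite ler_pdivrMr ?psi_gt0 // => h1.
have gy : g ystar = c * psi ystar by rewrite /c divfK // gt_eqF // psi_gt0.
rewrite [X in 0 <= X](_ : _ = t^-1 * (c * psi (ystar + t) - g (ystar + t))).
  by rewrite mulr_ge0 ?invr_ge0 ?(ltW t0) // subr_ge0.
by rewrite gy; simpl; ring.
Unshelve. all: by end_near.
Qed.

(** Exceptional points of [g] below [ystar] disappear, since [h] is the smooth [c * psi] there;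
    above [ystar] the one-sided limits of [g'] are identified with its one-sided derivatives, so
    that the assumed order of these applies. *)
Lemma threshold_superharmonic :
  piecewise_superharmonic a b mu sigma r h (Pts `|` [set ystar]).
Proof.
have [fP PI cg gC gP] := hg.
have kC z : I z -> C2_at (fun z => c * psi z) z by move=> Iz; have [] := C2_at_scale c (psiC Iz).
split.
- by rewrite finite_setU; split => //; exact: finite_set1.
- exact: threshold_continuous.
- move=> z Iz /not_orP [Pz zy]; have [zy'|yz|//] := ltgtP z ystar.
    have [hC e1 e2] := C2_at_near (threshold_near_left zy') (kC z Iz).
    split; first exact: hC.
    have e0 : generator_r mu sigma r (fun z => c * psi z) z = 0.
      by rewrite (generator_r_scale _ _ _ _ (psiC Iz)) (psiG Iz) mulr0.
    move: e0; rewrite /generator_r /generator e1 e2 (threshold_left (ltW zy')) => ->.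
    exact: lexx.
  have [hC e1 e2] := C2_at_near (threshold_near_right yz) (gC z (conj Iz Pz)).
  split; first exact: hC.
  rewrite /generator_r /generator e1 e2 (threshold_right (ltW yz)).
  exact: hii (ltW yz) Pz.
move=> z Iz _.
have left_psi : z <= ystar -> derive1 h x @[x --> z^'-] --> c * derive1 psi z /\
    cvg (derive1 (derive1 h) @ z^'-).
  move=> zy; have [h1 _ h3 _] := C2_at_sides (kC z Iz).
  have n : \forall x \near z^'-, x < ystar.
    by near=> x; apply: lt_le_trans zy; near: x; exact: nbhs_left_lt.
  have [_ <- _] := C2_at_scale c (psiC Iz).
  split; [apply: near_eq_cvg_to h1|apply: near_eq_is_cvg h3];
    apply: filterS n => x /threshold_derive_left [e1 e2]; first [exact: esym e1|exact: esym e2].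
have right_psi : z < ystar -> derive1 h x @[x --> z^'+] --> c * derive1 psi z /\
    cvg (derive1 (derive1 h) @ z^'+).
  move=> zy; have [_ h2 _ h4] := C2_at_sides (kC z Iz).
  have n : \forall x \near z^'+, x < ystar by exact: nbhs_right_lt.
  have [_ <- _] := C2_at_scale c (psiC Iz).
  split; [apply: near_eq_cvg_to h2|apply: near_eq_is_cvg h4];
    apply: filterS n => x /threshold_derive_left [e1 e2]; first [exact: esym e1|exact: esym e2].
have [c1 c2 c3 c4] := piecewise_C2_sides Iz.
have left_g : ystar < z -> derive1 h x @[x --> z^'-] --> lim (derive1 g @ z^'-) /\
    cvg (derive1 (derive1 h) @ z^'-).
  move=> yz; have n : \forall x \near z^'-, ystar < x by exact: nbhs_left_gt.
  split; [apply: near_eq_cvg_to c1|apply: near_eq_is_cvg c3];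
    apply: filterS n => x /threshold_derive_right [e1 e2]; first [exact: esym e1|exact: esym e2].
have right_g : ystar <= z -> derive1 h x @[x --> z^'+] --> lim (derive1 g @ z^'+) /\
    cvg (derive1 (derive1 h) @ z^'+).
  move=> yz; have n : \forall x \near z^'+, ystar < x.
    by near=> x; apply: le_lt_trans yz _; near: x; exact: nbhs_right_gt.
  split; [apply: near_eq_cvg_to c2|apply: near_eq_is_cvg c4];
    apply: filterS n => x /threshold_derive_right [e1 e2]; first [exact: esym e1|exact: esym e2].
have [zy|yz|zy] := ltgtP z ystar.
- have [h1 d1] := left_psi (ltW zy); have [h2 d2] := right_psi zy.
  split; [exists (c * derive1 psi z), (c * derive1 psi z)|exact: d1|exact: d2].
  by split; [exact: h1|exact: h2|exact: lexx].
- have [h1 d1] := left_g yz; have [h2 d2] := right_g (ltW yz).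
  split; [exists (lim (derive1 g @ z^'-)), (lim (derive1 g @ z^'+))|exact: d1|exact: d2].
  split; [exact: h1|exact: h2|].
  have dz := piecewise_C2_dnbhs Iz.
  rewrite -(right_derive_cvg (cg z Iz) (dnbhs_at_right dz) c2).
  rewrite -(left_derive_cvg (cg z Iz) (dnbhs_at_left dz) c1).
  have [Pz|Pz] := pselect (Pts z); first exact: hiii (ltW yz) Pz.
  rewrite right_derive_derivable; last exact: C2_at_derivable (gC z (conj Iz Pz)).
  have [l1 _ _ _] := C2_at_sides (gC z (conj Iz Pz)).
  by rewrite (left_derive_cvg (cg z Iz) (dnbhs_at_left dz) l1).
- have zy1 : z <= ystar by rewrite zy.
  have zy2 : ystar <= z by rewrite zy.
  have [h1 d1] := left_psi zy1; have [h2 d2] := right_g zy2.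
  split; [exists (c * derive1 psi z), (lim (derive1 g @ z^'+))|exact: d1|exact: d2].
  split; [exact: h1|exact: h2|].
  by rewrite zy in c2 *; exact: right_derive_ystar c2.
Unshelve. all: by end_near.
Qed.

End Threshold.

(** * The Wronskian, regularity of [fhat], and the integral of its density *)

Section ThresholdDensity.
Context {R : realType}.
Variables (a b : \bar R) (mu sigma : R -> R) (r : R) (psi : R -> R).
Local Notation I := (state_space a b).
Local Notation leb := (@lebesgue_measure R).
Hypothesis hmu : forall x, I x -> {for x, continuous mu}.
Hypothesis hsigma : forall x, I x -> {for x, continuous sigma}.
Hypothesis hsigma0 : forall x, I x -> 0 < sigma x.
Hypothesis psi_gt0 : forall x, I x -> 0 < psi x.
Hypothesis psi1_gt0 : forall x, I x -> 0 < derive1 psi x.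
Hypothesis psiC : forall x, I x -> C2_at psi x.
Hypothesis psiG : forall x, I x -> generator_r mu sigma r psi x = 0.
Variables (h : R -> R) (E : set R).
Hypothesis hh : piecewise_superharmonic a b mu sigma r h E.
Implicit Types (x z : R).

Let hfE : finite_set E. Proof. by have [] := hh. Qed.
Let hcont z : I z -> {for z, continuous h}. Proof. by have [_ + _ _] := hh; apply. Qed.
Let hC2 z : I z -> ~ E z -> C2_at h z.
Proof. by move=> Iz Ez; have [_ _ /(_ _ Iz Ez) [] ] := hh. Qed.

Lemma wronskian_ge0 (al be : R) : I al -> I be -> al <= be -> (forall z, I z -> 0 <= psi z) ->
  0 <= h al * derive1 psi al - psi al * right_derive h al ->
  0 <= h be * derive1 psi be - psi be * right_derive h be.
Proof.
move=> Ial Ibe ab _ W0.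
pose clamp z := Num.max al (Num.min z be).
have Iab z : al <= z <= be -> I z by exact: state_space_segment.
have clampI z : al <= clamp z <= be.
  by rewrite /clamp le_max lexx /= ge_max ab ge_min lexx orbT.
have cclamp : continuous clamp.
  move=> z; have k0 : {for z, continuous (cst al : R -> R)} by exact: cvg_cst.
  have k1 : {for z, continuous (cst be : R -> R)} by exact: cvg_cst.
  have k2 : {for z, continuous (id : R -> R)} by exact: cvg_id.
  exact: (continuous_max k0 (continuous_min k2 k1)).
pose kap z := 2 * mu z / sigma z ^+ 2.
have ckap z : I z -> {for z, continuous kap}.
  move=> Iz; apply: cvgM.
    by apply: cvgM; [exact: cvg_cst|exact: hmu].
  apply: cvgV; first by rewrite expf_neq0 // gt_eqF // hsigma0.
  by apply: cvgM; exact: hsigma.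
(* [primitive_exists] wants a function vanishing left of [al], so the constant [kap al] is
   subtracted here and restored by the linear term in [M]. *)
pose k z := kap (clamp z) - kap al.
have ck : continuous k.
  move=> z; apply: cvgB; last exact: cvg_cst.
  exact: (continuous_comp (cclamp z) (ckap _ (Iab _ (clampI z)))).
have k0 z : z <= al -> k z = 0.
  move=> za; rewrite /k /clamp (_ : Num.max al _ = al) ?subrr //.
  by apply/max_idPl; rewrite ge_min za.
have [H _ dH] := primitive_exists ck k0.
pose M z := expR (H z + kap al * z).
have dM z : al <= z <= be -> is_derive z 1 M (M z * kap z).
  move=> zab; have e : clamp z = z.
    move: zab => /andP[az zb]; rewrite /clamp (_ : Num.min z be = z); last by apply/min_idPl.
    exact/max_idPr.
  have d1 : is_derive z 1 (fun z => H z + kap al * z) (k z + kap al * 1).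
    by apply: is_deriveD; apply: is_deriveZ.
  have d2 := @is_derive1_comp _ expR _ z _ _ (is_derive_expR _) d1.
  by apply: is_derive_eq; rewrite /k e mulr1 subrK.
have M0 z : 0 < M z by exact: expR_gt0.
pose W z := h z * derive1 psi z - psi z * right_derive h z.
have cM z : al <= z <= be -> {for z, continuous M} by move=> /dM; exact: is_derive_continuous.
have cvgW (T : set_system R) (FT : Filter T) z (l : R) : al <= z <= be -> T `=>` nbhs z ->
    right_derive h x @[x --> T] --> l ->
    M x * W x @[x --> T] --> M z * (h z * derive1 psi z - psi z * l).
  move=> zab Tz rl; have Iz := Iab _ zab.
  have [c1 c2] := (C2_at_continuous (psiC Iz), C2_at_continuous1 (psiC Iz)).
  apply: cvgM; first by apply: cvg_trans (cM _ zab); exact: cvg_app.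
  apply: cvgB; apply: cvgM.
  - by apply: cvg_trans (hcont Iz); exact: cvg_app.
  - by apply: cvg_trans c2; exact: cvg_app.
  - by apply: cvg_trans c1; exact: cvg_app.
  - exact: rl.
suff : M al * W al <= M be * W be.
  by move=> le; rewrite -(pmulr_rge0 _ (M0 be)); apply: le_trans le; rewrite mulr_ge0 // ltW.
apply: (nondecreasing_piecewise (q := fun z => M z * W z) ab hfE).
- move=> z /andP[az zb] Ez; have zab : al <= z <= be by rewrite !ltW.
  have Iz := Iab _ zab; have hC := hC2 Iz Ez; have pC := psiC Iz.
  have dh := derivable_is_derive1 (C2_at_derivable hC).
  have dh1 := derivable_is_derive1 (C2_at_derivable2 hC).
  have dp := derivable_is_derive1 (C2_at_derivable pC).
  have dp1 := derivable_is_derive1 (C2_at_derivable2 pC).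
  have dMz := dM _ zab.
  pose W1 z := h z * derive1 psi z - psi z * derive1 h z.
  have dMW : is_derive z 1 (fun z => M z * W1 z) (M z *
      (h z * derive1 (derive1 psi) z - psi z * derive1 (derive1 h) z + kap z * W1 z)).
    apply: is_derive_eq; rewrite /GRing.scale /= /W1.
    move: (derive1 (derive1 psi) z) (derive1 (derive1 h) z) (derive1 psi z) (derive1 h z).
    by move: (h z) (psi z) (kap z) (M z) => *; ring.
  have nW : {near z, (fun z => M z * W1 z) =1 (fun z => M z * W z)}.
    by apply: filterS (right_derive_C2 hC) => t e; rewrite /W /W1 e.
  have dd : derivable (fun z => M z * W z) z 1.
    by apply: near_eq_derivable nW _; exact: ex_derive.
  split; first exact: dd.
  rewrite (nbhs_singleton (derive1_near nW)) (derive1_is_derive dMW).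
  apply: mulr_ge0; first exact: ltW.
  have s0 := hsigma0 Iz.
  have [_ _ /(_ _ Iz Ez) [_ hG] _] := hh.
  have pG := psiG Iz.
  rewrite /generator_r /generator in hG pG.
  have s2 : 0 < sigma z ^+ 2 by rewrite exprn_gt0.
  rewrite -(pmulr_rge0 _ s2).
  (* The left side is [sigma ^ 2 / M] times the derivative of [M * W1]. The terms in [r] cancel,
     leaving [2 * (h * G psi - psi * G h)] with [G] the operator [generator_r]; the first product
     vanishes and the second is nonpositive. *)
  have -> : sigma z ^+ 2 * (h z * derive1 (derive1 psi) z - psi z * derive1 (derive1 h) z + kap z * W1 z) =
    2 * (h z * (2^-1 * sigma z ^+ 2 * derive1 (derive1 psi) z + mu z * derive1 psi z - r * psi z)
       - psi z * (2^-1 * sigma z ^+ 2 * derive1 (derive1 h) z + mu z * derive1 h z - r * h z)).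
    rewrite /kap /W1; move: (derive1 (derive1 psi) z) (derive1 (derive1 h) z) s0.
    move: (derive1 psi z) (derive1 h z) (h z) (psi z) (mu z) (sigma z) => *.
    by field; rewrite gt_eqF.
  rewrite pG mulr0 sub0r mulrN oppr_ge0.
  have p0 := psi_gt0 Iz.
  by rewrite pmulr_rle0 // pmulr_rle0.
- move=> z az zb; have zab : al <= z <= be by rewrite az ltW.
  apply: (cvgW _ _ z) => //; last exact: psh_right_derive_right hh _ (Iab _ zab).
  exact: cvg_within.
- move=> z az zb; have zab : al <= z <= be by rewrite zb ltW.
  have [l cl lel] := psh_right_derive_left hh (Iab _ zab).
  exists (M z * (h z * derive1 psi z - psi z * l)).
    by apply: cvgW => //; exact: cvg_within.
  rewrite ler_pM2l // lerD2l lerN2 ler_wpM2l // ltW //.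
  exact: psi_gt0 (Iab _ zab).
Qed.

Lemma fhat_wronskian z : I z ->
  fhat h psi z = (h z * derive1 psi z - psi z * right_derive h z) / derive1 psi z.
Proof. by move=> Iz; rewrite /fhat mulrBl mulfK // gt_eqF // psi1_gt0. Qed.

Lemma continuous_measurable_segment (f : R -> R) (m d : R) :
  (forall z, m <= z <= d -> {for z, continuous f}) -> measurable_fun `[m, d] f.
Proof.
move=> cf; apply: subspace_continuous_measurable_fun => //.
apply: continuous_in_subspaceT => z; rewrite inE /= in_itv /=; exact: cf.
Qed.

(** A pointwise limit of the forward difference quotients, with step [1 / (n + 1)], of a continuous
    extension of [h]. *)
Lemma right_derive_measurable (m d : R) : I m -> I d -> measurable_fun `[m, d] (right_derive h).
Proof.
move=> Im Id.
have [d2 Id2 dd2] := state_space_upper Id.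
have [m2 Im2 mm2] := state_space_lower Im.
(* The extension agrees with [h] strictly beyond [d], so that for small steps the forward quotients
   at points up to [d] are those of [h]. *)
pose c'' := (d + d2) / 2.
have [c1 c2] : d < c'' /\ c'' < d2 by split; rewrite /c''; lra.
have [ht [cht _ hht _]] := cutoff_extension hcont Im2 Id2 mm2 c2.
have key (z : R) : m <= z <= d ->
    n.+1%:R * (ht (z + n.+1%:R^-1) - ht z) @[n --> \oo] --> right_derive h z.
  move=> /andP[mz zd].
  have Iz : I z by apply: state_space_segment Im Id _; rewrite mz.
  have nz : \forall t \near z^', derivable h t 1.
    by apply: filterS (psh_dnbhs_C2 hh Iz) => t; exact: C2_at_derivable.
  have cs := cvg_right_slope (hcont Iz) (dnbhs_at_right nz) (psh_right_derive hh Iz).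
  have cn : n.+1%:R^-1 @[n --> \oo] --> (0 : R)^'+.
    move=> A /at_rightR [e e0 hA].
    have [N _ hN] := near_infty_natSinv_lt (PosNum e0); exists N => // n /= Nn.
    apply: hA; first by rewrite invr_gt0.
    by rewrite add0r; exact: hN.
  have cc := cvg_comp _ _ cn cs.
  apply: cvg_trans cc; apply: near_eq_cvg.
  have e0 : 0 < c'' - d by rewrite subr_gt0.
  have [N _ hN] := near_infty_natSinv_lt (PosNum e0); exists N => // n /= Nn.
  have nn := hN n Nn; rewrite /= in nn.
  have n0 : 0 < n.+1%:R^-1 :> R by rewrite invr_gt0.
  rewrite /= invrK; move: (n.+1%:R^-1) nn n0 => q qd q0.
    have z1 : m <= z <= c'' by apply/andP; split; lra.
    have z2 : m <= z + q <= c'' by apply/andP; split; lra.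
    by rewrite (hht _ z1) (hht _ z2).
apply: (@measurable_fun_cvg _ _ _ `[m, d] (fun n z => n.+1%:R * (ht (z + n.+1%:R^-1) - ht z))).
  move=> n; apply: continuous_measurable_segment => z _.
  apply: cvgM; first exact: cvg_cst.
  apply: cvgB; last exact: cht.
  have ct : {for z, continuous (fun z : R => z + n.+1%:R^-1)}.
    by apply: cvgD; [exact: cvg_id|exact: cvg_cst].
  exact: (continuous_comp ct (cht _)).
by move=> z; rewrite /= in_itv /=; exact: key.
Qed.

Lemma right_derive_bounded (m d : R) : I m -> I d -> m <= d ->
  exists C, forall z, m <= z <= d -> `|right_derive h z| <= C.
Proof.
move=> Im Id md; apply: locally_bounded_segment => // z zd.
by apply: psh_derive_bound hh _ _; exact: state_space_segment zd.
Qed.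

Lemma continuous_bounded_segment (f : R -> R) (m d : R) : m <= d ->
  (forall z, m <= z <= d -> {for z, continuous f}) ->
  exists C, forall z, m <= z <= d -> `|f z| <= C.
Proof.
by move=> md cf; apply: locally_bounded_segment => // z /cf; exact: dnbhs_bound_of_continuous.
Qed.

Lemma right_derive_continuous z : I z -> ~ E z -> {for z, continuous (right_derive h)}.
Proof.
move=> Iz Ez; have hC := hC2 Iz Ez; have c1 := C2_at_continuous1 hC.
have n := right_derive_C2 hC.
suff : right_derive h t @[t --> z] --> right_derive h z by [].
rewrite (nbhs_singleton n); apply: near_eq_cvg_to c1.
by apply: filterS n => t ->.
Qed.

Let coef z := psi z / derive1 psi z.
Let ccoef z : I z -> {for z, continuous coef}.
Proof.
move=> Iz; apply: cvgM; first exact: C2_at_continuous (psiC Iz).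
by apply: cvgV; [rewrite gt_eqF // psi1_gt0|exact: C2_at_continuous1 (psiC Iz)].
Qed.

Lemma fhatE z : fhat h psi z = h z - coef z * right_derive h z.
Proof. by rewrite /fhat /coef mulrAC. Qed.

Lemma fhat_measurable (m d : R) : I m -> I d -> measurable_fun `[m, d] (fhat h psi).
Proof.
move=> Im Id; have Iz z : m <= z <= d -> I z by exact: state_space_segment.
rewrite (_ : fhat h psi = fun z => h z - coef z * right_derive h z); last first.
  by apply/funext => z; exact: fhatE.
apply: measurable_funB.
  by apply: continuous_measurable_segment => z /Iz; exact: hcont.
apply: measurable_funM; last exact: right_derive_measurable.
by apply: continuous_measurable_segment => z /Iz; exact: ccoef.
Qed.

Lemma fhat_bounded (m d : R) : I m -> I d -> m <= d ->
  exists C, forall z, m <= z <= d -> `|fhat h psi z| <= C.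
Proof.
move=> Im Id md; have Iz z : m <= z <= d -> I z by exact: state_space_segment.
have [C1 h1] := continuous_bounded_segment md (fun z zd => hcont (Iz z zd)).
have [C2 h2] := continuous_bounded_segment md (fun z zd => ccoef (Iz z zd)).
have [C3 h3] := right_derive_bounded Im Id md.
exists (C1 + C2 * C3) => z zd; rewrite fhatE.
apply: le_trans (ler_normB _ _) _; rewrite normrM.
by apply: lerD; [exact: h1|apply: ler_pM => //; [exact: h2|exact: h3]].
Qed.

Lemma fhat_continuous z : I z -> ~ E z -> {for z, continuous (fhat h psi)}.
Proof.
move=> Iz Ez; rewrite (_ : fhat h psi = fun z => h z - coef z * right_derive h z); last first.
  by apply/funext => t; exact: fhatE.
apply: cvgB; first exact: hcont.
by apply: cvgM; [exact: ccoef|exact: right_derive_continuous].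
Qed.

Lemma is_derive_ratio z : I z -> ~ E z ->
  is_derive z 1 (fun z => - (h z / psi z)) (J_density h psi z).
Proof.
move=> Iz Ez; have hC := hC2 Iz Ez; have pC := psiC Iz.
have p0 : psi z != 0 by rewrite gt_eqF // psi_gt0.
have p1 : derive1 psi z != 0 by rewrite gt_eqF // psi1_gt0.
have dh := derivable_is_derive1 (C2_at_derivable hC).
have dp := derivable_is_derive1 (C2_at_derivable pC).
have dV := @is_deriveV R psi z _ 1 p0 dp.
have dr : is_derive z 1 (fun z => h z * (psi z)^-1) _ := is_deriveM dh dV.
have dn := is_deriveN dr.
apply: is_derive_eq; rewrite /J_density /fhat right_derive_derivable; last exact: C2_at_derivable hC.
rewrite /GRing.scale /=; move: (derive1 psi z) (derive1 h z) (h z) (psi z) p0 p1 => *; field.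
by apply/andP.
Qed.

Let coef2 z := derive1 psi z / psi z ^+ 2.
Let ccoef2 z : I z -> {for z, continuous coef2}.
Proof.
move=> Iz; have cp := C2_at_continuous (psiC Iz).
apply: cvgM; first exact: C2_at_continuous1 (psiC Iz).
by apply: cvgV; [rewrite expf_neq0 // gt_eqF // psi_gt0|apply: cvgM].
Qed.

Let J_densityE : J_density h psi = fun z => fhat h psi z * coef2 z.
Proof. by apply/funext => z; rewrite /J_density -mulrA. Qed.

(** The density may jump on [E], so the fundamental theorem of calculus is replaced by
    [stieltjes_increment] with [K] the identity; [- (h / psi)] is continuous and has the density as
    its derivative off [E]. *)
Lemma J_density_integral (m d : R) : I m -> I d -> m <= d ->
  \int[leb]_(z in `[m, d]) J_density h psi z = h m / psi m - h d / psi d.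
Proof.
move=> Im Id md; have Iz z : m <= z <= d -> I z by exact: state_space_segment.
have cc2 z : m <= z <= d -> {for z, continuous coef2} by move=> /Iz; exact: ccoef2.
have [C1 h1] := fhat_bounded Im Id md.
have [C2 h2] := continuous_bounded_segment md cc2.
have JC z : m <= z <= d -> `|J_density h psi z| <= C1 * C2.
  by move=> zd; rewrite J_densityE normrM; apply: ler_pM; rewrite ?h1 ?h2.
have mJ : measurable_fun `[m, d] (J_density h psi).
  by rewrite J_densityE; apply: measurable_funM;
    [exact: fhat_measurable|exact: continuous_measurable_segment].
have iJ u v : m <= u -> v <= d -> leb.-integrable `[u, v] (EFin \o J_density h psi).
  move=> mu' vd; have sub : `[u, v] `<=` `[m, d].
    by move=> z; rewrite /= !in_itv /= => /andP[uz zv]; rewrite (le_trans mu' uz) (le_trans zv).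
  apply: measurable_bounded_integrable => //.
  - by rewrite /= lebesgue_measure_itv; case: ifP => _; rewrite ?ltry // -EFinB ltry.
  - exact: measurable_funS sub mJ.
  exists (C1 * C2); split; first exact: num_real.
  move=> M CM z /sub; rewrite /= in_itv /= => zd.
  exact: le_trans (JC z zd) (ltW CM).
have icst u v (c : R) : leb.-integrable `[u, v] (EFin \o cst c).
  by apply: continuous_segment_integrable => x; exact: cvg_cst.
pose F v := \int[leb]_(z in `[m, v]) J_density h psi z.
have Fm : F m = 0 by rewrite /F set_itv1 Rintegral_set1.
have -> : \int[leb]_(z in `[m, d]) J_density h psi z = F d - F m by rewrite Fm subr0.
pose G z := - (h z / psi z).
suff -> : F d - F m = G d - G m by rewrite /G opprK addrC.
apply: (@stieltjes_increment R F (J_density h psi) id (fun=> 1) G E m d (C1 * C2)) => //.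
- move=> u v lo hi mu' uv vd lohi.
  have -> : F v - F u = \int[leb]_(z in `[u, v]) J_density h psi z.
    by rewrite /F (Rintegral_segment_split (iJ m v _ vd) mu' uv) // addrAC subrr add0r.
  rewrite -!(Rintegral_segment_cst _ uv); apply/andP; split; apply: le_Rintegral => //;
    try exact: iJ; try exact: icst.
  - by move=> z; rewrite /= in_itv /= => /lohi /andP[].
  - by move=> z; rewrite /= in_itv /= => /lohi /andP[].
- move=> z /andP[mz zd] Ez; have {}Iz : I z by apply: Iz; rewrite !ltW.
  by rewrite J_densityE; apply: cvgM; [exact: fhat_continuous|exact: ccoef2].
- move=> z zd; have {}Iz := Iz z zd.
  apply: cvgN; apply: cvgM; first exact: hcont.
  by apply: cvgV; [rewrite gt_eqF // psi_gt0|exact: C2_at_continuous (psiC Iz)].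
- move=> z /andP[mz zd] Ez; rewrite mulr1; apply: is_derive_ratio => //.
  by apply: Iz; rewrite !ltW.
Qed.

End ThresholdDensity.

(** * The two representations *)

Section SupremumExpectation.
Context {R : realType} {d : measure_display} {Omega : measurableType d}.
Variables (a b : \bar R) (mu sigma : R -> R) (F : R -> set_system Omega)
  (X : R -> Omega -> option R) (P : R -> probability Omega R).
Hypothesis hX : diffusion a b mu sigma F X P.
Hypothesis hmu : forall x, state_space a b x -> {for x, continuous mu}.
Hypothesis hsigma : forall x, state_space a b x -> {for x, continuous sigma}.
Variables (r : R) (hr : 0 < r) (psi : R -> R) (T : Omega -> R).
Hypothesis hpsi : increasing_solution a b mu sigma r P X psi.
Hypothesis hT : independent_exponential_time (state_space a b) r X P T.
Local Notation I := (state_space a b).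
Variables (h : R -> R) (E : set R).
Hypothesis hh : piecewise_superharmonic a b mu sigma r h E.
Implicit Types (x z u v m : R) (w : Omega).

Local Notation M w := (running_sup X (T w) w).
Local Notation layer u v := [set w | (u%:E < running_sup X (T w) w <= v%:E)%E].

Lemma running_sup_measurable : measurable_fun setT (fun w => M w).
Proof.
apply: (measurability _ (ErealGenOInfty.measurableE R)) => _ [_ [z ->] <-].
rewrite setTI preimage_itvoy; exact: (running_sup_gt_measurable hX hT z).
Qed.

Lemma layer_measurable u v : measurable (layer u v).
Proof.
rewrite (_ : layer u v = [set w | (u%:E < M w)%E] `\` [set w | (v%:E < M w)%E]).
  by apply: measurableD; apply: (running_sup_gt_measurable hX hT).
apply/seteqP; split => w /=; first by move=> /andP[uM Mv]; split => //; rewrite ltNge Mv.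
by move=> [uM /negP]; rewrite -leNgt => Mv; rewrite uM.
Qed.

Lemma layer_law x u v : I x -> I u -> I v -> x <= u -> u <= v ->
  fine (P x (layer u v)) = psi x / psi u - psi x / psi v.
Proof.
move=> Ix Iu Iv xu uv.
have Mm z := running_sup_gt_measurable hX hT z.
have lu := running_sup_law hX hmu hsigma hr hpsi hT Ix Iu xu.
have lv := running_sup_law hX hmu hsigma hr hpsi hT Ix Iv (le_trans xu uv).
rewrite (_ : layer u v = [set w | (u%:E < M w)%E] `\` [set w | (v%:E < M w)%E]); last first.
  apply/seteqP; split => w /=; first by move=> /andP[uM Mv]; split => //; rewrite ltNge Mv.
  by move=> [uM /negP]; rewrite -leNgt => Mv; rewrite uM.
have AB : [set w | (u%:E < M w)%E] `&` [set w | (v%:E < M w)%E] = [set w | (v%:E < M w)%E].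
  apply/seteqP; split => w /=; first by case.
  by move=> vM; split => //; apply: le_lt_trans vM; rewrite lee_fin.
have fin : (P x [set w | (u%:E < M w)%E] < +oo)%E.
  by apply: le_lt_trans (probability_le1 _ (Mm u)) _; exact: ltry.
have := measureD (Mm u) (Mm v) fin; rewrite AB => ->.
rewrite (_ : (psi x / psi u - psi x / psi v) = fine ((psi x / psi u)%:E - (psi x / psi v)%:E)) //.
by congr (fine (_ - _)).
Qed.

(** On the layer the supremum is finite and lies in [[m, v]], so [phi] may be replaced by its
    restriction, which is measurable on the whole line. *)
Lemma layer_measurable_fun (phi : R -> R) m v : measurable_fun `[m, v] phi ->
  measurable_fun setT (fun w => phi (fine (M w)) * \1_(layer m v) w).
Proof.
move=> mphi.
have mr : measurable_fun setT (phi \_ `[m, v]) by apply/(measurable_restrictT _ _).1.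
rewrite (_ : (fun w => _) = fun w => (phi \_ `[m, v]) (fine (M w)) * \1_(layer m v) w).
  apply: measurable_funM; last by apply: measurable_indic; exact: layer_measurable.
  apply: (measurableT_comp mr).
  by apply: measurableT_comp; [exact: fine_measurable|exact: running_sup_measurable].
apply/funext => w; rewrite indicE; case: (boolP (w \in _)) => [|_]; last by rewrite !mulr0.
rewrite inE /= => /andP[mM Mv]; rewrite !mulr1 patchE ifT // inE /= in_itv /=.
move: mM Mv; case: (running_sup X (T w) w) => [s| |] //=.
by rewrite lte_fin lee_fin => ms sv; rewrite (ltW ms).
Qed.

Lemma layer_integrable (phi : R -> R) x m v C : I x -> measurable_fun `[m, v] phi ->
  (forall z, m <= z <= v -> `|phi z| <= C) ->
  (P x).-integrable setT (EFin \o (fun w => phi (fine (M w)) * \1_(layer m v) w)).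
Proof.
move=> Ix mphi phiC; apply: (@bounded_integrable _ _ _ _ _ `|C|); first exact: layer_measurable_fun.
move=> w; rewrite indicE; case: (boolP (w \in _)) => [|_]; last by rewrite mulr0 normr0.
rewrite inE /= mulr1; case: (running_sup X (T w) w) => [s| |] //=; rewrite ?andbF //.
rewrite lte_fin lee_fin => /andP[ms sv]; apply: le_trans (ler_norm _).
by apply: phiC; rewrite (ltW ms).
Qed.

Lemma layer_bounds (phi : R -> R) x m v lo hi C : I x -> measurable_fun `[m, v] phi ->
  (forall z, m <= z <= v -> `|phi z| <= C) ->
  (forall z, m <= z <= v -> lo <= phi z <= hi) ->
  lo * fine (P x (layer m v)) <= \int[P x]_w (phi (fine (M w)) * \1_(layer m v) w)
    <= hi * fine (P x (layer m v)).
Proof.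
move=> Ix mphi phiC lohi.
have mL := layer_measurable m v.
have ip := layer_integrable Ix mphi phiC.
have i1 : (P x).-integrable setT (EFin \o (\1_(layer m v) : Omega -> R)).
  apply: (@bounded_integrable _ _ _ _ _ 1); first exact: measurable_indic.
  by move=> w; rewrite indicE; case: (_ \in _); rewrite ?normr1 ?normr0.
have ic (c : R) : (P x).-integrable setT (EFin \o (fun w => c * \1_(layer m v) w)).
  apply: (@bounded_integrable _ _ _ _ _ `|c|).
    by apply: measurable_funM; [exact: measurable_cst|exact: measurable_indic].
  by move=> w; rewrite indicE; case: (_ \in _); rewrite ?mulr1 ?mulr0 ?normr0.
rewrite -!(expectation_indic P x mL) -!RintegralZl //.
have bd w : layer m v w -> lo <= phi (fine (M w)) <= hi.
  rewrite /=; case: (running_sup X (T w) w) => [s| |] //=; rewrite ?andbF //.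
  by rewrite lte_fin lee_fin => /andP[ms sv]; apply: lohi; rewrite (ltW ms).
apply/andP; split; apply: le_Rintegral => //.
- move=> w _; rewrite indicE; case: (boolP (w \in _)) => [|_]; last by rewrite !mulr0.
  by rewrite inE !mulr1 => /bd /andP[].
- move=> w _; rewrite indicE; case: (boolP (w \in _)) => [|_]; last by rewrite !mulr0.
  by rewrite inE !mulr1 => /bd /andP[].
Qed.

Hypothesis hsigma0 : forall x, I x -> 0 < sigma x.

Lemma layer_fhat x m v : I x -> I m -> I v -> x <= m -> m <= v ->
  \int[P x]_w (fhat h psi (fine (M w)) * \1_(layer m v) w) =
    psi x * (h m / psi m - h v / psi v).
Proof.
move=> Ix Im Iv xm mv; have [psi0 psi_incr psiC psiG _] := hpsi.
have psi1 z : I z -> 0 < derive1 psi z by exact: (psi_derive_gt0 hr psi0 psi_incr psiC psiG).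
have [fE ch _ _] := hh.
have Iz z : m <= z <= v -> I z by exact: state_space_segment.
have mfh u t : m <= u -> u <= t -> t <= v -> measurable_fun `[u, t] (fhat h psi).
  move=> mu' ut tv; apply: (fhat_measurable psi1 psiC hh); apply: Iz.
    by rewrite mu' (le_trans ut tv).
  by rewrite tv (le_trans mu' ut).
have [C hC] := fhat_bounded psi1 psiC hh Im Iv mv.
have hCs u t z : m <= u -> t <= v -> u <= z <= t -> `|fhat h psi z| <= C.
  by move=> mu' tv /andP[uz zt]; apply: hC; rewrite (le_trans mu' uz) (le_trans zt tv).
pose Lam t := \int[P x]_w (fhat h psi (fine (M w)) * \1_(layer m t) w).
(* The sign makes the increments of [K] equal to the probabilities of layers. *)
pose K t := - (psi x / psi t).
pose G t := psi x * - (h t / psi t).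
(* Layers are open below and closed above, so consecutive ones partition their union and
   expectations add up. *)
have Lam_split u t : m <= u -> u <= t -> t <= v ->
    Lam t - Lam u = \int[P x]_w (fhat h psi (fine (M w)) * \1_(layer u t) w).
  move=> mu' ut tv.
  have i1 := layer_integrable Ix (mfh m u (lexx m) mu' (le_trans ut tv))
    (fun z => hCs m u z (lexx m) (le_trans ut tv)).
  have i2 := layer_integrable Ix (mfh u t mu' ut tv) (fun z => hCs u t z mu' tv).
  apply/eqP; rewrite subr_eq addrC -RintegralD //; apply/eqP.
  apply: eq_Rintegral => w _; rewrite -mulrDr; congr (_ * _); rewrite !indicE.
  rewrite -natrD; congr (_%:R).
  have memE p q : (w \in layer p q) = (p%:E < M w <= q%:E)%E by apply/idP/idP; rewrite inE.
  rewrite !memE; case: (M w) => [s| |] /=; rewrite ?andbF //.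
  rewrite !lte_fin !lee_fin.
  have [su|us] := leP s u; last first.
    by rewrite (le_lt_trans mu' us) /= add0n.
  by rewrite (le_trans su ut) andbT addn0.
have Lm : Lam m = 0.
  rewrite /Lam -[RHS](expectation_cst (P x) 0); apply: eq_Rintegral => w _.
  rewrite indicE (_ : w \in _ = false) ?mulr0 //; apply/negbTE; rewrite notin_setE /=.
  by move=> /andP[h1 h2]; have := lt_le_trans h1 h2; rewrite ltxx.
have -> : \int[P x]_w (fhat h psi (fine (M w)) * \1_(layer m v) w) = Lam v - Lam m.
  by rewrite Lm subr0.
suff -> : Lam v - Lam m = G v - G m by rewrite /G; ring.
have law u t : m <= u -> u <= t -> t <= v -> fine (P x (layer u t)) = K t - K u.
  move=> mu' ut tv; have Iu : I u by apply: Iz; rewrite mu' (le_trans ut tv).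
  have It : I t by apply: Iz; rewrite tv (le_trans mu' ut).
  by rewrite (layer_law Ix Iu It (le_trans xm mu') ut) /K opprK addrC.
have dK z : m <= z <= v -> is_derive z 1 K (psi x * (derive1 psi z / psi z ^+ 2)).
  move=> zv; have {}Iz := Iz z zv; have p0 : psi z != 0 by rewrite gt_eqF // psi0.
  have dp := derivable_is_derive1 (C2_at_derivable (psiC z Iz)).
  have dV := @is_deriveV R psi z _ 1 p0 dp.
  have dZ : is_derive z 1 (fun t => psi x * (psi t)^-1) _ := is_deriveZ (psi x) dV.
  have dn := is_deriveN dZ.
  apply: is_derive_eq; rewrite /GRing.scale /=.
  by move: (derive1 psi z) (psi z) (psi x) p0 => *; field.
apply: (@stieltjes_increment R Lam (fhat h psi) K _ G E m v C mv fE _ _ dK hC).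
- move=> u t lo hi mu' ut tv lohi; rewrite Lam_split // -(law u t mu' ut tv).
  by apply: (layer_bounds Ix (mfh u t mu' ut tv) (fun z => hCs u t z mu' tv) lohi).
- move=> u t mu' ut tv; rewrite -subr_ge0 -law //; exact: fine_ge0.
- move=> z /andP[mz zv] Ez; apply: (fhat_continuous psi1 psiC hh) => //.
  by apply: Iz; rewrite !ltW.
- move=> z zv; have {}Iz := Iz z zv; apply: cvgM; first exact: cvg_cst.
  apply: cvgN; apply: cvgM; first exact: ch.
  by apply: cvgV; [rewrite gt_eqF // psi0|exact: C2_at_continuous (psiC z Iz)].
- move=> z /andP[mz zv] Ez.
  have {}Iz : I z by apply: Iz; rewrite !ltW.
  have dr := is_derive_ratio psi0 psi1 psiC hh Iz Ez.
  have dG : is_derive z 1 G _ := is_deriveZ (psi x) dr.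
  apply: is_derive_eq; rewrite /J_density /GRing.scale /=; ring.
Qed.

End SupremumExpectation.

(** * Threshold strategies and the value function *)

Section ThresholdValue.
Context {R : realType} {d : measure_display} {Omega : measurableType d}.
Variables (a b : \bar R) (mu sigma : R -> R) (F : R -> set_system Omega)
  (X : R -> Omega -> option R) (P : R -> probability Omega R).
Hypothesis hX : diffusion a b mu sigma F X P.
Hypothesis hmu : forall x, state_space a b x -> {for x, continuous mu}.
Hypothesis hsigma : forall x, state_space a b x -> {for x, continuous sigma}.
Variables (r : R) (hr : 0 < r) (psi : R -> R).
Hypothesis hpsi : increasing_solution a b mu sigma r P X psi.
Local Notation I := (state_space a b).
Variable g : R -> R.
Hypothesis gcont : forall x, I x -> {for x, continuous g}.
Implicit Types (x y z : R) (w : Omega).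

Lemma hitting_payoff_started y z w : X 0 w = Some z -> y <= z ->
  stopped_payoff r g X (hitting_time X y) w = g z.
Proof.
move=> X0 yz; have : (hitting_time X y w <= 0%:E)%E by apply: hitting_time_le => //; exists z.
have := hitting_time_ge0 X y w; rewrite /stopped_payoff.
case: (hitting_time X y w) => [t| |] //; rewrite !lee_fin => t0 t0'.
have -> : t = 0 by apply/eqP; rewrite eq_le t0' t0.
by rewrite mulr0 oppr0 expR0 mul1r X0.
Qed.

Lemma hitting_payoff_later y w : (forall z, X 0 w = Some z -> z < y) ->
  stopped_payoff r g X (hitting_time X y) w = discount r (hitting_time X y w) * g y.
Proof.
move=> X0; rewrite /stopped_payoff /discount.
case ht : (hitting_time X y w) => [t| |]; rewrite ?mul0r //.
have [t0 [z Xt yz] _] := hitting_time_attained hX ht.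
have t1 : 0 < t.
  rewrite lt_neqAle t0 andbT; apply/eqP => e; rewrite -e in Xt.
  by have := X0 z Xt; rewrite ltNge yz.
by rewrite (hitting_time_value hX ht t1).
Qed.

(** A path starting at or above [y] is paid at once, any other is paid exactly [g y] at a finite
    hit. [g] is cut off to [I], outside of which nothing is known about it. *)
Lemma hitting_payoff_measurable y : I y ->
  measurable_fun setT (fun w => (stopped_payoff r g X (hitting_time X y) w)%:E).
Proof.
move=> Iy; apply/measurable_EFinP.
pose B := state_in X 0 `[y, +oo[.
have mB : measurable B by apply: (state_in_measurable hX) => //; exact: measurable_itv.
have mI : measurable (I : set R) by apply: open_measurable; exact: state_space_open.
have mg : measurable_fun setT (g \_ I).
  have mgI : measurable_fun (I : set R) g.
    apply: subspace_continuous_measurable_fun => //.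
    by apply: continuous_in_subspaceT => z; rewrite inE; exact: gcont.
  exact: ((measurable_restrictT g mI).1 mgI).
rewrite (_ : stopped_payoff r g X (hitting_time X y) = fun w =>
    path_value X (g \_ I) 0 w * \1_B w + discount r (hitting_time X y w) * g y * \1_(~` B) w).
  apply: measurable_funD; apply: measurable_funM.
  - exact: (path_value_measurable hX).
  - exact: measurable_indic.
  - apply: measurable_funM; last exact: measurable_cst.
    apply: (discount_measurable hr); first by move=> w; exact: hitting_time_ge0.
    by move=> t t0; exact: (hitting_time_measurable hX).
  - by apply: measurable_indic; exact: measurableC.
apply/funext => w; rewrite !indicE.
have [Bw|Bw] := pselect (B w).
  rewrite mem_set // memNset ?mulr0 ?mulr1 ?addr0; last by move=> /(_ Bw).
  move: Bw => /state_in_SomeP [z X0]; rewrite /= in_itv /= andbT => yz.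
  rewrite (hitting_payoff_started X0 yz) /path_value X0 /= patchE ifT //.
  by rewrite inE; exact: (dif_state hX (lexx 0) X0).
rewrite memNset // mulr0 add0r mem_set ?mulr1 //.
apply: hitting_payoff_later => z X0; rewrite ltNge; apply/negP => yz; apply: Bw.
by apply/state_in_SomeP; exists z => //=; rewrite in_itv /= yz.
Qed.

Lemma V_thresholdE x y : I x -> I y ->
  V_threshold r g X P y x = (V_threshold_explicit g psi y x)%:E.
Proof.
move=> Ix Iy; have mY := hitting_payoff_measurable Iy.
have aeX := start_ae hX Ix.
rewrite /V_threshold /V_threshold_explicit; case: ltP => [xy|yx].
  have mD : measurable_fun setT (fun w => discount r (hitting_time X y w)).
    apply: (discount_measurable hr); first by move=> w; exact: hitting_time_ge0.
    by move=> t t0; exact: (hitting_time_measurable hX).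
  have iD : (P x).-integrable setT (EFin \o (fun w => discount r (hitting_time X y w))).
    apply: (@bounded_integrable _ _ _ _ _ 1) => // w.
    rewrite ger0_norm ?discount_ge0 //; apply: (discount_le1 hr); exact: hitting_time_ge0.
  have -> : psi x * (g y / psi y) = \int[P x]_w (g y * discount r (hitting_time X y w)).
    rewrite RintegralZl // (hitting_expectation hX hmu hsigma hr hpsi Ix Iy (ltW xy)).
    by rewrite mulrCA.
  have iZ : (P x).-integrable setT (EFin \o (fun w => g y * discount r (hitting_time X y w))).
    apply: (@bounded_integrable _ _ _ _ _ `|g y|).
      by apply: measurable_funM => //; exact: measurable_cst.
    move=> w; rewrite normrM ler_piMr // ger0_norm ?discount_ge0 //.
    by apply: (discount_le1 hr); exact: hitting_time_ge0.
  rewrite /Rintegral fineK; last exact: integrable_fin_num.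
  apply: ae_eq_integral => //; first exact: measurable_int iZ.
  apply: filterS aeX => w X0 _; congr EFin; rewrite mulrC.
  by apply: hitting_payoff_later => z; rewrite X0 => -[<-].
rewrite -(expectation_cst (P x) (g x)) /Rintegral fineK; last first.
  by apply: integrable_fin_num => //; apply: (@bounded_integrable _ _ _ _ _ `|g x|).
apply: ae_eq_integral => //.
by apply: filterS aeX => w X0 _; congr EFin; exact: hitting_payoff_started X0 yx.
Qed.

(** Pointwise the payoff of [g] is at most the nonnegative payoff of [h], so [integral_le_ge0] and
    the supermartingale inequality bound every stopping time; the hitting time of [y] attains the
    bound by assumption. *)
Lemma value_functionE (h : R -> R) (E : set R) x y :
  piecewise_superharmonic a b mu sigma r h E -> (forall z, I z -> 0 <= h z) ->
  (forall z, I z -> g z <= h z) -> I x -> I y -> V_threshold r g X P y x = (h x)%:E ->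
  value_function r g F X P x = (h x)%:E.
Proof.
move=> hh h0 gh Ix Iy Vy; apply/eqP; rewrite eq_le; apply/andP; split.
  apply: ge_ereal_sup => _ [tau st <-].
  apply: le_trans (superharmonic_stopping hX hmu hsigma (ltW hr) hh h0 Ix st).
  have [tau0 _] := st.
  have payoff_ge0 (f : R -> R) w : (forall z, I z -> 0 <= f z) -> 0 <= stopped_payoff r f X tau w.
    move=> f0; rewrite /stopped_payoff; case E1 : (tau w) => [t| |] //.
    have t0 : 0 <= t by rewrite -lee_fin -E1.
    rewrite mulr_ge0 ?expR_ge0 //; case Xt : (X t w) => [z|] //=.
    by apply: f0; exact: (dif_state hX t0 Xt).
  apply: integral_le_ge0 => w; rewrite lee_fin; first exact: payoff_ge0.
  have hg0 z : I z -> 0 <= h z - g z by move=> Iz; rewrite subr_ge0 gh.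
  have := payoff_ge0 _ w hg0; rewrite /stopped_payoff.
  case: (tau w) => [t| |] //; case: (X t w) => [z|] //=.
  by rewrite mulrBr subr_ge0.
by rewrite -Vy; apply: ereal_sup_ubound; exists (hitting_time X y) => //; exact: (hitting_time_stopping hX).
Qed.

End ThresholdValue.

(** * The integral and the running-supremum representations *)

Section Representation.
Context {R : realType} {d : measure_display} {Omega : measurableType d}.
Variables (a b : \bar R) (mu sigma : R -> R) (F : R -> set_system Omega)
  (X : R -> Omega -> option R) (P : R -> probability Omega R).
Hypothesis hX : diffusion a b mu sigma F X P.
Hypothesis hmu : forall x, state_space a b x -> {for x, continuous mu}.
Hypothesis hsigma : forall x, state_space a b x -> {for x, continuous sigma}.
Hypothesis hsigma0 : forall x, state_space a b x -> 0 < sigma x.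
Variables (r : R) (hr : 0 < r) (psi : R -> R) (T : Omega -> R).
Hypothesis hpsi : increasing_solution a b mu sigma r P X psi.
Hypothesis hT : independent_exponential_time (state_space a b) r X P T.
Local Notation I := (state_space a b).
Implicit Types (x z : R) (w : Omega).
Variables (g h : R -> R) (E : set R) (y : R).
Hypothesis hh : piecewise_superharmonic a b mu sigma r h E.
Hypothesis h0 : forall z, I z -> 0 <= h z.
Hypothesis Iy : I y.
Hypothesis hgy : forall z, y <= z -> h z = g z.
Hypothesis W0 : 0 <= h y * derive1 psi y - psi y * right_derive h y.
Hypothesis glim : g z / psi z @[z --> upper_end I] --> 0.

Local Notation M w := (running_sup X (T w) w).
Local Notation layer u v := [set w | (u%:E < running_sup X (T w) w <= v%:E)%E].

Let psi_gt0 z : I z -> 0 < psi z. Proof. by have [+ _ _ _ _] := hpsi; apply. Qed.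
Let psiC z : I z -> C2_at psi z. Proof. by have [_ _ + _ _] := hpsi; apply. Qed.
Let psiG z : I z -> generator_r mu sigma r psi z = 0.
Proof. by have [_ _ _ + _] := hpsi; apply. Qed.
Let psi1_gt0 z : I z -> 0 < derive1 psi z.
Proof. by have [_ incr _ _ _] := hpsi; exact: (psi_derive_gt0 hr psi_gt0 incr psiC psiG). Qed.

Lemma upper_end_proper : ProperFilter (upper_end I).
Proof.
apply: filter_from_proper; last by move=> c /state_space_upper [z Iz cz]; exists z.
apply: filter_from_filter; first by exists y.
move=> i j Ii Ij; exists (Num.max i j); first by rewrite maxEle; case: ifP.
by move=> z /= [Iz]; rewrite gt_max => /andP[iz jz]; split.
Qed.

(** Right derivatives only look to the right, where [h] and [g] agree; at [z = y] itself the left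
    derivatives may differ. *)
Lemma fhat_eq z : I z -> y <= z -> fhat g psi z = fhat h psi z.
Proof.
move=> Iz yz; rewrite /fhat hgy //; congr (_ - _ * _ / _).
have [_ ch _ _] := hh.
have nz : \forall t \near z^', derivable h t 1.
  by apply: filterS (psh_dnbhs_C2 hh Iz) => t; exact: C2_at_derivable.
have cs := cvg_right_slope (ch z Iz) (dnbhs_at_right nz) (psh_right_derive hh Iz).
apply: cvg_lim => //; apply: near_eq_cvg_to cs.
near=> t; have t0 : 0 < t by near: t; exact: nbhs_right_gt.
by rewrite !hgy //; lra.
Unshelve. all: by end_near.
Qed.

Lemma fhat_ge0 z : I z -> y <= z -> 0 <= fhat h psi z.
Proof.
move=> Iz yz; rewrite (fhat_wronskian psi1_gt0) // divr_ge0 ?(ltW (psi1_gt0 Iz)) //.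
apply: (wronskian_ge0 hmu hsigma hsigma0 psi_gt0 psiC psiG hh Iy Iz yz) => // t It.
exact/ltW/psi_gt0.
Qed.

Lemma J_partialE x z : I x -> I z -> Num.max x y <= z ->
  J_partial g psi y x z = psi x * (h (Num.max x y) / psi (Num.max x y) - g z / psi z).
Proof.
move=> Ix Iz xyz; have Im : I (Num.max x y) by rewrite maxEle; case: ifP.
have yz : y <= z by apply: le_trans xyz; rewrite le_max lexx orbT.
rewrite -(hgy yz) -(J_density_integral psi_gt0 psi1_gt0 psiC hh Im Iz xyz) /J_partial.
congr (_ * _); apply: eq_Rintegral => t; rewrite inE /= in_itv /= => /andP[mt tz].
rewrite /J_density fhat_eq //; first by apply: state_space_segment Im Iz _; rewrite mt.
by apply: le_trans mt; rewrite le_max lexx orbT.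
Qed.

Lemma J_partial_cvg x : I x ->
  J_partial g psi y x z @[z --> upper_end I] -->
    psi x * (h (Num.max x y) / psi (Num.max x y)).
Proof.
move=> Ix; have Im : I (Num.max x y) by rewrite maxEle; case: ifP.
have pf := upper_end_proper.
set m := Num.max x y in Im *.
have c1 : psi x * (h m / psi m - g z / psi z) @[z --> upper_end I] -->
    psi x * (h m / psi m - 0).
  by apply: cvgM; [exact: cvg_cst|apply: cvgB => //; exact: cvg_cst].
rewrite subr0 in c1; apply: cvg_trans c1; apply: near_eq_cvg.
by exists m => // z /= [Iz mz]; rewrite J_partialE // ltW.
Qed.

Lemma running_sup_eq_measurable z : measurable [set w | M w = z%:E].
Proof.
have := running_sup_measurable hX hT measurableT (emeasurable_set1 z%:E).
by rewrite setTI.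
Qed.

(** For [x < y] the event is [{M = y}], a null set because the law of the supremum is continuous in
    the level. For [y <= x] it lies in [{M <= x}], null because the probability of exceeding the
    start is [psi x / psi x]. It allows replacing [[y, b)] by the open-ended range above
    [Num.max x y]. *)
Lemma running_sup_early x : I x ->
  {ae P x, forall w, ~ (y%:E <= M w <= (Num.max x y)%:E)%E}.
Proof.
move=> Ix; have [xy|yx] := ltP x y.
  pose N := [set w | M w = y%:E].
  have mN : measurable N by exact: running_sup_eq_measurable.
  have N0 : fine (P x N) <= 0.
    have cz : psi x / psi z - psi x / psi y @[z --> y^'-] --> psi x / psi y - psi x / psi y.
      apply: cvgB; last exact: cvg_cst.
      apply: cvgM; first exact: cvg_cst.
      apply: cvgV; first by rewrite gt_eqF // psi_gt0.
      by apply: cvg_at_left_filter; exact: C2_at_continuous (psiC Iy).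
    rewrite subrr in cz; apply: (cvg_ge_bound cz); near=> z.
    have zy : z < y by near: z; exact: nbhs_left_lt.
    have xz : x <= z by near: z; exact: nbhs_left_ge.
    have Iz : I z by apply: state_space_segment Ix Iy _; rewrite xz ltW.
    rewrite -(layer_law hX hmu hsigma hr hpsi hT Ix Iz Iy xz (ltW zy)).
    have mL := layer_measurable hX hT z y.
    apply: fine_le; try exact: fin_num_measure.
    apply: le_measure; rewrite ?inE // => w; rewrite /N /= => ->.
    by rewrite lte_fin zy lexx.
  exists N; split => //.
    have PN : P x N \is a fin_num by exact: fin_num_measure.
    rewrite -[LHS]fineK //; congr EFin; apply/eqP; rewrite eq_le N0.
    exact: fine_ge0.
  by move=> w /= /contrapT /andP[h1 h2]; apply/eqP; rewrite eq_le h1 h2.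
have law := running_sup_law hX hmu hsigma hr hpsi hT Ix Ix (lexx x).
have mA := running_sup_gt_measurable hX hT x.
exists (~` [set w | (x%:E < M w)%E]); split; first exact: measurableC.
  rewrite probability_setC // law divff ?subee //.
  by rewrite gt_eqF // psi_gt0.
by move=> w /= /contrapT /andP[_ Mx] xM; move: xM; rewrite ltNge Mx.
Unshelve. all: by end_near.
Qed.

Let tail m w := fhat h psi (fine (M w)) * \1_[set w | (m%:E < M w < b)%E] w.

Let in_tail m w : I m -> (m%:E < M w < b)%E -> I (fine (M w)) /\ m < fine (M w).
Proof.
move=> /andP[am _]; case: (running_sup X (T w) w) => [s| |]; [|by move=> /andP[_]; rewrite ltNge leey|by move=> /andP[]].
rewrite lte_fin => /andP[ms sb]; split => //.
by rewrite /state_space /= sb andbT (lt_trans am).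
Qed.

Let tail_ge0 m w : I m -> y <= m -> 0 <= tail m w.
Proof.
move=> Im ym; rewrite /tail indicE; case: (boolP (w \in _)) => [|_]; last by rewrite mulr0.
rewrite inE /= => /(in_tail Im) [Is ms]; rewrite mulr1 fhat_ge0 //.
exact: le_trans ym (ltW ms).
Qed.

Let layer_tail m v w : I v -> layer m v w -> (m%:E < M w < b)%E.
Proof. by move=> /andP[_ vb] /= /andP[mM Mv]; rewrite mM (le_lt_trans Mv). Qed.

Let layer_le_tail m v w : I m -> I v -> y <= m ->
  fhat h psi (fine (M w)) * \1_(layer m v) w <= tail m w.
Proof.
move=> Im Iv ym; have t0 := tail_ge0 w Im ym.
rewrite indicE; case: (boolP (w \in _)) => [|_]; last by rewrite mulr0.
by rewrite inE => /(layer_tail Iv) mb; rewrite /tail indicE mem_set.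
Qed.

Let layer_ge0 m v w : I m -> I v -> y <= m ->
  0 <= fhat h psi (fine (M w)) * \1_(layer m v) w.
Proof.
move=> Im Iv ym; rewrite indicE; case: (boolP (w \in _)) => [|_]; last by rewrite mulr0.
rewrite inE => /(layer_tail Iv) /(in_tail Im) [Is ms]; rewrite mulr1 fhat_ge0 //.
exact: le_trans ym (ltW ms).
Qed.

Let layer_eq_tail m (cs : nat -> R) w : I m ->
  (forall z, I z -> exists N, forall n, (N <= n)%N -> z < cs n) -> (forall n, I (cs n)) ->
  exists N, forall n, (N <= n)%N ->
    fhat h psi (fine (M w)) * \1_(layer m (cs n)) w = tail m w.
Proof.
move=> Im csup Ics; have [mb|mb] := boolP (m%:E < M w < b)%E.
  have [Is ms] := in_tail Im mb; have [N hN] := csup _ Is; exists N => n /hN sn.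
  congr (_ * _); rewrite !indicE !mem_set //=.
  move: mb sn; case: (running_sup X (T w) w) => [s| |];
    [|by move=> /andP[_]; rewrite ltNge leey|by move=> /andP[]].
  by rewrite lee_fin => /andP[-> _] /ltW.
exists 0%N => n _; rewrite /tail !indicE !memNset ?mulr0 //=; first exact/negP.
by move=> /(layer_tail (Ics n)); exact/negP.
Qed.

Let layer_mfun m v : I m -> I v ->
  measurable_fun setT (fun w => fhat h psi (fine (M w)) * \1_(layer m v) w).
Proof.
by move=> Im Iv; apply: (layer_measurable_fun hX hT); exact: (fhat_measurable psi1_gt0 psiC hh).
Qed.

Let tail_measurable m : I m -> measurable_fun setT (tail m).
Proof.
move=> Im; have [cs [Ics csup]] := upper_sequence Im.
apply: (@measurable_fun_cvg _ _ _ setT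
    (fun n w => fhat h psi (fine (M w)) * \1_(layer m (cs n)) w)).
  by move=> n; apply: layer_mfun => //; exact: (Ics n).1.
move=> w _; have [N hN] := layer_eq_tail w Im csup (fun n => (Ics n).1).
by apply: cvg_near_cst; exists N => // n /hN.
Qed.

(** Layers increase to the tail as [v] tends to [b]. Fatou gives one inequality, since
    [h v / psi v >= 0]. For the other, a layer is below the tail because [fhat >= 0], and the
    missing [psi x * (h v / psi v)] is made smaller than [e]. *)
Lemma tail_expectation x m : I x -> I m -> x <= m -> y <= m ->
  (\int[P x]_w (tail m w)%:E = (psi x * (h m / psi m))%:E)%E.
Proof.
move=> Ix Im xm ym; have px := psi_gt0 Ix.
have layerE v : I v -> m <= v ->
    (\int[P x]_w (fhat h psi (fine (M w)) * \1_(layer m v) w)%:E =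
     (psi x * (h m / psi m - h v / psi v))%:E)%E.
  move=> Iv mv; have [C hC] := fhat_bounded psi1_gt0 psiC hh Im Iv mv.
  have il := layer_integrable hX hT Ix (fhat_measurable psi1_gt0 psiC hh Im Iv) hC.
  rewrite -(layer_fhat hX hmu hsigma hr hpsi hT hh Ix Im Iv xm mv) /Rintegral fineK //.
  exact: integrable_fin_num.
apply/eqP; rewrite eq_le; apply/andP; split.
  have [cs [Ics csup]] := upper_sequence Im.
  apply: (@le_trans _ _ (\int[P x]_w limn_einf (fun n =>
      (fhat h psi (fine (M w)) * \1_(layer m (cs n)) w)%:E))%E).
    apply: ge0_integral_mono => w; first by rewrite lee_fin tail_ge0.
    have [N hN] := layer_eq_tail w Im csup (fun n => (Ics n).1).
    by apply: (@limn_einf_ge _ _ _ N) => n /hN ->.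
  apply: le_trans; first apply: fatou => //.
  - by move=> n; apply/measurable_EFinP; apply: layer_mfun => //; exact: (Ics n).1.
  - by move=> n w _; rewrite lee_fin layer_ge0 //; exact: (Ics n).1.
  apply: limn_einf_le => n; have [In mn] := Ics n.
  rewrite layerE // lee_fin ler_pM2l // gerBl divr_ge0 ?h0 //.
  exact/ltW/psi_gt0.
apply/lee_addgt0Pr => e e0; have ex0 : 0 < e / psi x by rewrite divr_gt0.
have [c Ic hc] : upper_end I [set z | `|0 - g z / psi z| <= e / psi x].
  by have pf := upper_end_proper; move: glim => /cvgrPdist_le /(_ _ ex0).
have Imc : I (Num.max m c) by rewrite maxEle; case: ifP.
have [v Iv] := state_space_upper Imc; rewrite gt_max => /andP[mv cv].
apply: (@le_trans _ _ (\int[P x]_w (fhat h psi (fine (M w)) * \1_(layer m v) w)%:E + e%:E)%E).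
  rewrite layerE ?(ltW mv) // -EFinD lee_fin.
  have := hc v (conj Iv cv); rewrite /= sub0r normrN -(hgy (le_trans ym (ltW mv))) => hv.
  rewrite mulrBr -addrA lerDl addrC subr_ge0 mulrC -ler_pdivlMr //.
  exact: le_trans (ler_norm _) hv.
rewrite leeD2r //; apply: ge0_integral_mono => w; rewrite lee_fin.
  exact: layer_ge0.
exact: layer_le_tail.
Qed.

Lemma J_expectationE x : I x ->
  J_expectation b g psi X P T y x = (psi x * (h (Num.max x y) / psi (Num.max x y)))%:E.
Proof.
move=> Ix; have Im : I (Num.max x y) by rewrite maxEle; case: ifP.
have [xm ym] : x <= Num.max x y /\ y <= Num.max x y by rewrite !le_max !lexx orbT.
rewrite -(tail_expectation Ix Im xm ym).
pose N := [set w | M w = y%:E].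
have mN : measurable N by exact: running_sup_eq_measurable.
(* [tail] is strict at its lower end while the indicator in [J_expectation] includes [y], so the
   contribution of [{M = y}] is split off; it is null. *)
have integrandE w : fhat g psi (fine (M w)) * \1_[set m' | (y%:E <= m' < b)%E] (M w) =
    tail y w + fhat h psi y * \1_N w.
  have /andP[_ yb] := Iy.
  have [MN|MN] := pselect (M w = y%:E).
    rewrite /tail !indicE MN mem_set /= ?lexx ?yb // memNset /=; last by rewrite MN ltxx.
    by rewrite mem_set // !mulr1 mulr0 add0r fhat_eq.
  rewrite [in X in _ + X]indicE memNset // mulr0 addr0 /tail !indicE.
  have e : (y%:E <= M w < b)%E = (y%:E < M w < b)%E.
    by rewrite le_eqVlt; case: eqP => // e; case: MN.
  have [mb|mb] := boolP (y%:E < M w < b)%E.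
    have [Is ys] := in_tail Iy mb.
    by rewrite !mem_set //= ?e // fhat_eq // ltW.
  by rewrite !memNset ?mulr0 //= ?e; exact/negP.
rewrite /J_expectation /=; under eq_integral do rewrite integrandE.
apply: ae_eq_integral => //.
- apply/measurable_EFinP; apply: measurable_funD; first exact: tail_measurable.
  by apply: measurable_funM; [exact: measurable_cst|exact: measurable_indic].
- by apply/measurable_EFinP; exact: tail_measurable.
apply: filterS (running_sup_early Ix) => w nw _; congr EFin.
have MN : M w <> y%:E by move=> e; apply: nw; rewrite e lexx lee_fin.
rewrite [in X in _ + X]indicE memNset // mulr0 addr0 /tail !indicE; congr (_ * _%:R).
congr nat_of_bool; apply/idP/idP; rewrite !inE /= => /andP[h1 ->]; rewrite andbT.
  by rewrite ltNge; apply/negP => h2; apply: nw; rewrite (ltW h1).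
by apply: le_lt_trans h1; rewrite lee_fin.
Qed.

End Representation.

Theorem theorem3p6 (R : realType) (d : measure_display)
  (Omega : measurableType d) (a b : \bar R) (mu sigma : R -> R)
  (F : R -> set_system Omega) (X : R -> Omega -> option R)
  (P : R -> probability Omega R) (T : Omega -> R) (r : R)
  (psi g : R -> R) (xg : R) (Pts : set R) (ystar : R)
  (hmu : forall x, state_space a b x -> {for x, continuous mu})
  (hsigma : forall x, state_space a b x -> {for x, continuous sigma})
  (hsigma0 : forall x, state_space a b x -> 0 < sigma x)
  (hX : diffusion a b mu sigma F X P)
  (hr : 0 < r)
  (hT : independent_exponential_time (state_space a b) r X P T)
  (hpsi : increasing_solution a b mu sigma r P X psi)
  (hg : piecewise_C2 (state_space a b) Pts g)
  (hxg : state_space a b xg)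
  (hgpos : forall x, state_space a b x -> (0 < g x <-> xg < x))
  (hgsup : integrable_sup_payoff (state_space a b) r g X P)
  (hystar : state_space a b ystar)
  (hargmax : forall x, state_space a b x -> g x / psi x <= g ystar / psi ystar)
  (hii : forall x, state_space a b x -> ystar <= x -> ~ Pts x ->
     generator_r mu sigma r g x <= 0)
  (hiii : forall x, state_space a b x -> ystar <= x -> Pts x ->
     right_derive g x <= left_derive g x)
  (hlim : g x / psi x @[x --> upper_end (state_space a b)] --> 0)
  (hlsc : lower_semicontinuous_on
     [set x | state_space a b x /\ ystar <= x] (right_derive g)) :
  forall x, state_space a b x ->
    [/\ value_function r g F X P x = V_threshold r g X P ystar x,
        V_threshold r g X P ystar x = (V_threshold_explicit g psi ystar x)%:E,
        cvg (J_partial g psi ystar x d' @[d' --> upper_end (state_space a b)]),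
        V_threshold_explicit g psi ystar x =
          J_integral (state_space a b) g psi ystar x &
        J_expectation b g psi X P T ystar x =
          (J_integral (state_space a b) g psi ystar x)%:E].
Proof.
have [psi_gt0 _ psiC psiG _] := hpsi.
have [_ _ gcont _ _] := hg.
set h := V_threshold_explicit g psi ystar.
have hh := threshold_superharmonic psi_gt0 psiC psiG hg hystar hargmax hii hiii.
(* Some point above [xg] has positive payoff, and the maximal ratio dominates its ratio. *)
have gy0 : 0 < g ystar.
  have [z Iz xz] := state_space_upper hxg.
  have gz : 0 < g z / psi z by rewrite divr_gt0 ?psi_gt0 //; apply/(hgpos z Iz).
  by have := lt_le_trans gz (hargmax z Iz); rewrite pmulr_lgt0 // invr_gt0 psi_gt0.
have h0 z : state_space a b z -> 0 <= h z.
  move=> Iz; rewrite /h /V_threshold_explicit; case: ltP => [_|yz].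
    by rewrite mulr_ge0 ?divr_ge0 ?(ltW gy0) ?ltW ?psi_gt0.
  by apply/ltW/(hgpos z Iz); apply: lt_le_trans yz; apply/(hgpos _ hystar).
have gh z : state_space a b z -> g z <= h z by apply: le_threshold; [exact: psi_gt0|exact: hystar|exact: hargmax].
have hgy z : ystar <= z -> h z = g z by exact: threshold_right.
have W0 : 0 <= h ystar * derive1 psi ystar - psi ystar * right_derive h ystar.
  have cg : derive1 g z @[z --> ystar^'+] --> right_derive h ystar.
    apply: near_eq_cvg_to (psh_right_derive hh hystar); near=> z.
    by have [] := @threshold_derive_right R psi g ystar z _; first by near: z; exact: nbhs_right_gt.
  have := right_derive_ystar psi_gt0 psiC hg hystar hargmax cg.
  have py := psi_gt0 _ hystar.
  rewrite hgy // mulrAC ler_pdivlMr // subr_ge0 mulrC => le; lra.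
move=> x Ix.
have VE := V_thresholdE hX hmu hsigma hr hpsi gcont Ix hystar.
(* Left of [ystar] the ratio [h / psi] is constant, and right of it the maximum is [x] itself, so
   one formula serves both cases. *)
have m_eq : h x = psi x * (h (Num.max x ystar) / psi (Num.max x ystar)).
  rewrite /h /V_threshold_explicit; case: (ltP x ystar) => [xy|yx]; first by rewrite ltxx.
  by rewrite ltNge yx /= mulrCA divff ?mulr1 // gt_eqF // psi_gt0.
have Jc := J_partial_cvg hr hpsi hh hystar hgy hlim Ix.
have JE : J_integral (state_space a b) g psi ystar x = h x.
  have pf := upper_end_proper hystar.
  by rewrite m_eq; apply: cvg_lim.
split.
- rewrite VE; apply: (value_functionE hX hmu hsigma hr hh h0 gh Ix hystar); exact: VE.
- exact: VE.
- by apply/cvg_ex; exists (psi x * (h (Num.max x ystar) / psi (Num.max x ystar))).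
- by rewrite JE.
- rewrite JE m_eq.
  exact: (J_expectationE hX hmu hsigma hsigma0 hr hpsi hT hh h0 hystar hgy W0 hlim Ix).
Unshelve. all: by end_near.
Qed.
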